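(* Let $(\phi_t)$ be a non-elliptic semigroup in $\mathbb{D}$ with Denjoy-Wolff point $\tau\in\partial\mathbb{D}$. Then the function $$[0,+\infty)\times\mathbb{D}\ni(t,z)\longmapsto\phi_t(z)\in\mathbb{D}$$ is real analytic, and there exists a unique holomorphic function $G:\mathbb{D}\to\mathbb{C}$ such that $$\frac{\partial\phi_t(z)}{\partial t}=G(\phi_t(z)),\qquad z\in\mathbb{D},\ t\in[0,+\infty).$$ Moreover, let $h$ be the Königs function of $(\phi_t)$. (1) For all $z\in\mathbb{D}$, $G(z)=\dfrac{i}{h'(z)}$. (2) If $$p(z):=\frac{i}{h'(z)(z-\tau)(\overline{\tau}z-1)},\qquad z\in\mathbb{D},$$ then $G(z)=(z-\tau)(\overline{\tau}z-1)p(z)$ and $\operatorname{Re}p(z)\ge0$ for all $z\in\mathbb{D}$.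
   Context: $\mathbb{D}=\{z\in\mathbb{C}:|z|<1\}$. A semigroup $(\phi_t)$ in $\mathbb{D}$ is a continuous homomorphism $t\mapsto\phi_t$ from the additive semigroup $[0,+\infty)$ to the semigroup (under composition) of holomorphic self-maps of $\mathbb{D}$ with the topology of uniform convergence on compacta. It is elliptic if there is $x\in\mathbb{D}$ with $\phi_t(x)=x$ for all $t\ge0$. If it is not elliptic, there is a unique point $\tau\in\partial\mathbb{D}$ (the Denjoy-Wolff point) for which there exists $\lambda\ge0$ (the spectral value) with $\liminf_{z\to\tau}\frac{1-|\phi_t(z)|}{1-|z|}=e^{-\lambda t}$ for all $t\ge0$; moreover $\phi_t(z)\to\tau$ as $t\to+\infty$ for every $z\in\mathbb{D}$. A holomorphic model for $(\phi_t)$ is a triple $(\Omega,h,\psi_t)$ where $\Omega$ is a Riemann surface, $h:\mathbb{D}\to\Omega$ is univalent (holomorphic and injective), and $(\psi_t)$ is a continuous group of automorphisms of $\Omega$ such that $h\circ\phi_t=\psi_t\circ h$ for all $t\ge0$ and $\bigcup_{t\ge0}\psi_{-t}(h(\mathbb{D}))=\Omega$. For a non-elliptic semigroup, a canonical model is a holomorphic model of the form $(\Omega,h,z\mapsto z+it)$ where $\Omega$ is one of: $\{\zeta\in\mathbb{C}:0<\operatorname{Re}\zeta<\pi/\lambda\}$ (when the spectral value satisfies $\lambda>0$), $\{\operatorname{Re}\zeta>0\}$, $\{\operatorname{Re}\zeta<0\}$, or $\mathbb{C}$ (when $\lambda=0$). Every non-elliptic semigroup has a canonical model; its map $h$ is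 called the Königs function of $(\phi_t)$ and is unique up to an additive constant. *)

(* Defs.v *)
From Stdlib Require Export Reals List.
From Coquelicot Require Export Coquelicot.

Open Scope R_scope.

(* Maps defined on a subset U of C (or of R x C) are represented by total
   functions; every notion below only depends on their values on U. *)

Definition disc (z : C) : Prop := Cmod z < 1.

(* Meant for open U: the complex derivative at z looks at a neighbourhood of z. *)
Definition holomorphic_on (U : C -> Prop) (f : C -> C) : Prop :=
  forall z, U z -> ex_derive (K := C_AbsRing) (V := C_NormedModule) f z.

Definition compact_set {T : UniformSpace} (K : T -> Prop) : Prop :=
  forall (I : Type) (O : I -> T -> Prop),
    (forall i, open (O i)) ->
    (forall x, K x -> exists i, O i x) ->
    exists l : list I, forall x, K x -> exists i, In i l /\ O i x.

(* t |-> phi t is a continuous (monoid) homomorphism from the additive monoid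
   T of reals to the holomorphic self-maps of U under composition, for the
   topology of uniform convergence on compacta. *)
Record continuous_hom (T : R -> Prop) (U : C -> Prop) (phi : R -> C -> C)
  : Prop := {
  hom_holomorphic : forall t, T t -> holomorphic_on U (phi t);
  hom_maps : forall t z, T t -> U z -> U (phi t z);
  hom_zero : forall z, U z -> phi 0 z = z;
  hom_add : forall s t z, T s -> T t -> U z -> phi (s + t) z = phi s (phi t z);
  hom_continuous : forall (t0 : R) (K : C -> Prop),
    T t0 -> compact_set (T := C_UniformSpace) K -> (forall z, K z -> U z) ->
    forall eps : posreal,
      within T (locally t0)
        (fun t => forall z, K z -> Cmod (phi t z - phi t0 z) < eps)
}.

Definition semigroup (phi : R -> C -> C) : Prop :=
  continuous_hom (Rle 0) disc phi.

Definition elliptic (phi : R -> C -> C) : Prop :=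
  exists x, disc x /\ forall t, 0 <= t -> phi t x = x.

(* Analogue of is_LimInf_seq for a finite limit along an arbitrary filter. *)
Definition is_liminf {T : Type} (F : (T -> Prop) -> Prop) (f : T -> R) (l : R)
  : Prop :=
  forall eps : posreal,
    (forall P : T -> Prop, F P -> exists x, P x /\ f x < l + eps) /\
    F (fun x => l - eps < f x).

Definition denjoy_wolff_spectral
  (phi : R -> C -> C) (tau : C) (lambda : R) : Prop :=
  Cmod tau = 1 /\ 0 <= lambda /\
  forall t, 0 <= t ->
    is_liminf (within disc (locally (T := C_UniformSpace) tau))
      (fun z => (1 - Cmod (phi t z)) / (1 - Cmod z)) (exp (- lambda * t)).

Definition denjoy_wolff_point (phi : R -> C -> C) (tau : C) : Prop :=
  exists lambda, denjoy_wolff_spectral phi tau lambda.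

Definition spectral_value (phi : R -> C -> C) (lambda : R) : Prop :=
  exists tau, denjoy_wolff_spectral phi tau lambda.

(* Holomorphic models whose Riemann surface Omega is a domain of C; only the
   canonical domains below are substituted for Omega.  Each psi t is an
   automorphism of Omega because psi (- t) is its inverse. *)
Record holomorphic_model (phi : R -> C -> C) (Omega : C -> Prop)
  (h : C -> C) (psi : R -> C -> C) : Prop := {
  model_holomorphic : holomorphic_on disc h;
  model_injective : forall z w, disc z -> disc w -> h z = h w -> z = w;
  model_maps : forall z, disc z -> Omega (h z);
  model_group : continuous_hom (fun _ => True) Omega psi;
  model_intertwines : forall t z, 0 <= t -> disc z ->
    h (phi t z) = psi t (h z);
  model_exhausts : forall w, Omega w <->
    exists t z, 0 <= t /\ disc z /\ w = psi (- t) (h z)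
}.

Inductive canonical_domain : R -> (C -> Prop) -> Prop :=
| canonical_strip : forall lambda, 0 < lambda ->
    canonical_domain lambda (fun w => 0 < Re w < PI / lambda)
| canonical_right_half_plane : canonical_domain 0 (fun w => 0 < Re w)
| canonical_left_half_plane : canonical_domain 0 (fun w => Re w < 0)
| canonical_plane : canonical_domain 0 (fun _ => True).

Definition koenigs_function (phi : R -> C -> C) (h : C -> C) : Prop :=
  exists lambda Omega,
    spectral_value phi lambda /\ canonical_domain lambda Omega /\
    holomorphic_model phi Omega h (fun t w => (w + Ci * t)%C).

Definition cube_sum {G : AbelianMonoid} (u : nat -> nat -> nat -> G) (N : nat)
  : G :=
  sum_n (fun j => sum_n (fun k => sum_n (fun l => u j k l) N) N) N.

Definition monomial (a : nat -> nat -> nat -> C) (s x y : R) (j k l : nat) : C :=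
  (a j k l * RtoC (s ^ j * x ^ k * y ^ l))%C.

(* Real analyticity in the three real variables t, Re z, Im z on a set S which
   need not be open: around each point of S, f agrees on S with the sum of a
   power series that converges absolutely in a full neighbourhood, so that f
   extends analytically past the boundary points of S lying in S. *)
Definition real_analytic_on (S : R -> C -> Prop) (f : R -> C -> C) : Prop :=
  forall (t0 : R) (z0 : C), S t0 z0 ->
  exists (a : nat -> nat -> nat -> C) (r : posreal),
    (forall s x y : R, Rabs s < r -> Rabs x < r -> Rabs y < r ->
       exists M : R, forall N : nat,
         cube_sum (fun j k l => Cmod (monomial a s x y j k l)) N <= M) /\
    (forall (t : R) (z : C), S t z ->
       Rabs (t - t0) < r -> Rabs (Re z - Re z0) < r -> Rabs (Im z - Im z0) < r ->
       filterlim
         (cube_sum (G := C_AbelianMonoid)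
            (monomial a (t - t0) (Re z - Re z0) (Im z - Im z0)))
         eventually (locally (T := C_UniformSpace) (f t z))).

(* Derivative at t relative to [0,+oo), hence one-sided at t = 0. *)
Definition is_time_derivative (f : R -> C) (t : R) (l : C) : Prop :=
  filterlim (fun s => ((f s - f t) / RtoC (s - t))%C)
    (within (Rle 0) (locally' t)) (locally (T := C_UniformSpace) l).

Definition generates (G : C -> C) (phi : R -> C -> C) : Prop :=
  holomorphic_on disc G /\
  forall t z, 0 <= t -> disc z ->
    is_time_derivative (fun s => phi s z) t (G (phi t z)).

(* Main.v *)
Require Import Defs.
From Stdlib Require Import Arith Factorial Lra Lia Psatz Classical ClassicalEpsilon.

(** Time derivatives are obtained by averaging.  For a semigroup [phi] let
    [F z] be the integral of [phi s z] over [0 <= s <= d].  It is holomorphic, and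
    [F (phi t z)] is the integral of the same orbit over [t <= s <= t + d], hence
    differentiable in [t].  As [F' z] is close to [d] for small [d], it can be divided
    out: the orbits are differentiable, with derivative [G (phi t z)] for
    [G z = (phi d z - z) / F' z], a holomorphic function which is independent of [d]
    ([generator_exists]).

    Analyticity is Taylor's formula along a flow.  If [g] is an integral curve of a
    holomorphic field [G], the [n]-th derivative of [f o g] is the [n]-fold Lie
    derivative of [f] along [G], and nested Cauchy estimates bound it by
    [n! A ^ n] ([lie_bound]).  So the Taylor series converges geometrically, on both
    sides of the initial time ([flow_taylor]).  Used for the semigroup, then for the
    two translation flows of the plane acting on the coefficients, it gives the
    triple power series in [t], [Re z], [Im z] ([flow_real_analytic]).

    If [h] is a Koenigs function, differentiating [h (phi t z) = h z + i t] at [t = 0]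
    gives [h' G = i], that is [G = i / h'].

    The inequality [Re p >= 0] is the derivative at [t = 0] of the fact that the
    horodiscs at [tau] are invariant, that is
    [|tau - phi t z|^2 / (1 - |phi t z|^2) <= |tau - z|^2 / (1 - |z|^2)]
    ([berkson_porta_nonneg]).  This is Julia's lemma, once [phi t] is known to fix
    the boundary point [tau].  The definition of the Denjoy-Wolff point only speaks
    of the moduli [|phi t z|], and Julia's lemma alone says that [phi t] maps [tau]
    to some point [sig t] of the circle, with an angular derivative of modulus
    [exp (- lambda t)].  The same lemma at [sig s] in place of [tau] shows that
    [phi t] maps [sig s] to [sig (t + s)], again with angular derivative of modulus
    [exp (- lambda t)], and that [sig] is continuous.  If [sig] is not constant near
    [0], it fills an arc of the circle.  Then [phi t] extends across this arc by
    Schwarz reflection ([schwarz_reflection]), and on the arc the derivative of the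
    extension is its angular derivative ([extension_derivative]); this reads
    [z * phi_t' = exp (- lambda t) * phi_t].  By the identity theorem the equation
    holds in the whole disc, and at [z = 0] it says [phi_t 0 = 0]
    ([euler_equation_fixes_zero]).  So [0] would be fixed by all [phi t],
    and [phi] would be elliptic.  Hence [sig t = tau] for small [t]
    ([horodiscs_invariant]).

    The function theory used on the way is derived from Goursat's theorem for
    rectangles.  A vertical line on which a function is merely continuous does not
    obstruct that theorem.  Applied to difference quotients this gives Cauchy's
    formula ([cauchy_formula]), and applied to functions glued along a line it gives
    Painleve's theorem ([painleve]), which serves both for removing the singularity
    in Schwarz's lemma and for reflection. *)

(** * Elementary facts on complex numbers *)

Lemma half_pos {e : R} : 0 < e -> 0 < e / 2.
Proof. lra. Qed.

Lemma Cmod_sub_sym (z w : C) : Cmod (z - w) = Cmod (w - z).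
Proof. rewrite <- Cmod_opp. f_equal. ring. Qed.

Lemma Cmod_sub_triangle (a b c : C) :
  Cmod (a - c) <= Cmod (a - b) + Cmod (b - c).
Proof.
  replace (a - c)%C with ((a - b) + (b - c))%C by ring. apply Cmod_triangle.
Qed.

Lemma Cmod_sub_le (a b : C) : Cmod (a - b) <= Cmod a + Cmod b.
Proof.
  unfold Cminus. eapply Rle_trans; [apply Cmod_triangle|].
  rewrite Cmod_opp. lra.
Qed.

Lemma Cmod_sub_ge (a b : C) : Cmod a - Cmod b <= Cmod (a - b).
Proof.
  assert (H := Cmod_triangle (a - b) b).
  replace (a - b + b)%C with a in H by ring. lra.
Qed.

Lemma Re_le_Cmod (z : C) : Rabs (Re z) <= Cmod z.
Proof. exact (re_le_Cmod z). Qed.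

Lemma Re_close (v w : C) : - Cmod (v - w) <= Re v - Re w <= Cmod (v - w).
Proof. apply Rabs_le_between. exact (Re_le_Cmod (v - w)). Qed.

Lemma Im_le_Cmod (z : C) : Rabs (Im z) <= Cmod z.
Proof. eapply Rle_trans; [|apply (Rmax_Cmod z)]. apply Rmax_r. Qed.

Lemma Cmod_le_Re_Im (z : C) : Cmod z <= Rabs (Re z) + Rabs (Im z).
Proof.
  replace z with (RtoC (Re z) + Ci * RtoC (Im z))%C at 1.
  - eapply Rle_trans; [apply Cmod_triangle|].
    rewrite Cmod_mult, Cmod_Ci, !Cmod_R. lra.
  - destruct z as [x y]. unfold Cplus, Cmult, Ci, RtoC, Re, Im; simpl.
    f_equal; ring.
Qed.

Lemma Cmod_pair_sub (a b c d : R) :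
  Cmod ((a, b) - (c, d))%C <= Rabs (a - c) + Rabs (b - d).
Proof. exact (Cmod_le_Re_Im ((a, b) - (c, d))%C). Qed.

Lemma Cmod_sqr (z : C) : Cmod z ^ 2 = Re z ^ 2 + Im z ^ 2.
Proof. apply Cmod2_alt. Qed.

Lemma Cmod_sub_self (z : C) : Cmod (z - z) = 0.
Proof. replace (z - z)%C with (RtoC 0) by ring. apply Cmod_0. Qed.

Lemma Cmod_pos_sub (z w : C) : z <> w -> 0 < Cmod (z - w).
Proof. intros H. apply Cmod_gt_0. now apply Cminus_eq_contra. Qed.

Lemma Cmod_sub_eq_0 (z w : C) : Cmod (z - w) = 0 -> z = w.
Proof.
  intros H. apply Cmod_eq_0 in H. now apply Ceq_minus.
Qed.

Lemma Cmod_sub_small_eq (z w : C) :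
  (forall eps, 0 < eps -> Cmod (z - w) <= eps) -> z = w.
Proof.
  intros H. apply Cmod_sub_eq_0. apply Rle_antisym; [|apply Cmod_ge_0].
  apply Rnot_lt_le. intros L. specialize (H (Cmod (z - w) / 2)). lra.
Qed.

Lemma Ceq (z w : C) : Re z = Re w -> Im z = Im w -> z = w.
Proof. destruct z, w; unfold Re, Im; simpl; congruence. Qed.

(** * Limits and first-order expansions along a filter *)

(** Balls of [C] for the modulus; [C_UniformSpace] uses the sup norm. *)
Definition Cnear (z : C) : (C -> Prop) -> Prop :=
  fun P => exists d, 0 < d /\ forall w, Cmod (w - z) < d -> P w.

Global Instance Cnear_filter (z : C) : ProperFilter (Cnear z).
Proof.
  constructor.
  - intros P [d [Hd H]]. exists z. apply H. rewrite Cmod_sub_self. exact Hd.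
  - constructor.
    + exists 1. split; [lra|auto].
    + intros P Q [d [Hd HP]] [e [He HQ]]. exists (Rmin d e). split.
      * now apply Rmin_pos.
      * intros w Hw. split; [apply HP | apply HQ]; eapply Rlt_le_trans; eauto.
        apply Rmin_l. apply Rmin_r.
    + intros P Q HPQ [d [Hd HP]]. exists d. auto.
Qed.

Lemma Cnear_locally (z : C) (P : C -> Prop) :
  Cnear z P <-> locally (T := C_UniformSpace) z P.
Proof.
  split.
  - intros [d [Hd H]].
    assert (Hd2 : 0 < d / 2) by lra.
    exists (mkposreal _ Hd2). intros w [H1 H2]. apply H.
    eapply Rle_lt_trans; [apply Cmod_le_Re_Im|].
    change (Rabs (fst w - fst z) < d / 2) in H1.
    change (Rabs (snd w - snd z) < d / 2) in H2.
    change (Rabs (fst w - fst z) + Rabs (snd w - snd z) < d). lra.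
  - intros [d H]. exists d. split; [apply cond_pos|]. intros w Hw. apply H.
    split.
    + change (Rabs (fst w - fst z) < d). eapply Rle_lt_trans; [|exact Hw].
      apply (Re_le_Cmod (w - z)).
    + change (Rabs (snd w - snd z) < d). eapply Rle_lt_trans; [|exact Hw].
      apply (Im_le_Cmod (w - z)).
Qed.

Definition clim {T : Type} (F : (T -> Prop) -> Prop) (f : T -> C) (l : C)
  : Prop := forall eps, 0 < eps -> F (fun x => Cmod (f x - l) < eps).

(** [f = f0 + l * u + o(u)] along [F].  With [u w = w - z] this is complex
    differentiability at [z]; with [u s = RtoC (s - t)] it is differentiability
    of a curve, one-sided or not according to [F]. *)
Definition cdev {T : Type} (F : (T -> Prop) -> Prop) (f u : T -> C)
  (f0 l : C) : Prop :=
  forall eps, 0 < eps ->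
    F (fun x => Cmod (f x - f0 - l * u x) <= eps * Cmod (u x)).

Section Filters.
Context {T : Type} (F : (T -> Prop) -> Prop) {FF : Filter F}.

Lemma clim_const (c : C) : clim F (fun _ => c) c.
Proof.
  intros e He. apply filter_forall. intros _. rewrite Cmod_sub_self. exact He.
Qed.

Lemma clim_ext (f g : T -> C) (l : C) :
  F (fun x => f x = g x) -> clim F f l -> clim F g l.
Proof.
  intros E H e He. specialize (H e He). generalize (filter_and _ _ E H).
  apply filter_imp. intros x [<- ?]. assumption.
Qed.

Lemma clim_plus (f g : T -> C) (l m : C) :
  clim F f l -> clim F g m -> clim F (fun x => f x + g x)%C (l + m)%C.
Proof.
  intros Hf Hg e He.
  generalize (filter_and _ _ (Hf _ (half_pos He)) (Hg _ (half_pos He))).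
  apply filter_imp. intros x [H1 H2].
  replace (f x + g x - (l + m))%C with ((f x - l) + (g x - m))%C by ring.
  eapply Rle_lt_trans; [apply Cmod_triangle|]. lra.
Qed.

Lemma clim_opp (f : T -> C) (l : C) :
  clim F f l -> clim F (fun x => - f x)%C (- l)%C.
Proof.
  intros Hf e He. generalize (Hf e He). apply filter_imp. intros x H.
  replace (- f x - - l)%C with (- (f x - l))%C by ring. now rewrite Cmod_opp.
Qed.

Lemma clim_minus (f g : T -> C) (l m : C) :
  clim F f l -> clim F g m -> clim F (fun x => f x - g x)%C (l - m)%C.
Proof. intros. apply clim_plus; auto. now apply clim_opp. Qed.

Lemma clim_mult_0 (f g : T -> C) (M : R) :
  clim F f (RtoC 0) -> F (fun x => Cmod (g x) <= M) ->
  clim F (fun x => f x * g x)%C (RtoC 0).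
Proof.
  intros Hf Hg e He.
  set (M' := Rmax M 1). assert (HM : 1 <= M') by apply Rmax_r.
  assert (He' : 0 < e / M') by (apply Rdiv_lt_0_compat; lra).
  generalize (filter_and _ _ (Hf _ He') Hg). apply filter_imp.
  intros x [H1 H2].
  replace (f x - RtoC 0)%C with (f x) in H1 by ring.
  replace (f x * g x - RtoC 0)%C with (f x * g x)%C by ring.
  rewrite Cmod_mult.
  assert (Cmod (g x) <= M') by (eapply Rle_trans; [exact H2|apply Rmax_l]).
  apply Rle_lt_trans with (Cmod (f x) * M').
  - apply Rmult_le_compat_l; [apply Cmod_ge_0|assumption].
  - replace e with (e / M' * M') by (field; lra).
    apply Rmult_lt_compat_r; lra.
Qed.

Lemma clim_bounded (f : T -> C) (l : C) :
  clim F f l -> F (fun x => Cmod (f x) <= Cmod l + 1).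
Proof.
  intros H. generalize (H 1 Rlt_0_1). apply filter_imp. intros x Hx.
  assert (K := Cmod_sub_ge (f x) l). lra.
Qed.

Lemma clim_minus_0 (f : T -> C) (l : C) :
  clim F f l <-> clim F (fun x => f x - l)%C (RtoC 0).
Proof.
  split; intros H e He; generalize (H e He); apply filter_imp; intros x Hx;
  [replace (f x - l - RtoC 0)%C with (f x - l)%C by ring
  |replace (f x - l - RtoC 0)%C with (f x - l)%C in Hx by ring]; exact Hx.
Qed.

Lemma clim_mult (f g : T -> C) (l m : C) :
  clim F f l -> clim F g m -> clim F (fun x => f x * g x)%C (l * m)%C.
Proof.
  intros Hf Hg.
  replace (l * m)%C with (RtoC 0 + (RtoC 0 + l * m))%C by ring.
  apply clim_ext with
    (fun x => (f x - l) * g x + ((g x - m) * l + l * m))%C.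
  - apply filter_forall. intros x. ring.
  - apply clim_plus; [|apply clim_plus].
    + apply clim_mult_0 with (Cmod m + 1); [exact (proj1 (clim_minus_0 f l) Hf)|].
      now apply clim_bounded.
    + apply clim_mult_0 with (Cmod l); [exact (proj1 (clim_minus_0 g m) Hg)|].
      apply filter_forall. intros _. lra.
    + apply clim_const.
Qed.

Lemma clim_inv (f : T -> C) (l : C) :
  l <> RtoC 0 -> clim F f l -> clim F (fun x => / f x)%C (/ l)%C.
Proof.
  intros Hl Hf. assert (HM : 0 < Cmod l) by now apply Cmod_gt_0.
  intros e He.
  set (d := Rmin (Cmod l / 2) (e * Cmod l * Cmod l / 2)).
  assert (Hd : 0 < d).
  { apply Rmin_pos; [lra|]. assert (0 < e * Cmod l * Cmod l) by
      (repeat apply Rmult_lt_0_compat; auto). lra. }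
  generalize (Hf d Hd). apply filter_imp. intros x Hx.
  assert (D1 : d <= Cmod l / 2) by apply Rmin_l.
  assert (D2 : d <= e * Cmod l * Cmod l / 2) by apply Rmin_r.
  assert (K := Cmod_sub_ge l (f x)). rewrite Cmod_sub_sym in K.
  assert (Hfx : f x <> RtoC 0) by (apply Cmod_gt_0; lra).
  replace (/ f x - / l)%C with ((l - f x) / (f x * l))%C
    by (field; split; assumption).
  rewrite Cmod_div by (apply Cmult_neq_0; assumption).
  rewrite Cmod_mult, Cmod_sub_sym.
  assert (0 < Cmod (f x) * Cmod l) by (apply Rmult_lt_0_compat; lra).
  apply Rmult_lt_reg_r with (Cmod (f x) * Cmod l); [assumption|].
  unfold Rdiv. rewrite Rmult_assoc, Rinv_l, Rmult_1_r by lra.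
  eapply Rlt_le_trans; [exact Hx|]. eapply Rle_trans; [exact D2|].
  assert (e * Cmod l * (Cmod l / 2) <= e * Cmod l * Cmod (f x)).
  { apply Rmult_le_compat_l; [|lra]. apply Rmult_le_pos; lra. }
  nra.
Qed.

Lemma clim_comp (f : T -> C) (g : C -> C) (l m : C) :
  clim F f l -> clim (Cnear l) g m -> clim F (fun x => g (f x)) m.
Proof.
  intros Hf Hg e He. destruct (Hg e He) as [d [Hd H]].
  generalize (Hf d Hd). apply filter_imp. intros x Hx. now apply H.
Qed.

Lemma clim_unique {PF : ProperFilter F} (f : T -> C) (l m : C) :
  clim F f l -> clim F f m -> l = m.
Proof.
  intros Hl Hm. apply Cmod_sub_small_eq. intros e He.
  destruct (filter_ex (F := F) _
    (filter_and _ _ (Hl _ (half_pos He)) (Hm _ (half_pos He))))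
    as [x [H1 H2]].
  rewrite Cmod_sub_sym in H1.
  assert (K := Cmod_sub_triangle l (f x) m). lra.
Qed.

Lemma cdev_const (u : T -> C) (c : C) : cdev F (fun _ => c) u c (RtoC 0).
Proof.
  intros e He. apply filter_forall. intros x.
  replace (c - c - RtoC 0 * u x)%C with (RtoC 0) by ring. rewrite Cmod_0.
  apply Rmult_le_pos; [lra|apply Cmod_ge_0].
Qed.

Lemma cdev_ext (f g u : T -> C) (f0 l : C) :
  F (fun x => f x = g x) -> cdev F f u f0 l -> cdev F g u f0 l.
Proof.
  intros E H e He. generalize (filter_and _ _ E (H e He)).
  apply filter_imp. intros x [<- ?]. assumption.
Qed.

Lemma cdev_eq (f u : T -> C) (f0 f1 l m : C) :
  f0 = f1 -> l = m -> cdev F f u f0 l -> cdev F f u f1 m.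
Proof. now intros -> ->. Qed.

Lemma cdev_affine (u : T -> C) (f0 l : C) :
  cdev F (fun x => f0 + l * u x)%C u f0 l.
Proof.
  intros e He. apply filter_forall. intros x.
  replace (f0 + l * u x - f0 - l * u x)%C with (RtoC 0) by ring.
  rewrite Cmod_0. apply Rmult_le_pos; [lra|apply Cmod_ge_0].
Qed.

Lemma cdev_plus (f g u : T -> C) (f0 g0 l m : C) :
  cdev F f u f0 l -> cdev F g u g0 m ->
  cdev F (fun x => f x + g x)%C u (f0 + g0)%C (l + m)%C.
Proof.
  intros Hf Hg e He.
  generalize (filter_and _ _ (Hf _ (half_pos He)) (Hg _ (half_pos He))).
  apply filter_imp. intros x [H1 H2].
  replace (f x + g x - (f0 + g0) - (l + m) * u x)%C with
    ((f x - f0 - l * u x) + (g x - g0 - m * u x))%C by ring.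
  eapply Rle_trans; [apply Cmod_triangle|]. lra.
Qed.

Lemma cdev_scal (c : C) (f u : T -> C) (f0 l : C) :
  cdev F f u f0 l -> cdev F (fun x => c * f x)%C u (c * f0)%C (c * l)%C.
Proof.
  intros Hf e He.
  assert (Hc : 0 < Cmod c + 1) by (assert (H := Cmod_ge_0 c); lra).
  assert (He' : 0 < e / (Cmod c + 1)) by now apply Rdiv_lt_0_compat.
  generalize (Hf _ He'). apply filter_imp. intros x H.
  replace (c * f x - c * f0 - c * l * u x)%C with
    (c * (f x - f0 - l * u x))%C by ring.
  rewrite Cmod_mult.
  apply Rle_trans with ((Cmod c + 1) * (e / (Cmod c + 1) * Cmod (u x))).
  - apply Rmult_le_compat; try apply Cmod_ge_0; try lra.
  - right. field. lra.
Qed.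

Lemma cdev_opp (f u : T -> C) (f0 l : C) :
  cdev F f u f0 l -> cdev F (fun x => - f x)%C u (- f0)%C (- l)%C.
Proof.
  intros Hf e He. generalize (Hf e He). apply filter_imp. intros x H.
  replace (- f x - - f0 - - l * u x)%C with (- (f x - f0 - l * u x))%C by ring.
  now rewrite Cmod_opp.
Qed.

Lemma cdev_minus (f g u : T -> C) (f0 g0 l m : C) :
  cdev F f u f0 l -> cdev F g u g0 m ->
  cdev F (fun x => f x - g x)%C u (f0 - g0)%C (l - m)%C.
Proof. intros. apply cdev_plus; auto. now apply cdev_opp. Qed.

Lemma cdev_bound (f u : T -> C) (f0 l : C) :
  cdev F f u f0 l ->
  F (fun x => Cmod (f x - f0) <= (Cmod l + 1) * Cmod (u x)).
Proof.
  intros H. generalize (H 1 Rlt_0_1). apply filter_imp. intros x Hx.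
  replace (f x - f0)%C with ((f x - f0 - l * u x) + l * u x)%C by ring.
  eapply Rle_trans; [apply Cmod_triangle|]. rewrite Cmod_mult. lra.
Qed.

Lemma cdev_lim (f u : T -> C) (f0 l : C) :
  clim F u (RtoC 0) -> cdev F f u f0 l -> clim F f f0.
Proof.
  intros Hu H e He.
  assert (Hc : 0 < Cmod l + 1) by (assert (K := Cmod_ge_0 l); lra).
  assert (He' : 0 < e / (Cmod l + 1)) by now apply Rdiv_lt_0_compat.
  generalize (filter_and _ _ (cdev_bound _ _ _ _ H) (Hu _ He')).
  apply filter_imp. intros x [H1 H2].
  replace (u x - RtoC 0)%C with (u x) in H2 by ring.
  eapply Rle_lt_trans; [exact H1|].
  replace e with ((Cmod l + 1) * (e / (Cmod l + 1))) by (field; lra).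
  apply Rmult_lt_compat_l; assumption.
Qed.

(** Carathéodory's form of differentiability: the slope extends by the
    derivative. *)
Lemma cdev_slope (f u q : T -> C) (f0 l : C) :
  F (fun x => f x - f0 = q x * u x)%C -> clim F q l -> cdev F f u f0 l.
Proof.
  intros E H e He. generalize (filter_and _ _ E (H e He)). apply filter_imp.
  intros x [H1 H2]. rewrite H1.
  replace (q x * u x - l * u x)%C with ((q x - l) * u x)%C by ring.
  rewrite Cmod_mult. apply Rmult_le_compat_r; [apply Cmod_ge_0|lra].
Qed.

Lemma cdev_quot (f u : T -> C) (f0 l : C) :
  F (fun x => u x <> RtoC 0) -> cdev F f u f0 l ->
  clim F (fun x => (f x - f0) / u x)%C l.
Proof.
  intros Hu H e He. generalize (filter_and _ _ Hu (H _ (half_pos He))).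
  apply filter_imp. intros x [H1 H2].
  replace ((f x - f0) / u x - l)%C with ((f x - f0 - l * u x) / u x)%C
    by (field; assumption).
  rewrite Cmod_div by assumption.
  apply Rle_lt_trans with (e / 2); [|lra].
  assert (0 < Cmod (u x)) by now apply Cmod_gt_0.
  apply Rmult_le_reg_r with (Cmod (u x)); [assumption|].
  unfold Rdiv at 1. rewrite Rmult_assoc, Rinv_l, Rmult_1_r by lra. exact H2.
Qed.

Lemma cdev_mult (f g u : T -> C) (f0 g0 l m : C) :
  clim F u (RtoC 0) -> cdev F f u f0 l -> cdev F g u g0 m ->
  cdev F (fun x => f x * g x)%C u (f0 * g0)%C (l * g0 + f0 * m)%C.
Proof.
  intros Hu Hf Hg.
  apply cdev_ext with
    (fun x => ((f x - f0) * (g x - g0) + (g0 * f x + f0 * g x)) - f0 * g0)%C.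
  { apply filter_forall. intros x. ring. }
  apply cdev_eq with ((RtoC 0 + (g0 * f0 + f0 * g0)) - f0 * g0)%C
    ((RtoC 0 + (g0 * l + f0 * m)) - RtoC 0)%C; [ring|ring|].
  apply cdev_minus; [|apply cdev_const].
  apply cdev_plus; [|apply cdev_plus; now apply cdev_scal].
  intros e He.
  set (A := Cmod l + 1). assert (HA : 0 < A) by
    (unfold A; assert (H := Cmod_ge_0 l); lra).
  assert (He' : 0 < e / A) by now apply Rdiv_lt_0_compat.
  generalize (filter_and _ _ (cdev_bound _ _ _ _ Hf)
    (cdev_lim _ _ _ _ Hu Hg _ He')).
  apply filter_imp. intros x [H1 H2].
  replace ((f x - f0) * (g x - g0) - RtoC 0 - RtoC 0 * u x)%C with
    ((f x - f0) * (g x - g0))%C by ring.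
  rewrite Cmod_mult.
  apply Rle_trans with (A * Cmod (u x) * (e / A)).
  - apply Rmult_le_compat; try apply Cmod_ge_0; [exact H1|lra].
  - right. field. lra.
Qed.

Lemma cdev_comp (f : C -> C) (g u : T -> C) (g0 l m : C) :
  clim F u (RtoC 0) ->
  cdev (Cnear g0) f (fun w => w - g0)%C (f g0) l -> cdev F g u g0 m ->
  cdev F (fun x => f (g x)) u (f g0) (l * m)%C.
Proof.
  intros Hu Hf Hg e He.
  set (A := Cmod m + 1). assert (HA : 0 < A) by
    (unfold A; assert (H := Cmod_ge_0 m); lra).
  set (B := Cmod l + 1). assert (HB : 0 < B) by
    (unfold B; assert (H := Cmod_ge_0 l); lra).
  assert (He1 : 0 < e / (2 * A)) by (apply Rdiv_lt_0_compat; lra).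
  assert (He2 : 0 < e / (2 * B)) by (apply Rdiv_lt_0_compat; lra).
  destruct (Hf _ He1) as [d [Hd H]].
  generalize (filter_and _ _ (cdev_lim _ _ _ _ Hu Hg _ Hd)
    (filter_and _ _ (cdev_bound _ _ _ _ Hg) (Hg _ He2))).
  apply filter_imp. intros x [H1 [H2 H3]]. specialize (H _ H1).
  replace (f (g x) - f g0 - l * m * u x)%C with
    ((f (g x) - f g0 - l * (g x - g0)) + l * (g x - g0 - m * u x))%C by ring.
  eapply Rle_trans; [apply Cmod_triangle|]. rewrite Cmod_mult.
  assert (P : 0 <= Cmod (u x)) by apply Cmod_ge_0.
  assert (E1 : Cmod (f (g x) - f g0 - l * (g x - g0)) <= e / 2 * Cmod (u x)).
  { eapply Rle_trans; [exact H|].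
    apply Rle_trans with (e / (2 * A) * (A * Cmod (u x))).
    - apply Rmult_le_compat_l; [lra|exact H2].
    - right. field. lra. }
  assert (E2 : Cmod l * Cmod (g x - g0 - m * u x) <= e / 2 * Cmod (u x)).
  { apply Rle_trans with (B * (e / (2 * B) * Cmod (u x))).
    - apply Rmult_le_compat; try apply Cmod_ge_0; [unfold B; lra|exact H3].
    - right. field. lra. }
  lra.
Qed.

End Filters.

Lemma clim_filter_le {T : Type} (F G : (T -> Prop) -> Prop) (f : T -> C)
  (l : C) : filter_le F G -> clim G f l -> clim F f l.
Proof. intros H Hf e He. apply H. now apply Hf. Qed.

Lemma clim_locally {T : Type} (F : (T -> Prop) -> Prop) {FF : Filter F}
  (f : T -> C) (l : C) :
  clim F f l <-> filterlim f F (locally (T := C_UniformSpace) l).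
Proof.
  split.
  - intros H P HP. apply Cnear_locally in HP. destruct HP as [d [Hd HP]].
    generalize (H d Hd). unfold filtermap. apply filter_imp. auto.
  - intros H e He.
    apply (H (fun y => Cmod (y - l) < e)). apply Cnear_locally. exists e. auto.
Qed.

(** * Complex differentiability *)

Definition ccont (f : C -> C) (z : C) : Prop := clim (Cnear z) f (f z).

Definition cdiff (f : C -> C) (z l : C) : Prop :=
  cdev (Cnear z) f (fun w => w - z)%C (f z) l.

Lemma clim_sub_self (z : C) : clim (Cnear z) (fun w => w - z)%C (RtoC 0).
Proof.
  intros e He. exists e. split; [assumption|]. intros w Hw.
  replace (w - z - RtoC 0)%C with (w - z)%C by ring. exact Hw.
Qed.

Lemma cdiff_is_derive (f : C -> C) (z l : C) :
  cdiff f z l <->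
  is_derive (K := C_AbsRing) (V := C_NormedModule) f z l.
Proof.
  split.
  - intros H. split.
    + apply is_linear_scal_l.
    + intros x Hx.
      assert (E := is_filter_lim_locally_unique
        (V := AbsRing_NormedModule C_AbsRing) z x Hx). subst x. clear Hx.
      intros eps.
      destruct (H eps (cond_pos eps)) as [d [Hd K]].
      exists (mkposreal d Hd). intros y Hy. specialize (K y Hy).
      replace (f y - f z - l * (y - z))%C with
        (f y - f z - (y - z) * l)%C in K by ring.
      exact K.
  - intros [_ H] e He.
    assert (Hz : is_filter_lim (locally (T := AbsRing_NormedModule C_AbsRing) z) z)
      by (intros P HP; exact HP).
    specialize (H z Hz (mkposreal e He)).
    destruct H as [d K]. exists d. split; [apply cond_pos|].
    intros w Hw. specialize (K w Hw).
    replace (f w - f z - l * (w - z))%C with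
        (f w - f z - (w - z) * l)%C by ring. exact K.
Qed.

Lemma cdiff_C_derive (f : C -> C) (z l : C) : cdiff f z l -> C_derive f z = l.
Proof. intros H. apply is_C_derive_unique. now apply cdiff_is_derive. Qed.

Lemma cdiff_cont (f : C -> C) (z l : C) : cdiff f z l -> ccont f z.
Proof. intros H. exact (cdev_lim _ _ _ _ _ (clim_sub_self z) H). Qed.

Lemma cdiff_const (c z : C) : cdiff (fun _ => c) z (RtoC 0).
Proof. apply (cdev_const (Cnear z)). Qed.

Lemma cdiff_id (z : C) : cdiff (fun w => w) z (RtoC 1).
Proof.
  apply cdev_ext with (fun w => z + RtoC 1 * (w - z))%C; [apply _| |].
  - apply filter_forall. intros w. ring.
  - apply cdev_affine. apply _.
Qed.

Lemma cdiff_plus (f g : C -> C) (z l m : C) :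
  cdiff f z l -> cdiff g z m -> cdiff (fun w => f w + g w)%C z (l + m)%C.
Proof. intros H K. exact (cdev_plus _ _ _ _ _ _ _ _ H K). Qed.

Lemma cdiff_minus (f g : C -> C) (z l m : C) :
  cdiff f z l -> cdiff g z m -> cdiff (fun w => f w - g w)%C z (l - m)%C.
Proof. intros H K. exact (cdev_minus _ _ _ _ _ _ _ _ H K). Qed.

Lemma cdiff_scal (c : C) (f : C -> C) (z l : C) :
  cdiff f z l -> cdiff (fun w => c * f w)%C z (c * l)%C.
Proof. intros H. exact (cdev_scal _ _ _ _ _ _ H). Qed.

Lemma cdiff_mult (f g : C -> C) (z l m : C) :
  cdiff f z l -> cdiff g z m ->
  cdiff (fun w => f w * g w)%C z (l * g z + f z * m)%C.
Proof. intros H K. exact (cdev_mult _ _ _ _ _ _ _ _ (clim_sub_self z) H K). Qed.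

Lemma cdiff_comp (f g : C -> C) (z l m : C) :
  cdiff f (g z) l -> cdiff g z m -> cdiff (fun w => f (g w)) z (l * m)%C.
Proof. intros H K. exact (cdev_comp _ f g _ _ _ _ (clim_sub_self z) H K). Qed.

Lemma cdiff_inv (z : C) : z <> RtoC 0 -> cdiff Cinv z (- / (z * z))%C.
Proof.
  intros Hz. apply cdev_slope with (fun w => - / (w * z))%C; [apply _| |].
  - assert (0 < Cmod z) by now apply Cmod_gt_0.
    exists (Cmod z). split; [assumption|]. intros w Hw.
    assert (w <> RtoC 0).
    { intros ->. rewrite Cmod_sub_sym in Hw.
      replace (z - RtoC 0)%C with z in Hw by ring. lra. }
    field. split; assumption.
  - apply clim_opp; [apply _|]. apply clim_inv; [apply _| |].
    + now apply Cmult_neq_0.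
    + apply clim_mult; [apply _| |].
      * apply (cdiff_cont _ _ _ (cdiff_id z)).
      * apply clim_const. apply _.
Qed.

Lemma cdiff_div (f g : C -> C) (z l m : C) :
  g z <> RtoC 0 -> cdiff f z l -> cdiff g z m ->
  cdiff (fun w => f w / g w)%C z ((l * g z - f z * m) / (g z * g z))%C.
Proof.
  intros Hz Hf Hg.
  replace ((l * g z - f z * m) / (g z * g z))%C with
    (l * / g z + f z * (- / (g z * g z) * m))%C by (field; assumption).
  apply (cdiff_mult f (fun w => / g w)%C); [assumption|].
  apply (cdiff_comp Cinv g); [now apply cdiff_inv|assumption].
Qed.

Lemma cdiff_eq (f : C -> C) (z l m : C) : l = m -> cdiff f z l -> cdiff f z m.
Proof. now intros ->. Qed.

Lemma cdiff_ext (f g : C -> C) (z l : C) :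
  Cnear z (fun w => f w = g w) -> cdiff f z l -> cdiff g z l.
Proof.
  intros E H. unfold cdiff.
  assert (E0 : f z = g z).
  { destruct E as [d [Hd E]]. apply E. now rewrite Cmod_sub_self. }
  rewrite <- E0. apply (cdev_ext _ f); assumption.
Qed.

Lemma holomorphic_cdiff (U : C -> Prop) (f : C -> C) :
  holomorphic_on U f <-> forall z, U z -> cdiff f z (C_derive f z).
Proof.
  split.
  - intros H z Hz. destruct (H z Hz) as [l Hl]. apply cdiff_is_derive in Hl.
    now rewrite (cdiff_C_derive _ _ _ Hl).
  - intros H z Hz. exists (C_derive f z). apply cdiff_is_derive. now apply H.
Qed.

(** * Curves and their integrals *)

Definition rcont (g : R -> C) (t : R) : Prop := clim (locally t) g (g t).

Definition rdiff (g : R -> C) (t : R) (l : C) : Prop :=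
  cdev (locally t) g (fun s => RtoC (s - t)) (g t) l.

Definition contI (g : R -> C) (a b : R) : Prop :=
  forall t, Rmin a b <= t <= Rmax a b -> rcont g t.

Definition CInt (g : R -> C) (a b : R) : C :=
  (RInt (fun t => Re (g t)) a b, RInt (fun t => Im (g t)) a b).

Lemma Rminmax_between (a b : R) :
  (Rmin a b = a /\ Rmax a b = b /\ a <= b) \/
  (Rmin a b = b /\ Rmax a b = a /\ b <= a).
Proof.
  unfold Rmin, Rmax. destruct (Rle_dec a b); [left|right]; repeat split; lra.
Qed.

Lemma clim_displacement (t : R) :
  clim (locally t) (fun s => RtoC (s - t)) (RtoC 0).
Proof.
  intros e He. exists (mkposreal e He). intros s Hs.
  rewrite <- RtoC_minus, Cmod_R. change (Rabs (s - t) < e) in Hs.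
  now replace (s - t - 0) with (s - t) by ring.
Qed.

Lemma rdiff_rcont (g : R -> C) (t : R) (l : C) : rdiff g t l -> rcont g t.
Proof. intros H. exact (cdev_lim _ _ _ _ _ (clim_displacement t) H). Qed.

Lemma rdiff_comp (f : C -> C) (g : R -> C) (t : R) (l m : C) :
  cdiff f (g t) l -> rdiff g t m -> rdiff (fun s => f (g s)) t (l * m)%C.
Proof.
  intros Hf Hg. exact (cdev_comp _ f g _ _ _ _ (clim_displacement t) Hf Hg).
Qed.

Lemma rcont_comp (f : C -> C) (g : R -> C) (t : R) :
  ccont f (g t) -> rcont g t -> rcont (fun s => f (g s)) t.
Proof. intros Hf Hg. exact (clim_comp _ g f _ _ Hg Hf). Qed.

Lemma rcont_const (c : C) (t : R) : rcont (fun _ => c) t.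
Proof. apply (clim_const (locally t)). Qed.

Lemma rcont_minus (f g : R -> C) (t : R) :
  rcont f t -> rcont g t -> rcont (fun s => f s - g s)%C t.
Proof. intros H K. exact (clim_minus _ _ _ _ _ H K). Qed.

Lemma rcont_mult (f g : R -> C) (t : R) :
  rcont f t -> rcont g t -> rcont (fun s => f s * g s)%C t.
Proof. intros H K. exact (clim_mult _ _ _ _ _ H K). Qed.

Lemma rcont_inv (f : R -> C) (t : R) :
  f t <> RtoC 0 -> rcont f t -> rcont (fun s => / f s)%C t.
Proof. intros H K. exact (clim_inv _ _ _ H K). Qed.

Lemma rcont_Re (g : R -> C) (t : R) :
  rcont g t -> continuous (fun s => Re (g s)) t.
Proof.
  intros H P [d HP]. generalize (H d (cond_pos d)). unfold filtermap.
  apply filter_imp. intros s Hs. apply HP.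
  change (Rabs (Re (g s - g t)%C) < d).
  eapply Rle_lt_trans; [apply Re_le_Cmod|exact Hs].
Qed.

Lemma rcont_Im (g : R -> C) (t : R) :
  rcont g t -> continuous (fun s => Im (g s)) t.
Proof.
  intros H P [d HP]. generalize (H d (cond_pos d)). unfold filtermap.
  apply filter_imp. intros s Hs. apply HP.
  change (Rabs (Im (g s - g t)%C) < d).
  eapply Rle_lt_trans; [apply Im_le_Cmod|exact Hs].
Qed.

Lemma is_derive_eps (a : R -> R) (t l : R) :
  is_derive a t l <->
  forall e, 0 < e ->
    locally t (fun s => Rabs (a s - a t - l * (s - t)) <= e * Rabs (s - t)).
Proof.
  split.
  - intros [_ H] e He.
    assert (Ht : is_filter_lim (locally (T := R_UniformSpace) t) t)
      by (intros P HP; exact HP).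
    generalize (H t Ht (mkposreal e He)). apply filter_imp. intros s Hs.
    replace (l * (s - t)) with ((s - t) * l) by ring. exact Hs.
  - intros H. split; [apply is_linear_scal_l|].
    intros x Hx.
    assert (E := is_filter_lim_locally_unique
      (V := AbsRing_NormedModule R_AbsRing) t x Hx). subst x. clear Hx.
    intros e. generalize (H e (cond_pos e)). apply filter_imp. intros s Hs.
    replace (l * (s - t)) with ((s - t) * l) in Hs by ring. exact Hs.
Qed.

Lemma rdiff_pair (a b : R -> R) (t l m : R) :
  is_derive a t l -> is_derive b t m ->
  rdiff (fun s => (a s, b s)) t (l, m).
Proof.
  intros Ha Hb e He.
  assert (He2 : 0 < e / 2) by lra.
  generalize (filter_and _ _ (proj1 (is_derive_eps _ _ _) Ha _ He2)
    (proj1 (is_derive_eps _ _ _) Hb _ He2)).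
  apply filter_imp. intros s [H1 H2].
  eapply Rle_trans; [apply Cmod_le_Re_Im|].
  replace (Re ((a s, b s) - (a t, b t) - (l, m) * RtoC (s - t))%C)
    with (a s - a t - l * (s - t)) by (unfold Re; simpl; ring).
  replace (Im ((a s, b s) - (a t, b t) - (l, m) * RtoC (s - t))%C)
    with (b s - b t - m * (s - t)) by (unfold Im; simpl; ring).
  rewrite Cmod_R. lra.
Qed.

Lemma rdiff_Re (g : R -> C) (t : R) (l : C) :
  rdiff g t l -> is_derive (fun s => Re (g s)) t (Re l).
Proof.
  intros H. apply is_derive_eps. intros e He. generalize (H e He).
  apply filter_imp. intros s Hs. rewrite Cmod_R in Hs.
  eapply Rle_trans; [|exact Hs].
  replace (Re (g s) - Re (g t) - Re l * (s - t)) with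
    (Re (g s - g t - l * RtoC (s - t))%C) by (unfold Re; simpl; ring).
  apply Re_le_Cmod.
Qed.

Lemma rdiff_Im (g : R -> C) (t : R) (l : C) :
  rdiff g t l -> is_derive (fun s => Im (g s)) t (Im l).
Proof.
  intros H. apply is_derive_eps. intros e He. generalize (H e He).
  apply filter_imp. intros s Hs. rewrite Cmod_R in Hs.
  eapply Rle_trans; [|exact Hs].
  replace (Im (g s) - Im (g t) - Im l * (s - t)) with
    (Im (g s - g t - l * RtoC (s - t))%C) by (unfold Im; simpl; ring).
  apply Im_le_Cmod.
Qed.

Lemma contI_ex_Re (g : R -> C) (a b : R) :
  contI g a b -> ex_RInt (fun t => Re (g t)) a b.
Proof.
  intros H. apply (ex_RInt_continuous (V := R_CompleteNormedModule)).
  intros t Ht. apply rcont_Re. now apply H.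
Qed.

Lemma contI_ex_Im (g : R -> C) (a b : R) :
  contI g a b -> ex_RInt (fun t => Im (g t)) a b.
Proof.
  intros H. apply (ex_RInt_continuous (V := R_CompleteNormedModule)).
  intros t Ht. apply rcont_Im. now apply H.
Qed.

Lemma contI_swap (g : R -> C) (a b : R) : contI g a b -> contI g b a.
Proof. intros H t Ht. apply H. now rewrite Rmin_comm, Rmax_comm. Qed.

Lemma contI_minus (f g : R -> C) (a b : R) :
  contI f a b -> contI g a b -> contI (fun s => f s - g s)%C a b.
Proof. intros H K t Ht. apply rcont_minus; auto. Qed.

Lemma contI_scal (c : C) (g : R -> C) (a b : R) :
  contI g a b -> contI (fun s => c * g s)%C a b.
Proof. intros K t Ht. apply rcont_mult; auto. apply rcont_const. Qed.

Lemma CInt_ext (f g : R -> C) (a b : R) :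
  (forall t, Rmin a b < t < Rmax a b -> f t = g t) -> CInt f a b = CInt g a b.
Proof.
  intros H. unfold CInt. f_equal; apply RInt_ext; intros t Ht; now rewrite H.
Qed.

Lemma CInt_plus (f g : R -> C) (a b : R) :
  contI f a b -> contI g a b ->
  CInt (fun t => f t + g t)%C a b = (CInt f a b + CInt g a b)%C.
Proof.
  intros Hf Hg. unfold CInt, Cplus; simpl. f_equal.
  - apply (RInt_plus (V := R_CompleteNormedModule)); now apply contI_ex_Re.
  - apply (RInt_plus (V := R_CompleteNormedModule)); now apply contI_ex_Im.
Qed.

Lemma CInt_scal (c : C) (g : R -> C) (a b : R) :
  contI g a b -> CInt (fun t => c * g t)%C a b = (c * CInt g a b)%C.
Proof.
  intros Hg. assert (H1 := contI_ex_Re _ _ _ Hg).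
  assert (H2 := contI_ex_Im _ _ _ Hg).
  assert (S1 : forall k, ex_RInt (fun t => k * Re (g t)) a b)
    by (intros k; apply (ex_RInt_scal (V := R_NormedModule)); assumption).
  assert (S2 : forall k, ex_RInt (fun t => k * Im (g t)) a b)
    by (intros k; apply (ex_RInt_scal (V := R_NormedModule)); assumption).
  assert (T1 : forall k, RInt (fun t => k * Re (g t)) a b =
    k * RInt (fun t => Re (g t)) a b)
    by (intros k; apply (RInt_scal (V := R_CompleteNormedModule)); assumption).
  assert (T2 : forall k, RInt (fun t => k * Im (g t)) a b =
    k * RInt (fun t => Im (g t)) a b)
    by (intros k; apply (RInt_scal (V := R_CompleteNormedModule)); assumption).
  unfold CInt, Cmult; simpl. f_equal.
  - rewrite <- !T1, <- !T2.
    apply (RInt_minus (V := R_CompleteNormedModule)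
      (fun t => fst c * Re (g t)) (fun t => snd c * Im (g t))); auto.
  - rewrite <- !T1, <- !T2.
    apply (RInt_plus (V := R_CompleteNormedModule)
      (fun t => fst c * Im (g t)) (fun t => snd c * Re (g t))); auto.
Qed.

Lemma CInt_minus (f g : R -> C) (a b : R) :
  contI f a b -> contI g a b ->
  CInt (fun t => f t - g t)%C a b = (CInt f a b - CInt g a b)%C.
Proof.
  intros Hf Hg.
  rewrite (CInt_ext _ (fun t => f t + RtoC (-1) * g t)%C).
  2:{ intros t _. ring. }
  rewrite CInt_plus, CInt_scal by (try apply contI_scal; assumption). ring.
Qed.

Lemma CInt_point (g : R -> C) (a : R) : CInt g a a = RtoC 0.
Proof. unfold CInt. rewrite !RInt_point. reflexivity. Qed.

Lemma CInt_swap (g : R -> C) (a b : R) : contI g a b -> CInt g b a = (- CInt g a b)%C.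
Proof.
  intros H. unfold CInt, Copp; simpl. f_equal.
  - symmetry. apply (opp_RInt_swap (V := R_CompleteNormedModule)). now apply contI_ex_Re.
  - symmetry. apply (opp_RInt_swap (V := R_CompleteNormedModule)). now apply contI_ex_Im.
Qed.

Lemma CInt_Chasles (g : R -> C) (a b c : R) :
  contI g a b -> contI g b c -> (CInt g a b + CInt g b c)%C = CInt g a c.
Proof.
  intros H K. unfold CInt, Cplus; simpl. f_equal.
  - apply (RInt_Chasles (V := R_CompleteNormedModule)); now apply contI_ex_Re.
  - apply (RInt_Chasles (V := R_CompleteNormedModule)); now apply contI_ex_Im.
Qed.

Lemma CInt_const (c : C) (a b : R) :
  CInt (fun _ => c) a b = (RtoC (b - a) * c)%C.
Proof.
  unfold CInt. rewrite !RInt_const. destruct c as [x y].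
  unfold Cmult, RtoC, Re, Im, scal; simpl; unfold mult; simpl. f_equal; ring.
Qed.

(* Rotating the integral onto the positive real axis reduces the bound to the
   real-valued one. *)
Lemma CInt_bound_le (g : R -> C) (a b M : R) :
  a <= b -> contI g a b -> (forall t, a <= t <= b -> Cmod (g t) <= M) ->
  Cmod (CInt g a b) <= M * (b - a).
Proof.
  intros Hab Hg HM. set (v := CInt g a b).
  assert (Mpos : 0 <= M).
  { eapply Rle_trans; [|apply (HM a); lra]. apply Cmod_ge_0. }
  destruct (Req_dec (Cmod v) 0) as [H0|H0].
  { rewrite H0. apply Rmult_le_pos; lra. }
  assert (Hv : 0 < Cmod v) by (assert (K := Cmod_ge_0 v); lra).
  apply Rmult_le_reg_l with (Cmod v); [assumption|].
  assert (E : Cmod v * Cmod v = Re (Cconj v * v)%C).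
  { replace (Cmod v * Cmod v) with (Cmod v ^ 2) by ring. rewrite Cmod_sqr.
    unfold Re, Im; simpl; ring. }
  rewrite E. unfold v at 2. rewrite <- CInt_scal by assumption.
  change (RInt (fun t => Re (Cconj v * g t)%C) a b <= Cmod v * (M * (b - a))).
  replace (Cmod v * (M * (b - a))) with (RInt (fun _ => Cmod v * M) a b).
  2:{ rewrite RInt_const. unfold scal; simpl; unfold mult; simpl. ring. }
  apply RInt_le; [assumption| | |].
  - apply contI_ex_Re. now apply contI_scal.
  - apply ex_RInt_const.
  - intros t Ht. eapply Rle_trans; [apply Rle_abs|].
    eapply Rle_trans; [apply Re_le_Cmod|].
    rewrite Cmod_mult, Cmod_conj. apply Rmult_le_compat_l; [lra|].
    apply HM. lra.
Qed.

Lemma CInt_bound (g : R -> C) (a b M : R) :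
  contI g a b ->
  (forall t, Rmin a b <= t <= Rmax a b -> Cmod (g t) <= M) ->
  Cmod (CInt g a b) <= M * Rabs (b - a).
Proof.
  intros Hg HM. destruct (Rminmax_between a b) as [[E1 [E2 L]]|[E1 [E2 L]]];
  rewrite E1, E2 in HM.
  - rewrite Rabs_pos_eq by lra. now apply CInt_bound_le.
  - rewrite CInt_swap by now apply contI_swap. rewrite Cmod_opp.
    rewrite Rabs_minus_sym, Rabs_pos_eq by lra.
    apply CInt_bound_le; auto. now apply contI_swap.
Qed.

Lemma CInt_FTC (P g : R -> C) (a b : R) :
  contI g a b ->
  (forall t, Rmin a b <= t <= Rmax a b -> rdiff P t (g t)) ->
  CInt g a b = (P b - P a)%C.
Proof.
  intros Hg HP. apply Ceq.
  - apply (is_RInt_unique (V := R_CompleteNormedModule)).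
    apply (is_RInt_derive (fun t => Re (P t)) (fun t => Re (g t))).
    + intros t Ht. apply rdiff_Re. now apply HP.
    + intros t Ht. apply rcont_Re. now apply Hg.
  - apply (is_RInt_unique (V := R_CompleteNormedModule)).
    apply (is_RInt_derive (fun t => Im (P t)) (fun t => Im (g t))).
    + intros t Ht. apply rdiff_Im. now apply HP.
    + intros t Ht. apply rcont_Im. now apply Hg.
Qed.

Lemma CInt_derive (g : R -> C) (a b : R) :
  (forall t, rcont g t) -> rdiff (fun x => CInt g a x) b (g b).
Proof.
  intros H. unfold CInt.
  replace (g b) with (Re (g b), Im (g b)) by (destruct (g b); reflexivity).
  apply rdiff_pair.
  - apply (is_derive_RInt (fun t => Re (g t)) _ a).
    + apply filter_forall. intros x. apply (RInt_correct (V := R_CompleteNormedModule)).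
      apply contI_ex_Re. intros t _. apply H.
    + apply rcont_Re, H.
  - apply (is_derive_RInt (fun t => Im (g t)) _ a).
    + apply filter_forall. intros x. apply (RInt_correct (V := R_CompleteNormedModule)).
      apply contI_ex_Im. intros t _. apply H.
    + apply rcont_Im, H.
Qed.

Lemma CInt_shift (g : R -> C) (a b c : R) :
  (forall t, rcont g t) -> CInt (fun t => g (t + c)) a b = CInt g (a + c) (b + c).
Proof.
  intros H.
  assert (E : forall f : R -> R, (forall t, continuous f t) ->
    RInt (fun t => f (t + c)) a b = RInt f (a + c) (b + c)).
  { intros f Hf.
    assert (K := RInt_comp_lin (V := R_CompleteNormedModule) f 1 c a b).
    rewrite !Rmult_1_l in K. rewrite <- K.
    - apply RInt_ext. intros t _. change (f (t + c) = 1 * f (1 * t + c)).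
      now rewrite !Rmult_1_l.
    - apply (ex_RInt_continuous (V := R_CompleteNormedModule)). intros t _. apply Hf. }
  unfold CInt. f_equal.
  - apply (E (fun t => Re (g t))). intros t. apply rcont_Re, H.
  - apply (E (fun t => Im (g t))). intros t. apply rcont_Im, H.
Qed.

(** * Goursat's theorem on rectangles *)

Definition rect (x1 x2 y1 y2 : R) (z : C) : Prop :=
  Rmin x1 x2 <= Re z <= Rmax x1 x2 /\ Rmin y1 y2 <= Im z <= Rmax y1 y2.

Definition RectI (f : C -> C) (x1 x2 y1 y2 : R) : C :=
  (CInt (fun t => f (t, y1)) x1 x2 + Ci * CInt (fun t => f (x2, t)) y1 y2
   - CInt (fun t => f (t, y2)) x1 x2 - Ci * CInt (fun t => f (x1, t)) y1 y2)%C.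

Lemma rdiff_horizontal (y t : R) : rdiff (fun s => (s, y)) t (RtoC 1).
Proof. apply (rdiff_pair (fun s => s) (fun _ => y)); auto_derive; auto. Qed.

Lemma rdiff_vertical (x t : R) : rdiff (fun s => (x, s)) t Ci.
Proof. apply (rdiff_pair (fun _ => x) (fun s => s)); auto_derive; auto. Qed.

Lemma rcont_horizontal (f : C -> C) (y t : R) :
  ccont f (t, y) -> rcont (fun s => f (s, y)) t.
Proof.
  intros H. apply (rcont_comp f (fun s => (s, y))); [exact H|].
  exact (rdiff_rcont _ _ _ (rdiff_horizontal y t)).
Qed.

Lemma rcont_vertical (f : C -> C) (x t : R) :
  ccont f (x, t) -> rcont (fun s => f (x, s)) t.
Proof.
  intros H. apply (rcont_comp f (fun s => (x, s))); [exact H|].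
  exact (rdiff_rcont _ _ _ (rdiff_vertical x t)).
Qed.

Lemma Rminmax_l (a b : R) : Rmin a b <= a <= Rmax a b.
Proof. split; [apply Rmin_l|apply Rmax_l]. Qed.

Lemma Rminmax_r (a b : R) : Rmin a b <= b <= Rmax a b.
Proof. split; [apply Rmin_r|apply Rmax_r]. Qed.

Lemma contI_horizontal (f : C -> C) (x1 x2 y1 y2 y : R) :
  (forall z, rect x1 x2 y1 y2 z -> ccont f z) ->
  Rmin y1 y2 <= y <= Rmax y1 y2 -> contI (fun t => f (t, y)) x1 x2.
Proof.
  intros H Hy t Ht. apply rcont_horizontal. apply H. split; assumption.
Qed.

Lemma contI_vertical (f : C -> C) (x1 x2 y1 y2 x : R) :
  (forall z, rect x1 x2 y1 y2 z -> ccont f z) ->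
  Rmin x1 x2 <= x <= Rmax x1 x2 -> contI (fun t => f (x, t)) y1 y2.
Proof.
  intros H Hx t Ht. apply rcont_vertical. apply H. split; assumption.
Qed.

Ltac sides H :=
  first [ eapply contI_horizontal; [exact H|]
        | eapply contI_vertical; [exact H|] ];
  first [ apply Rminmax_l | apply Rminmax_r | assumption ].

Lemma RectI_primitive (P f : C -> C) (x1 x2 y1 y2 : R) :
  (forall z, rect x1 x2 y1 y2 z -> ccont f z) ->
  (forall z, rect x1 x2 y1 y2 z -> cdiff P z (f z)) ->
  RectI f x1 x2 y1 y2 = RtoC 0.
Proof.
  intros Hf HP. unfold RectI.
  assert (Hor : forall y, Rmin y1 y2 <= y <= Rmax y1 y2 ->
    CInt (fun t => f (t, y)) x1 x2 = (P (x2, y) - P (x1, y))%C).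
  { intros y Hy. apply (CInt_FTC (fun t => P (t, y))); [sides Hf|].
    intros t Ht. replace (f (t, y)) with (f (t, y) * RtoC 1)%C by ring.
    apply (rdiff_comp P (fun s => (s, y))).
    - apply HP. split; assumption.
    - apply rdiff_horizontal. }
  assert (Ver : forall x, Rmin x1 x2 <= x <= Rmax x1 x2 ->
    (Ci * CInt (fun t => f (x, t)) y1 y2)%C = (P (x, y2) - P (x, y1))%C).
  { intros x Hx. rewrite <- CInt_scal by sides Hf.
    apply (CInt_FTC (fun t => P (x, t))).
    - apply contI_scal. sides Hf.
    - intros t Ht. replace (Ci * f (x, t))%C with (f (x, t) * Ci)%C by ring.
      apply (rdiff_comp P (fun s => (x, s))).
      + apply HP. split; assumption.
      + apply rdiff_vertical. }
  rewrite !Hor, !Ver by (apply Rminmax_l || apply Rminmax_r). ring.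
Qed.

Lemma RectI_minus (f g : C -> C) (x1 x2 y1 y2 : R) :
  (forall z, rect x1 x2 y1 y2 z -> ccont f z) ->
  (forall z, rect x1 x2 y1 y2 z -> ccont g z) ->
  RectI (fun z => f z - g z)%C x1 x2 y1 y2 =
  (RectI f x1 x2 y1 y2 - RectI g x1 x2 y1 y2)%C.
Proof.
  intros Hf Hg. unfold RectI.
  rewrite !(CInt_minus (fun t => f _) (fun t => g _)) by
    first [sides Hf | sides Hg]. ring.
Qed.

Lemma RectI_bound (f : C -> C) (x1 x2 y1 y2 M : R) :
  (forall z, rect x1 x2 y1 y2 z -> ccont f z) ->
  (forall z, rect x1 x2 y1 y2 z -> Cmod (f z) <= M) ->
  Cmod (RectI f x1 x2 y1 y2) <= 2 * M * (Rabs (x2 - x1) + Rabs (y2 - y1)).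
Proof.
  intros Hf HM. unfold RectI.
  assert (Hor : forall y, Rmin y1 y2 <= y <= Rmax y1 y2 ->
    Cmod (CInt (fun t => f (t, y)) x1 x2) <= M * Rabs (x2 - x1)).
  { intros y Hy. apply CInt_bound; [sides Hf|].
    intros t Ht. apply HM. split; assumption. }
  assert (Ver : forall x, Rmin x1 x2 <= x <= Rmax x1 x2 ->
    Cmod (Ci * CInt (fun t => f (x, t)) y1 y2)%C <= M * Rabs (y2 - y1)).
  { intros x Hx. rewrite Cmod_mult, Cmod_Ci, Rmult_1_l.
    apply CInt_bound; [sides Hf|].
    intros t Ht. apply HM. split; assumption. }
  assert (H1 := Hor _ (Rminmax_l y1 y2)). assert (H2 := Hor _ (Rminmax_r y1 y2)).
  assert (H3 := Ver _ (Rminmax_l x1 x2)). assert (H4 := Ver _ (Rminmax_r x1 x2)).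
  eapply Rle_trans; [apply Cmod_sub_le|].
  eapply Rle_trans; [apply Rplus_le_compat_r, Cmod_sub_le|].
  eapply Rle_trans; [do 2 apply Rplus_le_compat_r; apply Cmod_triangle|]. lra.
Qed.

Lemma RectI_hsplit (f : C -> C) (x1 x2 x3 y1 y2 : R) :
  x1 <= x2 <= x3 -> (forall z, rect x1 x3 y1 y2 z -> ccont f z) ->
  RectI f x1 x3 y1 y2 = (RectI f x1 x2 y1 y2 + RectI f x2 x3 y1 y2)%C.
Proof.
  intros Hx Hf. unfold RectI.
  assert (S : forall y, Rmin y1 y2 <= y <= Rmax y1 y2 ->
    CInt (fun t => f (t, y)) x1 x3 =
    (CInt (fun t => f (t, y)) x1 x2 + CInt (fun t => f (t, y)) x2 x3)%C).
  { intros y Hy. symmetry. apply CInt_Chasles; intros t Ht;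
    apply rcont_horizontal; apply Hf; (split; [|exact Hy]);
    rewrite Rmin_left, Rmax_right in Ht by lra;
    rewrite Rmin_left, Rmax_right by lra; unfold Re; simpl; lra. }
  rewrite (S y1), (S y2) by (apply Rminmax_l || apply Rminmax_r). ring.
Qed.

Lemma RectI_vsplit (f : C -> C) (x1 x2 y1 y2 y3 : R) :
  y1 <= y2 <= y3 -> (forall z, rect x1 x2 y1 y3 z -> ccont f z) ->
  RectI f x1 x2 y1 y3 = (RectI f x1 x2 y1 y2 + RectI f x1 x2 y2 y3)%C.
Proof.
  intros Hy Hf. unfold RectI.
  assert (S : forall x, Rmin x1 x2 <= x <= Rmax x1 x2 ->
    CInt (fun t => f (x, t)) y1 y3 =
    (CInt (fun t => f (x, t)) y1 y2 + CInt (fun t => f (x, t)) y2 y3)%C).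
  { intros x Hx. symmetry. apply CInt_Chasles; intros t Ht;
    apply rcont_vertical; apply Hf; (split; [exact Hx|]);
    rewrite Rmin_left, Rmax_right in Ht by lra;
    rewrite Rmin_left, Rmax_right by lra; unfold Im; simpl; lra. }
  rewrite (S x1), (S x2) by (apply Rminmax_l || apply Rminmax_r). ring.
Qed.

Lemma RectI_swap_x (f : C -> C) (x1 x2 y1 y2 : R) :
  (forall z, rect x1 x2 y1 y2 z -> ccont f z) ->
  RectI f x2 x1 y1 y2 = (- RectI f x1 x2 y1 y2)%C.
Proof.
  intros Hf. unfold RectI.
  rewrite !(CInt_swap _ x1 x2) by sides Hf. ring.
Qed.

Lemma RectI_swap_y (f : C -> C) (x1 x2 y1 y2 : R) :
  (forall z, rect x1 x2 y1 y2 z -> ccont f z) ->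
  RectI f x1 x2 y2 y1 = (- RectI f x1 x2 y1 y2)%C.
Proof.
  intros Hf. unfold RectI.
  rewrite !(CInt_swap _ y1 y2) by sides Hf. ring.
Qed.

Lemma nested_intervals (x a : nat -> R) :
  (forall n, 0 <= a n) -> (forall n, x n <= x (S n)) ->
  (forall n, x (S n) + a (S n) <= x n + a n) ->
  exists c, forall n, x n <= c <= x n + a n.
Proof.
  intros Ha Hx Hxa.
  assert (U : forall n k, x n <= x (n + k)%nat /\ x (n + k)%nat + a (n + k)%nat <= x n + a n).
  { intros n k. induction k.
    - rewrite Nat.add_0_r. lra.
    - rewrite Nat.add_succ_r. specialize (Hx (n + k)%nat).
      specialize (Hxa (n + k)%nat). lra. }
  assert (V : forall n m, x n <= x m + a m).
  { intros n m. destruct (Nat.le_ge_cases n m) as [L|L].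
    - destruct (U n (m - n)%nat) as [H _].
      replace (n + (m - n))%nat with m in H by lia. specialize (Ha m). lra.
    - destruct (U m (n - m)%nat) as [_ H].
      replace (m + (n - m))%nat with n in H by lia. specialize (Ha n). lra. }
  destruct (completeness (fun y => exists n, y = x n)) as [c [Hc1 Hc2]].
  - exists (x O + a O). intros y [n ->]. apply V.
  - exists (x O). now exists O.
  - exists c. intros n. split.
    + apply Hc1. now exists n.
    + apply Hc2. intros y [m ->]. apply V.
Qed.

(** One bisection step: some quarter of the rectangle carries at least a
    quarter of the boundary integral. *)
Definition quarter (f : C -> C) (q : R * R * R * R) : R * R * R * R :=
  let '(x, y, a, b) := q in
  let big u v := Rle_dec (Cmod (RectI f x (x + a) y (y + b)) / 4)
    (Cmod (RectI f u (u + a / 2) v (v + b / 2))) in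
  if big x y then (x, y, a / 2, b / 2)
  else if big (x + a / 2) y then (x + a / 2, y, a / 2, b / 2)
  else if big x (y + b / 2) then (x, y + b / 2, a / 2, b / 2)
  else (x + a / 2, y + b / 2, a / 2, b / 2).

Lemma quarter_spec (f : C -> C) (x y a b : R) :
  0 <= a -> 0 <= b -> (forall z, rect x (x + a) y (y + b) z -> ccont f z) ->
  exists x' y', quarter f (x, y, a, b) = (x', y', a / 2, b / 2) /\
    x <= x' /\ x' + a / 2 <= x + a /\ y <= y' /\ y' + b / 2 <= y + b /\
    Cmod (RectI f x (x + a) y (y + b)) <=
      4 * Cmod (RectI f x' (x' + a / 2) y' (y' + b / 2)).
Proof.
  intros Ha Hb Hf.
  assert (E : RectI f x (x + a) y (y + b) =
    ((RectI f x (x + a / 2) y (y + b / 2) +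
      RectI f x (x + a / 2) (y + b / 2) (y + b / 2 + b / 2)) +
     (RectI f (x + a / 2) (x + a / 2 + a / 2) y (y + b / 2) +
      RectI f (x + a / 2) (x + a / 2 + a / 2) (y + b / 2) (y + b / 2 + b / 2)))%C).
  { replace (x + a / 2 + a / 2) with (x + a) by field.
    replace (y + b / 2 + b / 2) with (y + b) by field.
    rewrite (RectI_hsplit f x (x + a / 2) (x + a)) by (try assumption; lra).
    rewrite (RectI_vsplit f x (x + a / 2) y (y + b / 2) (y + b)).
    - rewrite (RectI_vsplit f (x + a / 2) (x + a) y (y + b / 2) (y + b)); auto.
      lra. intros z [H1 H2]. apply Hf. split; auto.
      rewrite Rmin_left, Rmax_right in * by lra. lra.
    - lra.
    - intros z [H1 H2]. apply Hf. split; auto.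
      rewrite Rmin_left, Rmax_right in * by lra. lra. }
  unfold quarter.
  destruct Rle_dec as [L1|L1].
  { do 2 eexists. split; [reflexivity|]. repeat split; lra. }
  destruct Rle_dec as [L2|L2].
  { do 2 eexists. split; [reflexivity|]. repeat split; lra. }
  destruct Rle_dec as [L3|L3].
  { do 2 eexists. split; [reflexivity|]. repeat split; lra. }
  do 2 eexists. split; [reflexivity|]. repeat split; try lra.
  set (I0 := RectI f x (x + a) y (y + b)) in *.
  set (I1 := RectI f x (x + a / 2) y (y + b / 2)) in *.
  set (I2 := RectI f (x + a / 2) (x + a / 2 + a / 2) y (y + b / 2)) in *.
  set (I3 := RectI f x (x + a / 2) (y + b / 2) (y + b / 2 + b / 2)) in *.
  set (I4 := RectI f (x + a / 2) (x + a / 2 + a / 2) (y + b / 2) (y + b / 2 + b / 2)) in *.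
  assert (T1 := Cmod_triangle (I1 + I3) (I2 + I4)).
  assert (T2 := Cmod_triangle I1 I3). assert (T3 := Cmod_triangle I2 I4).
  rewrite <- E in T1. lra.
Qed.

(** Bisection produces rectangles shrinking to a point [c] whose boundary integrals
    decay at most like [4 ^ - n].  Differentiability at [c] makes them
    [o(4 ^ - n)], because the affine part of [f] integrates to zero. *)
Lemma goursat_le (f : C -> C) (x0 y0 a0 b0 : R) :
  0 <= a0 -> 0 <= b0 ->
  (forall z, rect x0 (x0 + a0) y0 (y0 + b0) z -> exists l, cdiff f z l) ->
  RectI f x0 (x0 + a0) y0 (y0 + b0) = RtoC 0.
Proof.
  intros Ha0 Hb0 Hf.
  set (q := fix q n := match n with O => (x0, y0, a0, b0) | S n => quarter f (q n) end).
  set (X n := fst (fst (fst (q n)))). set (Y n := snd (fst (fst (q n)))).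
  set (a n := a0 / 2 ^ n). set (b n := b0 / 2 ^ n).
  assert (P2 : forall n, 0 < 2 ^ n) by (intros n; apply pow_lt; lra).
  assert (Ha : forall n, 0 <= a n) by
    (intros n; apply Rmult_le_pos; [|left; apply Rinv_0_lt_compat]; auto).
  assert (Hb : forall n, 0 <= b n) by
    (intros n; apply Rmult_le_pos; [|left; apply Rinv_0_lt_compat]; auto).
  assert (aS : forall n, a (S n) = a n / 2)
    by (intros n; unfold a; simpl; field; specialize (P2 n); lra).
  assert (bS : forall n, b (S n) = b n / 2)
    by (intros n; unfold b; simpl; field; specialize (P2 n); lra).
  assert (sub : forall n, x0 <= X n -> X n + a n <= x0 + a0 -> y0 <= Y n ->
    Y n + b n <= y0 + b0 -> forall z, rect (X n) (X n + a n) (Y n) (Y n + b n) z ->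
    ccont f z).
  { intros n H1 H2 H3 H4 z [H5 H6]. destruct (Hf z) as [l Hl].
    - specialize (Ha n). specialize (Hb n). split;
      rewrite Rmin_left, Rmax_right in * by lra; lra.
    - exact (cdiff_cont _ _ _ Hl). }
  assert (Step : forall n, q n = (X n, Y n, a n, b n) ->
    x0 <= X n -> X n + a n <= x0 + a0 -> y0 <= Y n -> Y n + b n <= y0 + b0 ->
    q (S n) = (X (S n), Y (S n), a (S n), b (S n)) /\
    X n <= X (S n) /\ X (S n) + a (S n) <= X n + a n /\
    Y n <= Y (S n) /\ Y (S n) + b (S n) <= Y n + b n /\
    Cmod (RectI f (X n) (X n + a n) (Y n) (Y n + b n)) <=
      4 * Cmod (RectI f (X (S n)) (X (S n) + a (S n)) (Y (S n)) (Y (S n) + b (S n)))).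
  { intros n E H1 H2 H3 H4.
    destruct (quarter_spec f (X n) (Y n) (a n) (b n) (Ha n) (Hb n)
      (sub n H1 H2 H3 H4)) as [x' [y' [E' K]]].
    assert (ES : q (S n) = (x', y', a n / 2, b n / 2)).
    { change (q (S n)) with (quarter f (q n)). now rewrite E. }
    assert (EX : X (S n) = x') by (unfold X; now rewrite ES).
    assert (EY : Y (S n) = y') by (unfold Y; now rewrite ES).
    rewrite EX, EY, aS, bS. now split. }
  assert (Inv : forall n, q n = (X n, Y n, a n, b n) /\
    x0 <= X n /\ X n + a n <= x0 + a0 /\ y0 <= Y n /\ Y n + b n <= y0 + b0 /\
    Cmod (RectI f x0 (x0 + a0) y0 (y0 + b0)) <=
      4 ^ n * Cmod (RectI f (X n) (X n + a n) (Y n) (Y n + b n))).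
  { induction n as [|n [E [H1 [H2 [H3 [H4 H5]]]]]].
    - unfold X, Y, a, b; simpl.
      replace (a0 / 1) with a0 by field. replace (b0 / 1) with b0 by field.
      repeat split; lra.
    - destruct (Step n E H1 H2 H3 H4) as [ES [K1 [K2 [K3 [K4 K5]]]]].
      repeat split; try lra; [exact ES|].
      eapply Rle_trans; [exact H5|]. simpl. rewrite (Rmult_comm 4), Rmult_assoc.
      apply Rmult_le_compat_l; [apply pow_le; lra|exact K5]. }
  destruct (nested_intervals X a Ha) as [cx Hcx]; try (intros n; now apply Step; apply Inv).
  destruct (nested_intervals Y b Hb) as [cy Hcy]; try (intros n; now apply Step; apply Inv).
  set (c := (cx, cy) : C).
  destruct (Hf c) as [l Hl].
  { specialize (Hcx O). specialize (Hcy O). unfold X, Y, a, b in Hcx, Hcy.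
    simpl in Hcx, Hcy.
    replace (a0 / 1) with a0 in Hcx by field.
    replace (b0 / 1) with b0 in Hcy by field.
    split; rewrite Rmin_left, Rmax_right by lra; assumption. }
  apply Cmod_eq_0. apply Rle_antisym; [|apply Cmod_ge_0].
  set (s := a0 + b0). assert (Hs : 0 <= s) by (unfold s; lra).
  apply Rnot_lt_le. intros L.
  set (I := Cmod (RectI f x0 (x0 + a0) y0 (y0 + b0))) in *.
  set (e := I / (2 * (2 * s * s + 1))).
  assert (Hss : 0 <= s * s) by now apply Rmult_le_pos.
  assert (He : 0 < e) by (apply Rdiv_lt_0_compat; lra).
  destruct (Hl e He) as [d [Hd K]].
  assert (exists n, s / 2 ^ n < d) as [n Hn].
  { assert (0 < d / (s + 1)) by (apply Rdiv_lt_0_compat; lra).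
    destruct (pow_lt_1_zero (/ 2)) with (y := d / (s + 1)) as [n Hn]; auto.
    { rewrite Rabs_pos_eq; lra. }
    exists n. specialize (Hn n (Nat.le_refl n)).
    rewrite Rabs_pos_eq in Hn by (apply pow_le; lra).
    rewrite pow_inv in Hn. unfold Rdiv.
    apply Rle_lt_trans with ((s + 1) * / 2 ^ n).
    - apply Rmult_le_compat_r; [|lra]. left. now apply Rinv_0_lt_compat.
    - apply Rmult_lt_compat_l with (r := s + 1) in Hn; [|lra].
      replace ((s + 1) * (d / (s + 1))) with d in Hn by (field; lra). exact Hn. }
  destruct (Inv n) as [_ [H1 [H2 [H3 [H4 H5]]]]].
  assert (Hcf := sub n H1 H2 H3 H4).
  (* The remainder [f - g] is at most [e * s / 2 ^ n] on the [n]-th rectangle, whose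
     perimeter is [2 * s / 2 ^ n]. *)
  set (g := fun z : C => (f c + l * (z - c))%C).
  set (Pg := fun z : C => (f c * z + l * ((z - c) * (z - c)) / 2)%C).
  assert (Dg : forall z, cdiff g z l).
  { intros z. apply cdiff_eq with (RtoC 0 + l * (RtoC 1 - RtoC 0))%C; [ring|].
    apply (cdiff_plus (fun _ => f c) (fun z => l * (z - c))%C);
    [apply cdiff_const|]. apply (cdiff_scal l (fun z => z - c)%C).
    apply (cdiff_minus (fun z => z) (fun _ => c));
    [apply cdiff_id|apply cdiff_const]. }
  assert (DP : forall z, cdiff Pg z (g z)).
  { intros z.
    apply cdiff_ext with (fun z => f c * z + l / 2 * ((z - c) * (z - c)))%C.
    { apply filter_forall. intros w. unfold Pg. field.  }
    apply cdiff_eq with (f c * RtoC 1 + l / 2 * ((RtoC 1 - RtoC 0) * (z - c)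
      + (z - c) * (RtoC 1 - RtoC 0)))%C; [unfold g; field|].
    assert (Dc : cdiff (fun z => z - c)%C z (RtoC 1 - RtoC 0)%C) by
      (apply (cdiff_minus (fun z => z) (fun _ => c));
       [apply cdiff_id|apply cdiff_const]).
    apply (cdiff_plus (fun z => f c * z)%C (fun z => l / 2 * ((z - c) * (z - c)))%C).
    - apply (cdiff_scal (f c) (fun z => z)), cdiff_id.
    - apply (cdiff_scal (l / 2) (fun z => (z - c) * (z - c)))%C.
      apply (cdiff_mult (fun z => z - c)%C (fun z => z - c)%C); exact Dc. }
  assert (E0 : RectI f (X n) (X n + a n) (Y n) (Y n + b n) =
    RectI (fun z => f z - g z)%C (X n) (X n + a n) (Y n) (Y n + b n)).
  { rewrite RectI_minus; [|assumption|].
    - rewrite (RectI_primitive Pg g); [ring| |].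
      + intros z _. exact (cdiff_cont _ _ _ (Dg z)).
      + intros z _. apply DP.
    - intros z _. exact (cdiff_cont _ _ _ (Dg z)). }
  assert (Bd : Cmod (RectI f (X n) (X n + a n) (Y n) (Y n + b n)) <=
    2 * (e * (s / 2 ^ n)) * (s / 2 ^ n)).
  { rewrite E0.
    replace (s / 2 ^ n) with (Rabs (X n + a n - X n) + Rabs (Y n + b n - Y n)) at 2.
    2:{ replace (X n + a n - X n) with (a n) by ring.
        replace (Y n + b n - Y n) with (b n) by ring.
        rewrite !Rabs_pos_eq by auto. unfold a, b, s. field.
        specialize (P2 n). lra. }
    apply RectI_bound.
    - intros z Hz. apply (clim_minus (Cnear z)); [now apply Hcf|].
      exact (cdiff_cont _ _ _ (Dg z)).
    - intros z [G1 G2]. specialize (Ha n). specialize (Hb n).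
      rewrite Rmin_left, Rmax_right in G1, G2 by lra.
      specialize (Hcx n). specialize (Hcy n).
      assert (D : Cmod (z - c) <= s / 2 ^ n).
      { eapply Rle_trans; [apply Cmod_le_Re_Im|].
        replace (s / 2 ^ n) with (a n + b n) by
          (unfold a, b, s; field; specialize (P2 n); lra).
        change (Rabs (Re z - cx) + Rabs (Im z - cy) <= a n + b n).
        apply Rplus_le_compat; apply Rabs_le; lra. }
      replace (f z - g z)%C with (f z - f c - l * (z - c))%C
        by (unfold g; ring).
      eapply Rle_trans; [apply K; lra|].
      apply Rmult_le_compat_l; lra. }
  assert (Hfin : I <= 2 * e * (s * s)).
  { eapply Rle_trans; [exact H5|].
    apply Rle_trans with (4 ^ n * (2 * (e * (s / 2 ^ n)) * (s / 2 ^ n))).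
    - apply Rmult_le_compat_l; [|exact Bd]. apply pow_le; lra.
    - right. replace (4 ^ n) with (2 ^ n * 2 ^ n).
      + field. specialize (P2 n). lra.
      + rewrite <- Rpow_mult_distr. f_equal; lra. }
  assert (Ie : I = e * (2 * (2 * s * s + 1))) by (unfold e; field; lra).
  nra.
Qed.

Theorem goursat (f : C -> C) (x1 x2 y1 y2 : R) :
  x1 <= x2 -> y1 <= y2 ->
  (forall z, rect x1 x2 y1 y2 z -> exists l, cdiff f z l) ->
  RectI f x1 x2 y1 y2 = RtoC 0.
Proof.
  intros Hx Hy Hf.
  replace x2 with (x1 + (x2 - x1)) in * by ring.
  replace y2 with (y1 + (y2 - y1)) in * by ring.
  apply goursat_le; try lra. exact Hf.
Qed.

(** * Exceptional lines and primitives *)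

Lemma Cmod_le_parts (a b : C) :
  Rabs (Re a) <= Rabs (Re b) -> Rabs (Im a) <= Rabs (Im b) -> Cmod a <= Cmod b.
Proof.
  intros H1 H2. apply Rsqr_incr_0_var; [|apply Cmod_ge_0].
  rewrite !Rsqr_pow2, !Cmod_sqr. rewrite <- !Rsqr_pow2.
  apply Rplus_le_compat; apply Rsqr_le_abs_1; assumption.
Qed.

Lemma unif_cont_rect (f : C -> C) (x1 x2 y1 y2 : R) :
  (forall z, rect x1 x2 y1 y2 z -> ccont f z) ->
  forall e, 0 < e -> exists d, 0 < d /\ forall z w,
    rect x1 x2 y1 y2 z -> rect x1 x2 y1 y2 w -> Cmod (z - w) < d ->
    Cmod (f z - f w) < e.
Proof.
  intros Hf e He.
  assert (H : forall u v, exists d : posreal, rect x1 x2 y1 y2 (u, v) ->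
    forall w, Cmod (w - (u, v)) < 3 * d -> Cmod (f w - f (u, v)) < e / 2).
  { intros u v. destruct (classic (rect x1 x2 y1 y2 (u, v))) as [I|I].
    - destruct (Hf _ I _ (half_pos He)) as [d [Hd K]].
      assert (Hd3 : 0 < d / 3) by lra. exists (mkposreal _ Hd3).
      intros _ w Hw. apply K. simpl in Hw. lra.
    - exists (mkposreal _ He). intros J. contradiction. }
  set (delta u v := proj1_sig (constructive_indefinite_description _ (H u v))).
  assert (Hdelta : forall u v, rect x1 x2 y1 y2 (u, v) ->
    forall w, Cmod (w - (u, v)) < 3 * delta u v -> Cmod (f w - f (u, v)) < e / 2).
  { intros u v. exact (proj2_sig (constructive_indefinite_description _ (H u v))). }
  destruct (compactness_value_2d (Rmin x1 x2) (Rmax x1 x2) (Rmin y1 y2)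
    (Rmax y1 y2) delta) as [d Hd].
  exists d. split; [apply cond_pos|]. intros z w Hz Hw Hzw.
  destruct (NNPP _ (Hd (Re z) (Im z) (proj1 Hz) (proj2 Hz)))
    as [u [v [Hu [Hv [H1 [H2 H3]]]]]].
  assert (Huv : rect x1 x2 y1 y2 (u, v)) by (split; assumption).
  assert (Z : Cmod (z - (u, v)) < 2 * delta u v).
  { eapply Rle_lt_trans; [apply Cmod_le_Re_Im|].
    change (Rabs (Re z - u) + Rabs (Im z - v) < 2 * delta u v). lra. }
  assert (W : Cmod (w - (u, v)) < 3 * delta u v).
  { eapply Rle_lt_trans; [apply (Cmod_sub_triangle _ z)|].
    rewrite Cmod_sub_sym in Hzw. lra. }
  assert (P : 0 < delta u v) by apply cond_pos.
  assert (A := Hdelta _ _ Huv _ W).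
  assert (B : Cmod (f z - f (u, v)) < e / 2) by (apply Hdelta; [assumption|lra]).
  assert (T := Cmod_sub_triangle (f z) (f (u, v)) (f w)).
  rewrite (Cmod_sub_sym (f (u, v)) (f w)) in T. lra.
Qed.

Lemma RectI_thin (f : C -> C) (x0 y1 y2 u v e : R) :
  u <= x0 <= v -> y1 <= y2 ->
  (forall z, rect u v y1 y2 z -> ccont f z) ->
  (forall t y, u <= t <= v -> y1 <= y <= y2 -> Cmod (f (t, y) - f (x0, y)) <= e) ->
  Cmod (RectI f u v y1 y2) <=
    (Cmod (f (x0, y1)) + Cmod (f (x0, y2)) + 2 * e) * (v - u) + 2 * e * (y2 - y1).
Proof.
  intros Hx Hy Hf He. unfold RectI.
  assert (Hor : forall y, y1 <= y <= y2 ->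
    Cmod (CInt (fun t => f (t, y)) u v) <= (Cmod (f (x0, y)) + e) * (v - u)).
  { intros y Hyy. apply CInt_bound_le; [lra| |].
    - eapply contI_horizontal; [exact Hf|].
      rewrite Rmin_left, Rmax_right; lra.
    - intros t Ht. specialize (He t y Ht Hyy).
      assert (K := Cmod_sub_ge (f (t, y)) (f (x0, y))). lra. }
  assert (Ver : Cmod (CInt (fun t => f (v, t)) y1 y2 - CInt (fun t => f (u, t)) y1 y2)
    <= 2 * e * (y2 - y1)).
  { assert (V1 : contI (fun t => f (v, t)) y1 y2)
      by (eapply contI_vertical; [exact Hf|apply Rminmax_r]).
    assert (V2 : contI (fun t => f (u, t)) y1 y2)
      by (eapply contI_vertical; [exact Hf|apply Rminmax_l]).
    rewrite <- CInt_minus by assumption.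
    apply CInt_bound_le; [lra|now apply contI_minus|].
    intros t Ht. assert (K := Cmod_sub_triangle (f (v, t)) (f (x0, t)) (f (u, t))).
    rewrite (Cmod_sub_sym (f (x0, t))) in K.
    assert (A := He u t ltac:(lra) Ht). assert (B := He v t ltac:(lra) Ht). lra. }
  assert (H1 := Hor y1 ltac:(lra)). assert (H2 := Hor y2 ltac:(lra)).
  match goal with |- Cmod (?a + Ci * ?b - ?c - Ci * ?d)%C <= _ =>
    replace (a + Ci * b - c - Ci * d)%C with ((a - c) + Ci * (b - d))%C by ring
  end.
  eapply Rle_trans; [apply Cmod_triangle|].
  rewrite Cmod_mult, Cmod_Ci, Rmult_1_l.
  eapply Rle_trans; [apply Rplus_le_compat_r, Cmod_sub_le|]. lra.
Qed.

Lemma RectI_flat (f : C -> C) (x y1 y2 : R) : RectI f x x y1 y2 = RtoC 0.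
Proof. unfold RectI. rewrite !CInt_point. ring. Qed.

(** A vertical line of mere continuity does not obstruct Goursat's theorem: the
    rectangle splits into two parts off the line and a thin strip around it,
    whose boundary integral tends to zero by uniform continuity. *)
Lemma RectI_line_le (f : C -> C) (x0 x1 x2 y1 y2 : R) :
  x1 <= x2 -> y1 <= y2 ->
  (forall z, rect x1 x2 y1 y2 z -> ccont f z) ->
  (forall z, rect x1 x2 y1 y2 z -> Re z <> x0 -> exists l, cdiff f z l) ->
  RectI f x1 x2 y1 y2 = RtoC 0.
Proof.
  intros Hx Hy Hf Hd.
  assert (sub : forall u v, x1 <= u -> u <= v -> v <= x2 ->
    forall z, rect u v y1 y2 z -> rect x1 x2 y1 y2 z).
  { intros u v H1 H2 H3 z [H4 H5]. split; [|assumption].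
    rewrite Rmin_left, Rmax_right in * by lra. lra. }
  assert (off : forall u v, x1 <= u -> u <= v -> v <= x2 -> (v < x0 \/ x0 < u) ->
    RectI f u v y1 y2 = RtoC 0).
  { intros u v H1 H2 H3 H4. apply goursat; try assumption. intros z Hz.
    apply Hd; [now apply (sub u v)|]. destruct Hz as [Hz _].
    rewrite Rmin_left, Rmax_right in Hz by lra. lra. }
  destruct (Rlt_le_dec x0 x1) as [L1|L1]; [apply off; lra|].
  destruct (Rlt_le_dec x2 x0) as [L2|L2]; [apply off; lra|].
  apply Cmod_eq_0. apply Rle_antisym; [|apply Cmod_ge_0].
  apply Rnot_lt_le. intros L. set (I := Cmod (RectI f x1 x2 y1 y2)) in *.
  set (e := I / (4 * (y2 - y1 + 1))).
  assert (He : 0 < e) by (apply Rdiv_lt_0_compat; lra).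
  destruct (unif_cont_rect f x1 x2 y1 y2 Hf e He) as [d [Hd0 K]].
  set (A := Cmod (f (x0, y1)) + Cmod (f (x0, y2)) + 2 * e).
  assert (HA : 0 < A) by (unfold A; assert (H1 := Cmod_ge_0 (f (x0, y1)));
    assert (H2 := Cmod_ge_0 (f (x0, y2))); lra).
  set (s := Rmin (d / 2) (I / (8 * A))).
  assert (Hs : 0 < s) by (apply Rmin_pos; [lra|apply Rdiv_lt_0_compat; lra]).
  assert (Hs1 : s <= d / 2) by apply Rmin_l.
  assert (Hs2 : s <= I / (8 * A)) by apply Rmin_r.
  set (u := Rmax x1 (x0 - s)). set (v := Rmin x2 (x0 + s)).
  assert (Hu : x1 <= u <= x0 /\ x0 - s <= u)
    by (unfold u, Rmax; destruct Rle_dec; lra).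
  assert (Hv : x0 <= v <= x2 /\ v <= x0 + s)
    by (unfold v, Rmin; destruct Rle_dec; lra).
  assert (E : RectI f x1 x2 y1 y2 = RectI f u v y1 y2).
  { rewrite (RectI_hsplit f x1 u x2), (RectI_hsplit f u v x2); try lra; auto.
    2:{ intros z Hz. apply Hf. apply (sub u x2); auto; lra. }
    replace (RectI f x1 u y1 y2) with (RtoC 0).
    2:{ unfold u, Rmax. destruct Rle_dec; [|now rewrite RectI_flat].
        symmetry. apply off; lra. }
    replace (RectI f v x2 y1 y2) with (RtoC 0).
    2:{ unfold v, Rmin. destruct Rle_dec; [now rewrite RectI_flat|].
        symmetry. apply off; lra. }
    ring. }
  assert (B : I <= A * (v - u) + 2 * e * (y2 - y1)).
  { unfold I. rewrite E. apply RectI_thin; try lra.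
    - intros z Hz. apply Hf. apply (sub u v); auto; lra.
    - intros t y Ht Hyy. left. apply K.
      + split; rewrite Rmin_left, Rmax_right by lra; unfold Re, Im; simpl; lra.
      + split; rewrite Rmin_left, Rmax_right by lra; unfold Re, Im; simpl; lra.
      + eapply Rle_lt_trans; [apply Cmod_le_Re_Im|].
        change (Rabs (t - x0) + Rabs (y - y) < d).
        replace (y - y) with 0 by ring. rewrite Rabs_R0.
        assert (Rabs (t - x0) <= s) by (apply Rabs_le; lra). lra. }
  assert (B1 : A * (v - u) <= I / 4).
  { apply Rle_trans with (A * (2 * (I / (8 * A)))).
    - apply Rmult_le_compat_l; lra.
    - right. field. lra. }
  assert (B2 : 2 * e * (y2 - y1) <= I / 2).
  { apply Rle_trans with (2 * e * (y2 - y1 + 1)).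
    - apply Rmult_le_compat_l; lra.
    - right. unfold e. field. lra. }
  lra.
Qed.

Lemma rect_swap_x (x1 x2 y1 y2 : R) z : rect x1 x2 y1 y2 z -> rect x2 x1 y1 y2 z.
Proof. unfold rect. now rewrite (Rmin_comm x2), (Rmax_comm x2). Qed.

Lemma rect_swap_y (x1 x2 y1 y2 : R) z : rect x1 x2 y1 y2 z -> rect x1 x2 y2 y1 z.
Proof. unfold rect. now rewrite (Rmin_comm y2), (Rmax_comm y2). Qed.

Lemma RectI_line (f : C -> C) (x0 x1 x2 y1 y2 : R) :
  (forall z, rect x1 x2 y1 y2 z -> ccont f z) ->
  (forall z, rect x1 x2 y1 y2 z -> Re z <> x0 -> exists l, cdiff f z l) ->
  RectI f x1 x2 y1 y2 = RtoC 0.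
Proof.
  intros Hf Hd.
  assert (Half : forall u v, u <= v ->
    (forall z, rect u v y1 y2 z -> rect x1 x2 y1 y2 z) ->
    RectI f u v y1 y2 = RtoC 0).
  { intros u v Huv S. destruct (Rle_dec y1 y2) as [L|L].
    - apply RectI_line_le with x0; auto.
    - rewrite <- (Copp_0), <- (RectI_line_le f x0 u v y2 y1); auto; try lra.
      + apply RectI_swap_y. intros z Hz. apply Hf, S. now apply rect_swap_y.
      + intros z Hz. apply Hf, S. now apply rect_swap_y.
      + intros z Hz. apply Hd, S. now apply rect_swap_y. }
  destruct (Rle_dec x1 x2) as [L|L].
  - apply Half; auto.
  - rewrite <- (Copp_0), <- (Half x2 x1); try lra.
    + apply RectI_swap_x. intros z Hz. apply Hf. now apply rect_swap_x.
    + intros z Hz. now apply rect_swap_x.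
Qed.

Definition inball (z0 : C) (r : R) (z : C) : Prop := Cmod (z - z0) < r.

Lemma inball_open (z0 : C) (r : R) (z : C) :
  inball z0 r z -> Cnear z (inball z0 r).
Proof.
  intros H. unfold inball in H. exists (r - Cmod (z - z0)). split; [lra|].
  intros w Hw. unfold inball.
  eapply Rle_lt_trans; [apply (Cmod_sub_triangle w z z0)|]. lra.
Qed.

Lemma inball_rect (z0 : C) (r : R) (z w : C) :
  inball z0 r z -> rect (Re z0) (Re z) (Im z0) (Im z) w -> inball z0 r w.
Proof.
  intros H [H1 H2]. eapply Rle_lt_trans; [|exact H].
  assert (P : forall a b c, Rmin a b <= c <= Rmax a b -> Rabs (c - a) <= Rabs (b - a)).
  { intros a b c Hc. destruct (Rminmax_between a b) as [[E1 [E2 L]]|[E1 [E2 L]]];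
    rewrite E1, E2 in Hc.
    - rewrite !Rabs_pos_eq; lra.
    - rewrite !Rabs_left1; lra. }
  apply Cmod_le_parts.
  - exact (P _ _ _ H1).
  - exact (P _ _ _ H2).
Qed.

(** The integrals along the two L-shaped paths from the centre agree, and each of
    them is easy to differentiate in one of the two directions. *)
Theorem primitive_disc (f : C -> C) (z0 : C) (r x0 : R) :
  (forall z, inball z0 r z -> ccont f z) ->
  (forall z, inball z0 r z -> Re z <> x0 -> exists l, cdiff f z l) ->
  exists P, forall z, inball z0 r z -> cdiff P z (f z).
Proof.
  intros Hf Hd.
  set (a := Re z0). set (b := Im z0).
  set (P := fun z : C => (CInt (fun t => f (t, b)) a (Re z) +
    Ci * CInt (fun t => f (Re z, t)) b (Im z))%C).
  assert (HQ : forall z, inball z0 r z -> P z =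
    (CInt (fun t => f (t, Im z)) a (Re z) + Ci * CInt (fun t => f (a, t)) b (Im z))%C).
  { intros z Hz. assert (E : RectI f a (Re z) b (Im z) = RtoC 0).
    { apply (RectI_line f x0).
      - intros w Hw. apply Hf. exact (inball_rect _ _ _ _ Hz Hw).
      - intros w Hw. apply Hd. exact (inball_rect _ _ _ _ Hz Hw). }
    unfold RectI in E. unfold P. apply Ceq_minus. rewrite <- E. ring. }
  exists P. intros z Hz e He.
  destruct (inball_open _ _ _ Hz) as [d1 [Hd1 B1]].
  destruct (Hf z Hz (e / 2) (half_pos He)) as [d2 [Hd2 B2]].
  exists (Rmin d1 d2). split; [now apply Rmin_pos|]. intros w Hw.
  assert (Hw1 : Cmod (w - z) < d1) by (eapply Rlt_le_trans; [exact Hw|apply Rmin_l]).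
  assert (Hw2 : Cmod (w - z) < d2) by (eapply Rlt_le_trans; [exact Hw|apply Rmin_r]).
  set (m := (Re z, Im w) : C).
  assert (near : forall v, rect (Re z) (Re w) (Im z) (Im w) v ->
    Cmod (v - z) <= Cmod (w - z)).
  { intros v Hv. apply Rnot_lt_le. intros L.
    assert (K := inball_rect z (Cmod (v - z)) w v L Hv). unfold inball in K. lra. }
  assert (inb : forall v, rect (Re z) (Re w) (Im z) (Im w) v -> inball z0 r v).
  { intros v Hv. apply B1. specialize (near v Hv). lra. }
  assert (cl : forall v, rect (Re z) (Re w) (Im z) (Im w) v ->
    Cmod (f v - f z) <= e / 2).
  { intros v Hv. left. apply B2. specialize (near v Hv). lra. }
  assert (Im0 : inball z0 r m).
  { apply inb. split; [apply Rminmax_l|apply Rminmax_r]. }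
  assert (Iw : inball z0 r w).
  { apply inb. split; apply Rminmax_r. }
  assert (C1 : contI (fun t => f (t, Im w)) (Re z) (Re w)).
  { intros t Ht. apply rcont_horizontal, Hf, inb. split; [exact Ht|apply Rminmax_r]. }
  assert (C2 : contI (fun t => f (Re z, t)) (Im z) (Im w)).
  { intros t Ht. apply rcont_vertical, Hf, inb. split; [apply Rminmax_l|exact Ht]. }
  assert (E1 : (P w - P m)%C = CInt (fun t => f (t, Im w)) (Re z) (Re w)).
  { rewrite (HQ w Iw), (HQ m Im0). change (Im m) with (Im w). change (Re m) with (Re z).
    rewrite <- (CInt_Chasles (fun t => f (t, Im w)) a (Re z) (Re w)).
    - ring.
    - intros t Ht. apply rcont_horizontal, Hf. apply (inball_rect z0 r m); [exact Im0|].
      split; [exact Ht|apply Rminmax_r].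
    - exact C1. }
  assert (E2 : (P m - P z)%C = (Ci * CInt (fun t => f (Re z, t)) (Im z) (Im w))%C).
  { unfold P. change (Im m) with (Im w). change (Re m) with (Re z).
    rewrite <- (CInt_Chasles (fun t => f (Re z, t)) b (Im z) (Im w)).
    - ring.
    - intros t Ht. apply rcont_vertical, Hf. apply (inball_rect z0 r z); [exact Hz|].
      split; [apply Rminmax_r|exact Ht].
    - exact C2. }
  assert (E3 : (P w - P z - f z * (w - z))%C =
    (CInt (fun t => f (t, Im w) - f z)%C (Re z) (Re w) +
     Ci * CInt (fun t => f (Re z, t) - f z)%C (Im z) (Im w))%C).
  { rewrite (CInt_minus (fun t => f (t, Im w)) (fun _ => f z)); auto.
    2:{ intros t _. apply rcont_const. }
    rewrite (CInt_minus (fun t => f (Re z, t)) (fun _ => f z)); auto.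
    2:{ intros t _. apply rcont_const. }
    rewrite !CInt_const, <- E1.
    replace (P w - P z - f z * (w - z))%C with
      ((P w - P m) + (P m - P z) - f z * (w - z))%C by ring.
    rewrite E2.
    replace (w - z)%C with (RtoC (Re w - Re z) + Ci * RtoC (Im w - Im z))%C.
    - ring.
    - apply Ceq; unfold Re, Im; simpl; ring. }
  rewrite E3. eapply Rle_trans; [apply Cmod_triangle|].
  rewrite Cmod_mult, Cmod_Ci, Rmult_1_l.
  assert (K1 : Cmod (CInt (fun t => f (t, Im w) - f z)%C (Re z) (Re w)) <=
    e / 2 * Rabs (Re w - Re z)).
  { apply CInt_bound.
    - apply contI_minus; [exact C1|]. intros t _. apply rcont_const.
    - intros t Ht. apply cl. split; [exact Ht|apply Rminmax_r]. }
  assert (K2 : Cmod (CInt (fun t => f (Re z, t) - f z)%C (Im z) (Im w)) <=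
    e / 2 * Rabs (Im w - Im z)).
  { apply CInt_bound.
    - apply contI_minus; [exact C2|]. intros t _. apply rcont_const.
    - intros t Ht. apply cl. split; [apply Rminmax_l|exact Ht]. }
  assert (K3 : Rabs (Re w - Re z) <= Cmod (w - z)) by apply (Re_le_Cmod (w - z)).
  assert (K4 : Rabs (Im w - Im z) <= Cmod (w - z)) by apply (Im_le_Cmod (w - z)).
  nra.
Qed.

(** * Cauchy's integral formula *)

Definition circ (t : R) : C := (cos t, sin t).

Lemma Cmod_circ (t : R) : Cmod (circ t) = 1.
Proof.
  transitivity (sqrt 1); [|exact sqrt_1]. unfold Cmod, circ; simpl. f_equal.
  assert (H := sin2_cos2 t). unfold Rsqr in H. lra.
Qed.

Lemma circ_opp (t : R) : (circ t * circ (- t))%C = RtoC 1.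
Proof.
  unfold circ. rewrite cos_neg, sin_neg. assert (H := sin2_cos2 t).
  unfold Rsqr in H. apply Ceq; unfold Re, Im; simpl; lra.
Qed.

Lemma rdiff_circ (t : R) : rdiff circ t (Ci * circ t)%C.
Proof.
  replace (Ci * circ t)%C with ((- sin t, cos t) : C)
    by (apply Ceq; unfold Re, Im; simpl; ring).
  apply rdiff_pair; auto_derive; auto; ring.
Qed.

Lemma rdiff_circ_opp (t : R) : rdiff (fun s => circ (- s)) t (- Ci * circ (- t))%C.
Proof.
  replace (- Ci * circ (- t))%C with ((- - sin (- t), - cos (- t)) : C)
    by (apply Ceq; unfold Re, Im; simpl; ring).
  apply (rdiff_pair (fun s => cos (- s)) (fun s => sin (- s))); auto_derive; auto; ring.
Qed.

Lemma rcont_circ (t : R) : rcont circ t.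
Proof. exact (rdiff_rcont _ _ _ (rdiff_circ t)). Qed.

Lemma rcont_circ_opp (t : R) : rcont (fun s => circ (- s)) t.
Proof. exact (rdiff_rcont _ _ _ (rdiff_circ_opp t)). Qed.

Lemma cdiff_pow (n : nat) (z : C) :
  cdiff (fun w => w ^ S n)%C z (RtoC (INR (S n)) * z ^ n)%C.
Proof.
  induction n.
  - apply cdiff_ext with (fun w => w).
    + apply filter_forall. intros w. simpl. ring.
    + apply cdiff_eq with (RtoC 1); [simpl; ring|apply cdiff_id].
  - apply cdiff_eq with
      (RtoC 1 * z ^ S n + z * (RtoC (INR (S n)) * z ^ n))%C.
    { rewrite (S_INR (S n)), RtoC_plus. simpl. ring. }
    apply (cdiff_mult (fun w => w) (fun w => w ^ S n)%C);
    [apply cdiff_id|exact IHn].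
Qed.

Lemma rcont_pow (g : R -> C) (n : nat) (t : R) :
  rcont g t -> rcont (fun s => g s ^ n)%C t.
Proof.
  intros H. induction n.
  - exact (rcont_const (RtoC 1) t).
  - apply (rcont_mult g (fun s => g s ^ n)%C); assumption.
Qed.

Lemma CInt_circ_pow (n : nat) :
  CInt (fun t => circ (- t) ^ S n)%C 0 (2 * PI) = RtoC 0.
Proof.
  set (k := (RtoC (INR (S n)) * Ci)%C).
  assert (Hn : RtoC (INR (S n)) <> RtoC 0).
  { intros H. apply RtoC_inj in H. apply (not_0_INR (S n)); [lia|exact H]. }
  assert (Hk : k <> RtoC 0) by (apply Cmult_neq_0; [exact Hn|exact Ci_nz]).
  rewrite (CInt_FTC (fun t => - / k * circ (- t) ^ S n)%C).
  - replace (circ (- (2 * PI))) with (circ (- 0)).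
    { ring. }
    unfold circ. rewrite !cos_neg, !sin_neg, cos_2PI, sin_2PI, cos_0, sin_0.
    reflexivity.
  - intros t _. apply rcont_pow, rcont_circ_opp.
  - intros t _.
    assert (D := cdiff_scal (- / k)%C _ _ _ (cdiff_pow n (circ (- t)))).
    assert (E := rdiff_comp _ (fun s => circ (- s)) t _ _ D (rdiff_circ_opp t)).
    replace (circ (- t) ^ S n)%C with
      (- / k * (RtoC (INR (S n)) * circ (- t) ^ n) * (- Ci * circ (- t)))%C.
    + exact E.
    + unfold k. rewrite Cpow_S. field. split; [exact Ci_nz|exact Hn].
Qed.

Lemma two_PI_pos : 0 < 2 * PI.
Proof. assert (H := PI_RGT_0). lra. Qed.

(** Cauchy's integral in the unknown [u], for [n = 0]: with [e = circ (- t)] the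
    inverse of the point of the circle, [1 / (1 - u e)] is the Cauchy kernel
    normalised to the unit circle.  Raising [n] removes Taylor coefficients. *)
Definition cauchy_int (F : R -> C) (n : nat) (u : C) : C :=
  CInt (fun t => F t * (circ (- t) ^ n / (1 - u * circ (- t))))%C 0 (2 * PI).

Lemma kernel_bound (u : C) (t : R) : Cmod u < 1 ->
  1 - Cmod u <= Cmod (1 - u * circ (- t))%C.
Proof.
  intros Hu. assert (K := Cmod_sub_ge 1 (u * circ (- t))%C).
  rewrite Cmod_mult, Cmod_circ, Cmod_1 in K. lra.
Qed.

Lemma kernel_neq_0 (u : C) (t : R) : Cmod u < 1 -> (1 - u * circ (- t))%C <> RtoC 0.
Proof. intros Hu. apply Cmod_gt_0. assert (K := kernel_bound u t Hu). lra. Qed.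

Lemma rcont_kernel (u : C) (t : R) : Cmod u < 1 ->
  rcont (fun s => / (1 - u * circ (- s)))%C t.
Proof.
  intros Hu. apply rcont_inv; [now apply kernel_neq_0|].
  apply rcont_minus; [apply rcont_const|].
  apply rcont_mult; [apply rcont_const|apply rcont_circ_opp].
Qed.

Lemma contI_cauchy (F : R -> C) (n : nat) (u : C) :
  contI F 0 (2 * PI) -> Cmod u < 1 ->
  contI (fun t => F t * (circ (- t) ^ n / (1 - u * circ (- t))))%C 0 (2 * PI).
Proof.
  intros HF Hu t Ht. apply rcont_mult; [now apply HF|].
  apply rcont_mult; [apply rcont_pow, rcont_circ_opp|now apply rcont_kernel].
Qed.

Lemma contI_circ_pow (F : R -> C) (n : nat) :
  contI F 0 (2 * PI) -> contI (fun t => F t * circ (- t) ^ n)%C 0 (2 * PI).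
Proof.
  intros HF t Ht. apply rcont_mult; [now apply HF|]. apply rcont_pow, rcont_circ_opp.
Qed.

Lemma cauchy_int_rec (F : R -> C) (n : nat) (u : C) :
  contI F 0 (2 * PI) -> Cmod u < 1 ->
  cauchy_int F n u =
  (CInt (fun t => F t * circ (- t) ^ n)%C 0 (2 * PI) + u * cauchy_int F (S n) u)%C.
Proof.
  intros HF Hu. unfold cauchy_int.
  rewrite <- CInt_scal by now apply contI_cauchy.
  rewrite <- CInt_plus.
  - apply CInt_ext. intros t _. rewrite Cpow_S. field. now apply kernel_neq_0.
  - now apply contI_circ_pow.
  - apply contI_scal. now apply contI_cauchy.
Qed.

Lemma cauchy_int_bound (F : R -> C) (n : nat) (u : C) (M : R) :
  contI F 0 (2 * PI) -> Cmod u < 1 -> (forall t, 0 <= t <= 2 * PI -> Cmod (F t) <= M) ->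
  Cmod (cauchy_int F n u) <= M / (1 - Cmod u) * (2 * PI).
Proof.
  intros HF Hu HM. unfold cauchy_int.
  assert (P := two_PI_pos).
  replace (M / (1 - Cmod u) * (2 * PI)) with (M / (1 - Cmod u) * (2 * PI - 0)) by ring.
  apply CInt_bound_le; [lra|now apply contI_cauchy|].
  intros t Ht. rewrite Cmod_mult, Cmod_div by now apply kernel_neq_0.
  rewrite Cmod_pow, Cmod_circ, pow1.
  apply Rmult_le_compat; try apply Cmod_ge_0; auto.
  - apply Rmult_le_pos; [lra|]. left. apply Rinv_0_lt_compat.
    apply Cmod_gt_0. now apply kernel_neq_0.
  - unfold Rdiv. rewrite Rmult_1_l. apply Rinv_le_contravar; [lra|].
    now apply kernel_bound.
Qed.

(** Iterating the recursion multiplies the integral by arbitrarily high powers of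
    [u], while the integrals that remain are bounded. *)
Lemma cauchy_int_zero (F : R -> C) (m : nat) (u : C) (M : R) :
  contI F 0 (2 * PI) -> Cmod u < 1 -> (forall t, 0 <= t <= 2 * PI -> Cmod (F t) <= M) ->
  (forall n, (m <= n)%nat -> CInt (fun t => F t * circ (- t) ^ n)%C 0 (2 * PI) = RtoC 0) ->
  cauchy_int F m u = RtoC 0.
Proof.
  intros HF Hu HM H0.
  assert (E : forall k, cauchy_int F m u = (u ^ k * cauchy_int F (m + k) u)%C).
  { induction k.
    - rewrite Nat.add_0_r. simpl. ring.
    - rewrite IHk, (cauchy_int_rec F (m + k)), H0 by (auto; lia).
      rewrite Cpow_S, Nat.add_succ_r. ring. }
  apply Cmod_eq_0. apply Rle_antisym; [|apply Cmod_ge_0].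
  apply Rnot_lt_le. intros L.
  set (B := M / (1 - Cmod u) * (2 * PI)).
  assert (HB : 0 <= B).
  { eapply Rle_trans; [|apply (cauchy_int_bound F 0 u M); auto]. apply Cmod_ge_0. }
  destruct (pow_lt_1_zero (Cmod u)) with (y := Cmod (cauchy_int F m u) / (B + 1)) as [k Hk].
  - now rewrite Rabs_pos_eq by apply Cmod_ge_0.
  - apply Rdiv_lt_0_compat; lra.
  - specialize (Hk k (Nat.le_refl k)). rewrite Rabs_pos_eq in Hk by (apply pow_le, Cmod_ge_0).
    assert (K : Cmod (cauchy_int F m u) <= Cmod u ^ k * B).
    { rewrite (E k), Cmod_mult, Cmod_pow. apply Rmult_le_compat_l; [apply pow_le, Cmod_ge_0|].
      now apply cauchy_int_bound. }
    apply Rmult_lt_compat_r with (r := B + 1) in Hk; [|lra].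
    unfold Rdiv in Hk. rewrite Rmult_assoc, Rinv_l, Rmult_1_r in Hk by lra.
    assert (0 <= Cmod u ^ k) by (apply pow_le, Cmod_ge_0). nra.
Qed.

Lemma cauchy_int_one (u : C) : Cmod u < 1 ->
  cauchy_int (fun _ => RtoC 1) 0 u = RtoC (2 * PI).
Proof.
  intros Hu. rewrite cauchy_int_rec; auto. 2:{ intros t _. apply rcont_const. }
  rewrite (cauchy_int_zero _ 1 u 1); auto.
  - rewrite (CInt_ext _ (fun _ => RtoC 1)).
    + rewrite CInt_const. replace (2 * PI - 0) with (2 * PI) by ring. ring.
    + intros t _. simpl. ring.
  - intros t _. apply rcont_const.
  - intros t _. rewrite Cmod_1. lra.
  - intros n Hn. destruct n; [lia|]. rewrite <- (CInt_circ_pow n).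
    apply CInt_ext. intros t _. ring.
Qed.

Definition circle (z0 : C) (p : R) (t : R) : C := (z0 + RtoC p * circ t)%C.

Lemma circle_inball (z0 : C) (p r : R) (t : R) : 0 <= p < r -> inball z0 r (circle z0 p t).
Proof.
  intros Hp. unfold inball, circle.
  replace (z0 + RtoC p * circ t - z0)%C with (RtoC p * circ t)%C by ring.
  rewrite Cmod_mult, Cmod_circ, Cmod_R, Rabs_pos_eq; lra.
Qed.

Lemma rdiff_circle (z0 : C) (p t : R) :
  rdiff (circle z0 p) t (RtoC p * (Ci * circ t))%C.
Proof.
  unfold circle.
  assert (H := cdev_plus (locally t) _ _ _ _ _ _ _ (cdev_const (locally t) _ z0)
    (cdev_scal (locally t) (RtoC p) _ _ _ _ (rdiff_circ t))).
  apply (cdev_eq _ _ _ _ _ _ _ eq_refl) with (2 := H). ring.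
Qed.

Lemma rcont_circle (f : C -> C) (z0 : C) (p r t : R) :
  0 <= p < r -> (forall z, inball z0 r z -> ccont f z) ->
  rcont (fun s => f (circle z0 p s)) t.
Proof.
  intros Hp Hf. apply rcont_comp; [apply Hf; now apply circle_inball|].
  exact (rdiff_rcont _ _ _ (rdiff_circle z0 p t)).
Qed.

Definition hol_ball (f : C -> C) (z0 : C) (r : R) : Prop :=
  forall z, inball z0 r z -> exists l, cdiff f z l.

Lemma hol_ball_cont (f : C -> C) (z0 : C) (r : R) :
  hol_ball f z0 r -> forall z, inball z0 r z -> ccont f z.
Proof. intros H z Hz. destruct (H z Hz) as [l Hl]. exact (cdiff_cont _ _ _ Hl). Qed.

Lemma inball_scaled (z0 u : C) (p : R) : 0 < p -> Cmod u < 1 -> inball z0 p (z0 + RtoC p * u)%C.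
Proof.
  intros Hp Hu. unfold inball. replace (z0 + RtoC p * u - z0)%C with (RtoC p * u)%C by ring.
  rewrite Cmod_mult, Cmod_R, Rabs_pos_eq by lra. nra.
Qed.

Lemma slope_exists (f : C -> C) (z0 a : C) (r : R) :
  hol_ball f z0 r -> inball z0 r a ->
  exists g, (forall w, (g w * (w - a) = f w - f a)%C) /\
    (forall z, inball z0 r z -> ccont g z) /\
    (forall z, inball z0 r z -> z <> a -> exists l, cdiff g z l).
Proof.
  intros Hf Ha. destruct (Hf a Ha) as [fa Hfa].
  set (g := fun w => if Ceq_dec w a then fa else ((f w - f a) / (w - a))%C).
  assert (gne : forall w, w <> a -> g w = ((f w - f a) / (w - a))%C).
  { intros w Hw. unfold g. destruct Ceq_dec; [contradiction|reflexivity]. }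
  assert (gmul : forall w, (g w * (w - a) = f w - f a)%C).
  { intros w. unfold g. destruct Ceq_dec as [->|Hw]; [ring|].
    field. now apply Cminus_eq_contra. }
  assert (gd : forall z, inball z0 r z -> z <> a -> exists l, cdiff g z l).
  { intros z Hz Hza. destruct (Hf z Hz) as [l Hl].
    eexists. apply cdiff_ext with (fun w => (f w - f a) / (w - a))%C.
    - exists (Cmod (z - a)). split; [now apply Cmod_pos_sub|]. intros w Hw.
      symmetry. apply gne. intros ->. rewrite Cmod_sub_sym in Hw. lra.
    - apply (cdiff_div (fun w => f w - f a)%C (fun w => w - a)%C).
      + now apply Cminus_eq_contra.
      + apply (cdiff_minus f (fun _ => f a)); [exact Hl|apply cdiff_const].
      + apply (cdiff_minus (fun w => w) (fun _ => a)); [apply cdiff_id|apply cdiff_const]. }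
  assert (gc : forall z, inball z0 r z -> ccont g z).
  { intros z Hz. destruct (Ceq_dec z a) as [->|Hza].
    - intros e He. replace (g a) with fa by (unfold g; destruct Ceq_dec; congruence).
      destruct (Hfa (e / 2) (half_pos He)) as [d [Hd K]]. exists d. split; [exact Hd|].
      intros w Hw. destruct (Ceq_dec w a) as [->|Hwa].
      + unfold g. destruct Ceq_dec; [|congruence]. now rewrite Cmod_sub_self.
      + rewrite gne by assumption. assert (Hw0 : (w - a)%C <> RtoC 0) by now apply Cminus_eq_contra.
        replace ((f w - f a) / (w - a) - fa)%C with ((f w - f a - fa * (w - a)) / (w - a))%C
          by (field; exact Hw0).
        rewrite Cmod_div by exact Hw0. assert (0 < Cmod (w - a)) by now apply Cmod_pos_sub.
        apply Rle_lt_trans with (e / 2); [|lra].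
        apply Rmult_le_reg_r with (Cmod (w - a)); [assumption|].
        unfold Rdiv at 1. rewrite Rmult_assoc, Rinv_l, Rmult_1_r by lra. now apply K.
    - destruct (gd z Hz Hza) as [l Hl]. exact (cdiff_cont _ _ _ Hl). }
  exists g. auto.
Qed.

(** The difference quotient [g] of [f] at the point [a] is continuous on the
    ball and differentiable off the vertical line through [a], so it has a
    primitive and its integral over the circle vanishes. *)
Theorem cauchy_formula (f : C -> C) (z0 : C) (p r : R) (u : C) :
  0 < p < r -> hol_ball f z0 r -> Cmod u < 1 ->
  cauchy_int (fun t => f (circle z0 p t)) 0 u =
  (RtoC (2 * PI) * f (z0 + RtoC p * u))%C.
Proof.
  intros Hp Hf Hu. set (a := (z0 + RtoC p * u)%C).
  assert (Ha : inball z0 r a).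
  { eapply Rlt_trans; [apply (inball_scaled z0 u p); [apply Hp|exact Hu]|apply Hp]. }
  destruct (slope_exists f z0 a r Hf Ha) as [g [gmul [gc gd]]].
  destruct (primitive_disc g z0 r (Re a) gc) as [P HP].
  { intros z Hz Hre. apply gd; [exact Hz|]. congruence. }
  assert (cg : contI (fun t => g (circle z0 p t)) 0 (2 * PI)).
  { intros t _. apply rcont_circle with r; [lra|exact gc]. }
  assert (cf : contI (fun t => f (circle z0 p t)) 0 (2 * PI)).
  { intros t _. apply rcont_circle with r; [lra|now apply hol_ball_cont]. }
  assert (cgc : contI (fun t => g (circle z0 p t) * (RtoC p * (Ci * circ t)))%C 0 (2 * PI)).
  { intros t Ht. apply rcont_mult; [now apply cg|].
    apply rcont_mult; [apply rcont_const|]. apply rcont_mult; [apply rcont_const|apply rcont_circ]. }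
  assert (I0 : CInt (fun t => g (circle z0 p t) * (RtoC p * (Ci * circ t)))%C 0 (2 * PI) = RtoC 0).
  { rewrite (CInt_FTC (fun t => P (circle z0 p t))); [|exact cgc|].
    - replace (circle z0 p (2 * PI)) with (circle z0 p 0); [ring|].
      unfold circle, circ. now rewrite cos_2PI, sin_2PI, cos_0, sin_0.
    - intros t _. apply rdiff_comp; [|apply rdiff_circle].
      apply HP. apply circle_inball. lra. }
  assert (E : CInt (fun t => g (circle z0 p t) * (RtoC p * (Ci * circ t)))%C 0 (2 * PI) =
    (Ci * (cauchy_int (fun t => f (circle z0 p t)) 0 u -
      f a * cauchy_int (fun _ => RtoC 1) 0 u))%C).
  { unfold cauchy_int.
    assert (c1 : contI (fun _ => RtoC 1) 0 (2 * PI)) by (intros t _; apply rcont_const).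
    rewrite <- CInt_scal by now apply contI_cauchy.
    rewrite <- CInt_minus; [| |apply contI_scal]; try now apply contI_cauchy.
    rewrite <- CInt_scal by (apply contI_minus; [|apply contI_scal]; now apply contI_cauchy).
    apply CInt_ext. intros t _.
    assert (Hk := kernel_neq_0 u t Hu). assert (Hc := circ_opp t).
    assert (Ew : (circle z0 p t - a = RtoC p * circ t * (1 - u * circ (- t)))%C).
    { unfold circle, a. replace (RtoC p * circ t * (1 - u * circ (- t)))%C with
        (RtoC p * circ t - RtoC p * u * (circ t * circ (- t)))%C by ring. rewrite Hc. ring. }
    assert (Hg := gmul (circle z0 p t)). rewrite Ew in Hg.
    apply (f_equal (fun x => x * (Ci * / (1 - u * circ (- t))))%C) in Hg.
    simpl Cpow.
    replace (g (circle z0 p t) * (RtoC p * (Ci * circ t)))%C with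
      (g (circle z0 p t) * (RtoC p * circ t * (1 - u * circ (- t))) *
       (Ci * / (1 - u * circ (- t))))%C by (field; exact Hk).
    rewrite Hg. field. exact Hk. }
  rewrite I0, cauchy_int_one in E by assumption.
  assert (E2 : (cauchy_int (fun t => f (circle z0 p t)) 0 u - f a * RtoC (2 * PI))%C = RtoC 0).
  { replace (cauchy_int (fun t => f (circle z0 p t)) 0 u - f a * RtoC (2 * PI))%C with
      (/ Ci * (Ci * (cauchy_int (fun t => f (circle z0 p t)) 0 u - f a * RtoC (2 * PI))))%C
      by (field; exact Ci_nz).
    rewrite <- E. ring. }
  apply Ceq_minus. rewrite <- E2. ring.
Qed.

(** * Consequences of Cauchy's formula *)

Lemma contI_bounded (F : R -> C) (a b : R) :
  a <= b -> contI F a b -> exists M, 0 <= M /\ forall t, a <= t <= b -> Cmod (F t) <= M.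
Proof.
  intros Hab HF.
  assert (E : forall g : R -> R, (forall t, a <= t <= b -> continuous g t) ->
    exists M, forall t, a <= t <= b -> Rabs (g t) <= M).
  { intros g Hg.
    assert (Cg : forall t, a <= t <= b -> continuity_pt g t).
    { intros t Ht. apply continuity_pt_filterlim. now apply Hg. }
    destruct (continuity_ab_maj g a b Hab Cg) as [x [Hx _]].
    destruct (continuity_ab_min g a b Hab Cg) as [y [Hy _]].
    exists (Rmax (Rabs (g x)) (Rabs (g y))). intros t Ht.
    specialize (Hx t Ht). specialize (Hy t Ht). apply Rabs_le.
    assert (A := Rle_abs (g x)). assert (B := Rle_abs (- g y)). rewrite Rabs_Ropp in B.
    assert (C := Rmax_l (Rabs (g x)) (Rabs (g y))).
    assert (D := Rmax_r (Rabs (g x)) (Rabs (g y))). lra. }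
  assert (HF' : forall t, a <= t <= b -> rcont F t).
  { intros t Ht. apply HF. now rewrite Rmin_left, Rmax_right by lra. }
  destruct (E (fun t => Re (F t))) as [M1 H1].
  { intros t Ht. apply rcont_Re. now apply HF'. }
  destruct (E (fun t => Im (F t))) as [M2 H2].
  { intros t Ht. apply rcont_Im. now apply HF'. }
  exists (M1 + M2). split.
  - specialize (H1 a ltac:(lra)). specialize (H2 a ltac:(lra)).
    assert (A := Rabs_pos (Re (F a))). assert (B := Rabs_pos (Im (F a))). lra.
  - intros t Ht. eapply Rle_trans; [apply Cmod_le_Re_Im|].
    specialize (H1 t Ht). specialize (H2 t Ht). lra.
Qed.

(** A remainder that is quadratic uniformly in [t] is what the kernels and, by
    Cauchy's estimates, families of holomorphic functions provide. *)
Lemma CInt_param_diff (k : C -> R -> C) (k' : R -> C) (a b : R) (u : C) (B d : R) :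
  a <= b -> 0 < d -> (forall v, Cmod (v - u) < d -> contI (k v) a b) -> contI k' a b ->
  (forall v t, Cmod (v - u) < d -> a <= t <= b ->
    Cmod (k v t - k u t - k' t * (v - u)) <= B * Cmod (v - u) ^ 2) ->
  cdiff (fun v => CInt (k v) a b) u (CInt k' a b).
Proof.
  intros Hab Hd Hk Hk' HB e He.
  set (B' := Rmax B 0 * (b - a) + 1).
  assert (HB0 : 0 <= Rmax B 0) by apply Rmax_r.
  assert (HB1 : B <= Rmax B 0) by apply Rmax_l.
  assert (HB' : 1 <= B') by (unfold B'; assert (0 <= Rmax B 0 * (b - a)) by
    (apply Rmult_le_pos; lra); lra).
  assert (He' : 0 < e / B') by (apply Rdiv_lt_0_compat; lra).
  exists (Rmin d (e / B')). split; [now apply Rmin_pos|]. intros v Hv.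
  assert (Hv1 : Cmod (v - u) < d) by (eapply Rlt_le_trans; [exact Hv|apply Rmin_l]).
  assert (Hv2 : Cmod (v - u) < e / B') by (eapply Rlt_le_trans; [exact Hv|apply Rmin_r]).
  assert (Hu : contI (k u) a b) by (apply Hk; now rewrite Cmod_sub_self).
  rewrite Cmult_comm, <- CInt_scal by assumption.
  rewrite <- CInt_minus by auto.
  rewrite <- CInt_minus by (try apply contI_minus; try apply contI_scal; auto).
  eapply Rle_trans.
  - apply (CInt_bound_le _ a b (Rmax B 0 * Cmod (v - u) ^ 2)); [assumption| |].
    + apply contI_minus; [apply contI_minus|apply contI_scal]; auto.
    + intros t Ht. rewrite (Cmult_comm (v - u)). eapply Rle_trans; [now apply HB|].
      apply Rmult_le_compat_r; [apply pow2_ge_0|exact HB1].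
  - assert (P := Cmod_ge_0 (v - u)).
    apply Rle_trans with (B' * Cmod (v - u) ^ 2).
    + unfold B'. assert (0 <= Cmod (v - u) ^ 2) by apply pow2_ge_0. nra.
    + replace (B' * Cmod (v - u) ^ 2) with (B' * Cmod (v - u) * Cmod (v - u)) by ring.
      apply Rmult_le_compat_r; [exact P|].
      replace e with (B' * (e / B')) by (field; lra).
      apply Rmult_le_compat_l; lra.
Qed.

Definition kernel1 (F : R -> C) (u : C) (t : R) : C :=
  (F t * (circ (- t) / ((1 - u * circ (- t)) * (1 - u * circ (- t)))))%C.

Definition kernel2 (F : R -> C) (u : C) (t : R) : C :=
  (F t * (2 * (circ (- t) * circ (- t)) /
    ((1 - u * circ (- t)) * (1 - u * circ (- t)) * (1 - u * circ (- t)))))%C.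

Lemma contI_kernel1 (F : R -> C) (u : C) :
  contI F 0 (2 * PI) -> Cmod u < 1 -> contI (kernel1 F u) 0 (2 * PI).
Proof.
  intros HF Hu t Ht. apply (rcont_mult F); [now apply HF|].
  assert (K := rcont_kernel u t Hu).
  assert (A : rcont (fun s => (1 - u * circ (- s)))%C t).
  { apply rcont_minus; [apply rcont_const|].
    apply rcont_mult; [apply rcont_const|apply rcont_circ_opp]. }
  apply (rcont_mult (fun s => circ (- s))); [apply rcont_circ_opp|].
  apply (rcont_inv (fun s => (1 - u * circ (- s)) * (1 - u * circ (- s))))%C.
  - apply Cmult_neq_0; now apply kernel_neq_0.
  - now apply rcont_mult.
Qed.

Lemma contI_kernel2 (F : R -> C) (u : C) :
  contI F 0 (2 * PI) -> Cmod u < 1 -> contI (kernel2 F u) 0 (2 * PI).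
Proof.
  intros HF Hu t Ht. apply (rcont_mult F); [now apply HF|].
  assert (A : rcont (fun s => (1 - u * circ (- s)))%C t).
  { apply rcont_minus; [apply rcont_const|].
    apply rcont_mult; [apply rcont_const|apply rcont_circ_opp]. }
  apply (rcont_mult (fun s => 2 * (circ (- s) * circ (- s))))%C.
  - apply rcont_mult; [apply rcont_const|]. apply rcont_mult; apply rcont_circ_opp.
  - apply (rcont_inv (fun s => (1 - u * circ (- s)) * (1 - u * circ (- s)) *
      (1 - u * circ (- s))))%C.
    + repeat apply Cmult_neq_0; now apply kernel_neq_0.
    + apply rcont_mult; [now apply rcont_mult|exact A].
Qed.

Lemma Cmod_div_le (a b : C) (x m : R) :
  Cmod a <= x -> 0 < m -> m <= Cmod b -> Cmod (a / b) <= x / m.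
Proof.
  intros Ha Hm Hb. assert (b <> RtoC 0) by (apply Cmod_gt_0; lra).
  rewrite Cmod_div by assumption. unfold Rdiv.
  apply Rmult_le_compat; try apply Cmod_ge_0; auto.
  - left. apply Rinv_0_lt_compat. lra.
  - now apply Rinv_le_contravar.
Qed.

Lemma cauchy_int_diff (F : R -> C) (u : C) :
  contI F 0 (2 * PI) -> Cmod u < 1 ->
  cdiff (cauchy_int F 0) u (CInt (kernel1 F u) 0 (2 * PI)) /\
  cdiff (fun v => CInt (kernel1 F v) 0 (2 * PI)) u (CInt (kernel2 F u) 0 (2 * PI)).
Proof.
  intros HF Hu. assert (PP := two_PI_pos).
  destruct (contI_bounded F 0 (2 * PI) ltac:(lra) HF) as [M [HM0 HM]].
  set (m := 1 - Cmod u). assert (Hm : 0 < m) by (unfold m; lra).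
  assert (Hm2 : 0 < m / 2) by lra.
  assert (Pu := Cmod_ge_0 u).
  assert (small : forall v, Cmod (v - u) < m / 2 -> Cmod v < 1).
  { intros v Hv. assert (K := Cmod_sub_ge v u). unfold m in *. lra. }
  assert (low : forall v t, Cmod (v - u) < m / 2 -> m / 2 <= Cmod (1 - v * circ (- t))%C).
  { intros v t Hv. eapply Rle_trans; [|apply kernel_bound; now apply small].
    assert (K := Cmod_sub_ge v u). unfold m in *. lra. }
  assert (lowu : forall t, m <= Cmod (1 - u * circ (- t))%C)
    by (intros t; now apply kernel_bound).
  split.
  - apply (CInt_param_diff (fun v t => F t * (circ (- t) ^ 0 / (1 - v * circ (- t))))%C
      (kernel1 F u) 0 (2 * PI) u (M / (m * m * (m / 2))) (m / 2)); try lra.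
    + intros v Hv. apply contI_cauchy; auto.
    + now apply contI_kernel1.
    + intros v t Hv Ht. unfold kernel1. simpl Cpow.
      assert (N1 := kernel_neq_0 u t Hu). assert (N2 := kernel_neq_0 v t (small v Hv)).
      set (e := circ (- t)) in *.
      replace (F t * (1 / (1 - v * e)) - F t * (1 / (1 - u * e)) -
        F t * (e / ((1 - u * e) * (1 - u * e))) * (v - u))%C with
        ((F t * ((v - u) * (v - u) * (e * e))) /
         ((1 - u * e) * (1 - u * e) * (1 - v * e)))%C by (field; split; assumption).
      replace (M / (m * m * (m / 2)) * Cmod (v - u) ^ 2) with
        ((M * Cmod (v - u) ^ 2) / (m * m * (m / 2))) by (field; lra).
      apply Cmod_div_le.
      * unfold e. rewrite !Cmod_mult, !Cmod_circ. specialize (HM t Ht).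
        assert (0 <= Cmod (v - u) ^ 2) by apply pow2_ge_0. nra.
      * repeat apply Rmult_lt_0_compat; lra.
      * rewrite !Cmod_mult. apply Rmult_le_compat; try lra; try apply lowu.
        -- apply Rmult_le_pos; lra.
        -- apply Rmult_le_compat; try lra; apply lowu.
        -- now apply low.
  - apply (CInt_param_diff (kernel1 F) (kernel2 F u) 0 (2 * PI) u
      (M * 8 / (m * m * m * (m / 2 * (m / 2)))) (m / 2)); try lra.
    + intros v Hv. apply contI_kernel1; auto.
    + now apply contI_kernel2.
    + intros v t Hv Ht. unfold kernel1, kernel2.
      assert (N1 := kernel_neq_0 u t Hu). assert (N2 := kernel_neq_0 v t (small v Hv)).
      assert (L1 := lowu t). assert (L2 := low v t Hv).
      assert (He : Cmod (circ (- t)) = 1) by apply Cmod_circ.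
      set (e := circ (- t)) in *.
      replace (F t * (e / ((1 - v * e) * (1 - v * e))) -
        F t * (e / ((1 - u * e) * (1 - u * e))) -
        F t * (2 * (e * e) / ((1 - u * e) * (1 - u * e) * (1 - u * e))) * (v - u))%C with
        ((F t * ((v - u) * (v - u) * (e * e * e) * (3 * (1 - u * e) - 2 * (v - u) * e))) /
         ((1 - u * e) * (1 - u * e) * (1 - u * e) * ((1 - v * e) * (1 - v * e))))%C
        by (field; split; assumption).
      replace (M * 8 / (m * m * m * (m / 2 * (m / 2))) * Cmod (v - u) ^ 2) with
        ((M * (Cmod (v - u) ^ 2 * 8)) / (m * m * m * (m / 2 * (m / 2)))) by (field; lra).
      apply Cmod_div_le.
      * rewrite !Cmod_mult, !He. specialize (HM t Ht).
        assert (P2 : 0 <= Cmod (v - u) ^ 2) by apply pow2_ge_0.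
        assert (T : Cmod (3 * (1 - u * e) - 2 * (v - u) * e)%C <= 8).
        { eapply Rle_trans; [apply Cmod_sub_le|]. rewrite !Cmod_mult, He, !Cmod_R.
          assert (T := Cmod_sub_le 1 (u * e)%C). rewrite Cmod_mult, He, Cmod_1 in T.
          rewrite !Rabs_pos_eq by lra. unfold m in *. lra. }
        apply Rmult_le_compat; try apply Cmod_ge_0; auto.
        -- repeat apply Rmult_le_pos; try apply Cmod_ge_0; lra.
        -- apply Rmult_le_compat; try apply Cmod_ge_0; auto.
           ++ repeat apply Rmult_le_pos; try apply Cmod_ge_0; lra.
           ++ right. ring.
      * repeat apply Rmult_lt_0_compat; lra.
      * rewrite !Cmod_mult. assert (0 <= m / 2 * (m / 2)) by (apply Rmult_le_pos; lra).
        assert (0 <= m * m) by (apply Rmult_le_pos; lra).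
        apply Rmult_le_compat; auto.
        -- apply Rmult_le_pos; lra.
        -- apply Rmult_le_compat; try lra. apply Rmult_le_compat; lra.
        -- apply Rmult_le_compat; lra.
Qed.

Lemma circle_contI (f : C -> C) (z0 : C) (p r : R) :
  0 < p < r -> hol_ball f z0 r -> contI (fun t => f (circle z0 p t)) 0 (2 * PI).
Proof. intros Hp Hf t _. apply rcont_circle with r; [lra|now apply hol_ball_cont]. Qed.

Lemma RtoC_neq_0 (x : R) : x <> 0 -> RtoC x <> RtoC 0.
Proof. intros H E. apply H. now apply RtoC_inj. Qed.

Lemma inball_unscale (z0 z : C) (p : R) : 0 < p -> inball z0 p z ->
  Cmod ((z - z0) / RtoC p) < 1 /\ z = (z0 + RtoC p * ((z - z0) / RtoC p))%C.
Proof.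
  intros Hp Hz. assert (N : RtoC p <> RtoC 0) by (apply RtoC_neq_0; lra). split.
  - rewrite Cmod_div, Cmod_R, Rabs_pos_eq by (auto; lra).
    apply Rmult_lt_reg_r with p; [lra|]. unfold Rdiv.
    rewrite Rmult_assoc, Rinv_l, Rmult_1_l, Rmult_1_r by lra. exact Hz.
  - field. exact N.
Qed.

Lemma derive_formula (f : C -> C) (z0 : C) (p r : R) (z : C) :
  0 < p < r -> hol_ball f z0 r -> inball z0 p z ->
  cdiff f z (/ RtoC (2 * PI) *
    (CInt (kernel1 (fun t => f (circle z0 p t)) ((z - z0) / RtoC p)) 0 (2 * PI) / RtoC p))%C.
Proof.
  intros Hp Hf Hz. assert (PP := two_PI_pos).
  assert (N : RtoC p <> RtoC 0) by (apply RtoC_neq_0; lra).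
  assert (N2 : RtoC (2 * PI) <> RtoC 0) by (apply RtoC_neq_0; lra).
  apply cdiff_ext with (fun w => / RtoC (2 * PI) *
    cauchy_int (fun t => f (circle z0 p t)) 0 ((w - z0) / RtoC p))%C.
  - generalize (inball_open _ _ _ Hz). apply filter_imp. intros w Hw.
    destruct (inball_unscale z0 w p ltac:(lra) Hw) as [Hu E].
    rewrite (cauchy_formula f z0 p r), <- E by assumption. field. exact N2.
  - apply (cdiff_scal _ (fun w => cauchy_int (fun t => f (circle z0 p t)) 0
      ((w - z0) / RtoC p)%C)).
    destruct (inball_unscale z0 z p ltac:(lra) Hz) as [Hu E].
    destruct (cauchy_int_diff (fun t => f (circle z0 p t)) _
      (circle_contI f z0 p r Hp Hf) Hu) as [D _].
    unfold Cdiv at 2.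
    apply (cdiff_comp (cauchy_int (fun t => f (circle z0 p t)) 0)
      (fun w => (w - z0) / RtoC p)%C); [exact D|].
    apply cdiff_ext with (fun w => / RtoC p * (w - z0))%C.
    + apply filter_forall. intros w. unfold Cdiv. ring.
    + apply cdiff_eq with (/ RtoC p * (RtoC 1 - RtoC 0))%C; [ring|].
      apply (cdiff_scal _ (fun w => w - z0)%C).
      apply (cdiff_minus (fun w => w) (fun _ => z0)); [apply cdiff_id|apply cdiff_const].
Qed.

(** The derivative is again an integral against a kernel that can be
    differentiated under the integral sign. *)
Theorem hol_ball_derive (f : C -> C) (z0 : C) (r : R) :
  hol_ball f z0 r -> hol_ball (C_derive f) z0 r.
Proof.
  intros Hf a Ha. unfold inball in Ha. assert (Pa := Cmod_ge_0 (a - z0)).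
  set (p := (Cmod (a - z0) + r) / 2).
  assert (Hp : 0 < p < r) by (unfold p; lra).
  assert (Hap : inball z0 p a) by (unfold inball, p; lra).
  destruct (inball_unscale z0 a p ltac:(lra) Hap) as [Hu E].
  destruct (cauchy_int_diff (fun t => f (circle z0 p t)) _
      (circle_contI f z0 p r Hp Hf) Hu) as [_ D].
  eexists. apply cdiff_ext with (fun z => / RtoC (2 * PI) * (/ RtoC p *
    CInt (kernel1 (fun t => f (circle z0 p t)) ((z - z0) / RtoC p)) 0 (2 * PI)))%C.
  - generalize (inball_open _ _ _ Hap). apply filter_imp. intros z Hz.
    rewrite (cdiff_C_derive _ _ _ (derive_formula f z0 p r z Hp Hf Hz)).
    unfold Cdiv. ring.
  - apply cdiff_scal, cdiff_scal.
    apply (cdiff_comp (fun v => CInt (kernel1 (fun t => f (circle z0 p t)) v) 0 (2 * PI))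
      (fun z => (z - z0) / RtoC p)%C); [exact D|].
    apply cdiff_ext with (fun w => / RtoC p * (w - z0))%C.
    + apply filter_forall. intros w. unfold Cdiv. ring.
    + apply (cdiff_scal _ (fun w => w - z0)%C).
      apply (cdiff_minus (fun w => w) (fun _ => z0)); [apply cdiff_id|apply cdiff_const].
Qed.

Lemma hol_ball_C_derive (f : C -> C) (z0 : C) (r : R) (z : C) :
  hol_ball f z0 r -> inball z0 r z -> cdiff f z (C_derive f z).
Proof.
  intros Hf Hz. destruct (Hf z Hz) as [l Hl]. now rewrite (cdiff_C_derive _ _ _ Hl).
Qed.

Lemma inball_center (z0 : C) (r : R) : 0 < r -> inball z0 r z0.
Proof. intros H. unfold inball. now rewrite Cmod_sub_self. Qed.

Lemma Rle_div_limit (x M r : R) :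
  0 < r -> (forall p, 0 < p < r -> x <= M / p) -> 0 <= M -> x <= M / r.
Proof.
  intros Hr H HM. apply Rnot_lt_le. intros L.
  assert (HMr : 0 <= M / r) by (apply Rmult_le_pos; [lra|left; now apply Rinv_0_lt_compat]).
  assert (Hx : M < x * r).
  { apply Rmult_lt_compat_r with (r := r) in L; [|lra].
    unfold Rdiv in L. rewrite Rmult_assoc, Rinv_l, Rmult_1_r in L by lra. exact L. }
  set (p := Rmax (r / 2) ((M / x + r) / 2)).
  assert (Hxr : M / x < r).
  { apply Rmult_lt_reg_r with x; [lra|]. unfold Rdiv.
    rewrite Rmult_assoc, Rinv_l by lra. lra. }
  assert (Hp : 0 < p < r) by (unfold p, Rmax; destruct Rle_dec; lra).
  assert (Hp2 : (M / x + r) / 2 <= p) by apply Rmax_r.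
  specialize (H p Hp). apply Rmult_le_compat_r with (r := p) in H; [|lra].
  unfold Rdiv in H. rewrite Rmult_assoc, Rinv_l, Rmult_1_r in H by lra.
  assert (x * ((M / x + r) / 2) <= x * p) by (apply Rmult_le_compat_l; lra).
  replace (x * ((M / x + r) / 2)) with ((M + x * r) / 2) in * by (field; lra). lra.
Qed.

Theorem cauchy_estimate (f : C -> C) (z0 : C) (r M : R) :
  0 < r -> hol_ball f z0 r -> (forall z, inball z0 r z -> Cmod (f z) <= M) ->
  Cmod (C_derive f z0) <= M / r.
Proof.
  intros Hr Hf HM. assert (PP := two_PI_pos).
  assert (HM0 : 0 <= M) by
    (eapply Rle_trans; [apply Cmod_ge_0|apply (HM z0); now apply inball_center]).
  apply Rle_div_limit; auto. intros p Hp.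
  assert (Np : RtoC p <> RtoC 0) by (apply RtoC_neq_0; lra).
  assert (N2 : RtoC (2 * PI) <> RtoC 0) by (apply RtoC_neq_0; lra).
  rewrite (cdiff_C_derive _ _ _ (derive_formula f z0 p r z0 Hp Hf (inball_center _ _ (proj1 Hp)))).
  replace ((z0 - z0) / RtoC p)%C with (RtoC 0) by (field; exact Np).
  rewrite Cmod_mult, Cmod_inv, Cmod_div by assumption. rewrite !Cmod_R, !Rabs_pos_eq by lra.
  assert (K : Cmod (CInt (kernel1 (fun t => f (circle z0 p t)) 0) 0 (2 * PI)) <= M * (2 * PI - 0)).
  { apply CInt_bound_le; [lra| |].
    - apply contI_kernel1; [now apply circle_contI with r|]. rewrite Cmod_0. lra.
    - intros t _. unfold kernel1.
      replace (f (circle z0 p t) * (circ (- t) / ((1 - 0 * circ (- t)) * (1 - 0 * circ (- t)))))%C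
        with (f (circle z0 p t) * circ (- t))%C by field.
      rewrite Cmod_mult, Cmod_circ, Rmult_1_r. apply HM. apply circle_inball. lra. }
  set (X := Cmod (CInt _ 0 (2 * PI))) in *.
  replace (M / p) with (/ (2 * PI) * (M * (2 * PI - 0) / p)) by (field; lra).
  apply Rmult_le_compat_l; [left; apply Rinv_0_lt_compat; lra|].
  apply Rmult_le_compat_r; [left; apply Rinv_0_lt_compat; lra|exact K].
Qed.

(** The remainder is [u ^ 2] times a Cauchy-type integral, by two steps of the
    recursion on the kernels. *)
Theorem taylor2_estimate (f : C -> C) (z0 w : C) (r M : R) :
  0 < r -> hol_ball f z0 r -> (forall z, inball z0 r z -> Cmod (f z) <= M) ->
  Cmod (w - z0) <= r / 4 ->
  Cmod (f w - f z0 - C_derive f z0 * (w - z0)) <= 8 * M / r ^ 2 * Cmod (w - z0) ^ 2.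
Proof.
  intros Hr Hf HM Hw. assert (PP := two_PI_pos).
  set (p := r / 2). assert (Hp : 0 < p < r) by (unfold p; lra).
  assert (Np : RtoC p <> RtoC 0) by (apply RtoC_neq_0; lra).
  assert (N2 : RtoC (2 * PI) <> RtoC 0) by (apply RtoC_neq_0; lra).
  assert (Hwb : inball z0 p w) by (unfold inball, p; lra).
  destruct (inball_unscale z0 w p ltac:(lra) Hwb) as [Hu E].
  set (u := ((w - z0) / RtoC p)%C) in *. set (F := fun t => f (circle z0 p t)).
  assert (HF : contI F 0 (2 * PI)) by now apply circle_contI with r.
  assert (C0 : Cmod 0 < 1) by (rewrite Cmod_0; lra).
  assert (Fw := cauchy_formula f z0 p r u Hp Hf Hu).
  assert (F0 := cauchy_formula f z0 p r (RtoC 0) Hp Hf C0).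
  fold F in Fw, F0. rewrite <- E in Fw.
  replace (z0 + RtoC p * 0)%C with z0 in F0 by ring.
  rewrite (cauchy_int_rec F 0 u), (cauchy_int_rec F 1 u) in Fw by assumption.
  rewrite (cauchy_int_rec F 0 (RtoC 0)) in F0 by assumption.
  assert (F1 := cdiff_C_derive _ _ _ (derive_formula f z0 p r z0 Hp Hf (inball_center _ _ (proj1 Hp)))).
  replace ((z0 - z0) / RtoC p)%C with (RtoC 0) in F1 by (field; exact Np). fold F in F1.
  rewrite (CInt_ext (kernel1 F 0) (fun t => F t * circ (- t) ^ 1)%C) in F1.
  2:{ intros t _. unfold kernel1. rewrite Cpow_1_r. field. }
  assert (Eq : (f w - f z0 - C_derive f z0 * (w - z0))%C =
    (/ RtoC (2 * PI) * (u * u * cauchy_int F 2 u))%C).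
  { rewrite F1.
    replace (f w) with (/ RtoC (2 * PI) * (RtoC (2 * PI) * f w))%C by (field; exact N2).
    replace (f z0) with (/ RtoC (2 * PI) * (RtoC (2 * PI) * f z0))%C by (field; exact N2).
    rewrite <- Fw, <- F0. unfold u. field. split; assumption. }
  rewrite Eq, !Cmod_mult, Cmod_inv, Cmod_R, Rabs_pos_eq by (assumption || lra).
  assert (HM0 : 0 <= M) by
    (eapply Rle_trans; [apply Cmod_ge_0|apply (HM z0); now apply inball_center]).
  assert (Hu2 : Cmod u = Cmod (w - z0) * (2 / r)).
  { unfold u. rewrite Cmod_div, Cmod_R, Rabs_pos_eq by (assumption || lra).
    unfold p. field. lra. }
  assert (Hu3 : Cmod u <= 1 / 2).
  { rewrite Hu2. replace (1 / 2) with (r / 4 * (2 / r)) by (field; lra).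
    apply Rmult_le_compat_r; [|exact Hw].
    apply Rmult_le_pos; [lra|left; now apply Rinv_0_lt_compat]. }
  assert (B : Cmod (cauchy_int F 2 u) <= 2 * M * (2 * PI)).
  { eapply Rle_trans; [apply (cauchy_int_bound F 2 u M HF Hu)|].
    - intros t _. apply HM. apply circle_inball. lra.
    - apply Rmult_le_compat_r; [lra|]. unfold Rdiv. rewrite (Rmult_comm 2).
      apply Rmult_le_compat_l; [exact HM0|].
      replace 2 with (/ (1 / 2)) by field. apply Rinv_le_contravar; lra. }
  apply Rle_trans with (/ (2 * PI) * (Cmod u * Cmod u * (2 * M * (2 * PI)))).
  - apply Rmult_le_compat_l; [left; apply Rinv_0_lt_compat; lra|].
    apply Rmult_le_compat_l; [|exact B]. apply Rmult_le_pos; apply Cmod_ge_0.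
  - right. rewrite Hu2. field. split; [lra|]. assert (H := PI_RGT_0). lra.
Qed.

(** Morera's argument: a primitive of [f] exists and is holomorphic, hence so is
    its derivative [f]. *)
Theorem painleve (f : C -> C) (z0 : C) (r x0 : R) :
  (forall z, inball z0 r z -> ccont f z) ->
  (forall z, inball z0 r z -> Re z <> x0 -> exists l, cdiff f z l) -> hol_ball f z0 r.
Proof.
  intros Hf Hd. destruct (primitive_disc f z0 r x0 Hf Hd) as [P HP].
  assert (HPb : hol_ball P z0 r) by (intros z Hz; exists (f z); now apply HP).
  intros z Hz. destruct (hol_ball_derive P z0 r HPb z Hz) as [l Hl]. exists l.
  apply (cdiff_ext (C_derive P)); [|exact Hl].
  generalize (inball_open _ _ _ Hz). apply filter_imp. intros w Hw.
  apply cdiff_C_derive. now apply HP.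
Qed.

Lemma Rle_0_small (x B d : R) :
  0 < d -> (forall e, 0 < e < d -> exists y, 0 <= y < e /\ x <= y * B) -> x <= 0.
Proof.
  intros Hd H. apply Rnot_lt_le. intros L.
  set (B' := Rmax B 1). assert (HB : 1 <= B') by apply Rmax_r.
  assert (HB2 : B <= B') by apply Rmax_l.
  assert (0 < x / B') by (apply Rdiv_lt_0_compat; lra).
  destruct (H (Rmin (d / 2) (x / B'))) as [y [[Hy1 Hy2] Hy3]].
  { split; [apply Rmin_pos; lra|]. assert (K := Rmin_l (d / 2) (x / B')). lra. }
  assert (K := Rmin_r (d / 2) (x / B')).
  assert (y * B <= y * B') by (apply Rmult_le_compat_l; lra).
  assert (y * B' < x / B' * B') by (apply Rmult_lt_compat_r; lra).
  replace (x / B' * B') with x in * by (field; lra). lra.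
Qed.

(** Writing [I n u] for the Cauchy integral with kernel [e^n / (1 - u e)], one has
    [I n u = c n + u * I (n+1) u].  Along the zeros of [f] accumulating at the
    centre all [c n] vanish one after the other, so that [I 0] vanishes
    identically. *)
Theorem identity_theorem (f : C -> C) (z0 : C) (r : R) :
  hol_ball f z0 r ->
  (forall d, 0 < d -> exists w, w <> z0 /\ Cmod (w - z0) < d /\ f w = RtoC 0) ->
  forall z, inball z0 r z -> f z = RtoC 0.
Proof.
  intros Hf Hz z Hzr. assert (PP := two_PI_pos). unfold inball in Hzr.
  assert (Pa := Cmod_ge_0 (z - z0)).
  set (p := (Cmod (z - z0) + r) / 2). assert (Hp : 0 < p < r) by (unfold p; lra).
  assert (Np : RtoC p <> RtoC 0) by (apply RtoC_neq_0; lra).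
  assert (N2 : RtoC (2 * PI) <> RtoC 0) by (apply RtoC_neq_0; lra).
  set (F := fun t => f (circle z0 p t)).
  assert (HF : contI F 0 (2 * PI)) by now apply circle_contI with r.
  destruct (contI_bounded F 0 (2 * PI) ltac:(lra) HF) as [M [HM0 HM]].
  assert (Zero : forall n w, w <> z0 -> Cmod (w - z0) < p / 2 -> f w = RtoC 0 ->
    cauchy_int F n ((w - z0) / RtoC p)%C = RtoC 0).
  { induction n.
    - intros w _ Hw Ew. assert (Hwb : inball z0 p w) by (unfold inball; lra).
      destruct (inball_unscale z0 w p ltac:(lra) Hwb) as [Hu E].
      unfold F. rewrite (cauchy_formula f z0 p r), <- E, Ew by assumption. ring.
    - assert (cn : CInt (fun t => F t * circ (- t) ^ n)%C 0 (2 * PI) = RtoC 0).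
      { apply Cmod_eq_0. apply Rle_antisym; [|apply Cmod_ge_0].
        apply (Rle_0_small _ (/ p * (M / (1 / 2) * (2 * PI))) (p / 2)); [lra|].
        intros e He. destruct (Hz e ltac:(lra)) as [w [W1 [W2 W3]]].
        exists (Cmod (w - z0)). split; [split; [apply Cmod_ge_0|exact W2]|].
        specialize (IHn w W1 ltac:(lra) W3).
        assert (Hwb : inball z0 p w) by (unfold inball; lra).
        destruct (inball_unscale z0 w p ltac:(lra) Hwb) as [Hu E].
        rewrite cauchy_int_rec in IHn by assumption.
        set (u := ((w - z0) / RtoC p)%C) in *.
        assert (Eu : Cmod u = Cmod (w - z0) * / p).
        { unfold u. rewrite Cmod_div, Cmod_R, Rabs_pos_eq by (assumption || lra). reflexivity. }
        assert (Hu2 : Cmod u <= 1 / 2).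
        { rewrite Eu. apply Rmult_le_reg_r with p; [lra|].
          rewrite Rmult_assoc, Rinv_l by lra. lra. }
        replace (CInt (fun t => F t * circ (- t) ^ n)%C 0 (2 * PI)) with
          (- (u * cauchy_int F (S n) u))%C.
        2:{ apply Ceq_minus. rewrite <- (Cmult_0_r (RtoC (-1))). rewrite <- IHn at 1. ring. }
        rewrite Cmod_opp, Cmod_mult, Eu, Rmult_assoc.
        apply Rmult_le_compat_l; [apply Cmod_ge_0|].
        apply Rmult_le_compat_l; [left; apply Rinv_0_lt_compat; lra|].
        eapply Rle_trans; [apply (cauchy_int_bound F (S n) u M); assumption|].
        apply Rmult_le_compat_r; [lra|]. apply Rmult_le_compat_l; [lra|].
        apply Rinv_le_contravar; lra. }
      intros w W1 W2 W3. specialize (IHn w W1 W2 W3).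
      assert (Hwb : inball z0 p w) by (unfold inball; lra).
      destruct (inball_unscale z0 w p ltac:(lra) Hwb) as [Hu E].
      rewrite cauchy_int_rec, cn in IHn by assumption.
      set (u := ((w - z0) / RtoC p)%C) in *.
      assert (Nu : u <> RtoC 0).
      { intros H. apply W1. rewrite E, H. ring. }
      replace (cauchy_int F (S n) u) with (/ u * (0 + u * cauchy_int F (S n) u))%C
        by (field; exact Nu).
      rewrite IHn. ring. }
  assert (cn : forall n, CInt (fun t => F t * circ (- t) ^ n)%C 0 (2 * PI) = RtoC 0).
  { intros n. destruct (Hz (p / 2) ltac:(lra)) as [w [W1 [W2 W3]]].
    assert (H1 := Zero n w W1 W2 W3). assert (H2 := Zero (S n) w W1 W2 W3).
    assert (Hwb : inball z0 p w) by (unfold inball; lra).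
    destruct (inball_unscale z0 w p ltac:(lra) Hwb) as [Hu E].
    rewrite cauchy_int_rec, H2 in H1 by assumption. rewrite <- H1. ring. }
  assert (Hzb : inball z0 p z) by (unfold inball, p; lra).
  destruct (inball_unscale z0 z p ltac:(lra) Hzb) as [Hu E].
  assert (K := cauchy_formula f z0 p r _ Hp Hf Hu). fold F in K. rewrite <- E in K.
  rewrite (cauchy_int_zero F 0 _ M) in K by auto.
  replace (f z) with (/ RtoC (2 * PI) * (RtoC (2 * PI) * f z))%C by (field; exact N2).
  rewrite <- K. ring.
Qed.

Lemma geometric_le (x M A : R) : 0 <= x -> 0 <= M ->
  (forall n, x ^ S n <= A * M ^ S n) -> x <= M.
Proof.
  intros Hx HM H. apply Rnot_lt_le. intros L.
  assert (Hx0 : 0 < x) by lra.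
  destruct (pow_lt_1_zero (M / x)) with (y := / (Rmax A 1)) as [n Hn].
  - rewrite Rabs_pos_eq.
    + apply Rmult_lt_reg_r with x; [lra|]. unfold Rdiv. rewrite Rmult_assoc, Rinv_l by lra. lra.
    + apply Rmult_le_pos; [lra|left; now apply Rinv_0_lt_compat].
  - apply Rinv_0_lt_compat. assert (K := Rmax_r A 1). lra.
  - specialize (Hn (S n) ltac:(lia)). specialize (H n).
    assert (K := Rmax_r A 1). assert (K2 := Rmax_l A 1).
    assert (P : 0 < x ^ S n) by now apply pow_lt.
    assert (Q : 0 <= M ^ S n) by now apply pow_le.
    unfold Rdiv in Hn. rewrite Rpow_mult_distr, pow_inv in Hn.
    rewrite Rabs_pos_eq in Hn.
    2:{ apply Rmult_le_pos; [exact Q|left; now apply Rinv_0_lt_compat]. }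
    apply Rmult_lt_compat_r with (r := x ^ S n * Rmax A 1) in Hn.
    2:{ apply Rmult_lt_0_compat; lra. }
    replace (M ^ S n * / x ^ S n * (x ^ S n * Rmax A 1)) with (Rmax A 1 * M ^ S n) in Hn
      by (field; lra).
    replace (/ Rmax A 1 * (x ^ S n * Rmax A 1)) with (x ^ S n) in Hn by (field; lra).
    assert (A * M ^ S n <= Rmax A 1 * M ^ S n) by (apply Rmult_le_compat_r; lra). lra.
Qed.

(** Landau's trick: the crude bound of Cauchy's formula, applied to all powers
    of [f], is sharp in the limit. *)
Theorem maximum_principle (f : C -> C) (z0 z : C) (p r M : R) :
  0 < p < r -> hol_ball f z0 r -> (forall t, Cmod (f (circle z0 p t)) <= M) ->
  inball z0 p z -> Cmod (f z) <= M.
Proof.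
  intros Hp Hf HM Hz. assert (PP := two_PI_pos).
  destruct (inball_unscale z0 z p ltac:(lra) Hz) as [Hu E].
  set (u := ((z - z0) / RtoC p)%C) in *.
  assert (HM0 : 0 <= M) by (eapply Rle_trans; [apply Cmod_ge_0|apply (HM 0)]).
  apply geometric_le with (/ (1 - Cmod u)); [apply Cmod_ge_0|exact HM0|].
  intros n. set (g := fun w => (f w ^ S n)%C).
  assert (Hg : hol_ball g z0 r).
  { intros w Hw. destruct (Hf w Hw) as [l Hl]. eexists.
    apply (cdiff_comp (fun w => w ^ S n)%C f); [apply cdiff_pow|exact Hl]. }
  assert (K := cauchy_formula g z0 p r u Hp Hg Hu). rewrite <- E in K.
  assert (B : Cmod (RtoC (2 * PI) * g z)%C <= M ^ S n / (1 - Cmod u) * (2 * PI)).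
  { rewrite <- K. apply cauchy_int_bound; auto.
    - now apply circle_contI with r.
    - intros t _. unfold g. rewrite Cmod_pow. apply pow_incr. split; [apply Cmod_ge_0|apply HM]. }
  rewrite Cmod_mult, Cmod_R, Rabs_pos_eq in B by lra. unfold g in B. rewrite Cmod_pow in B.
  apply Rmult_le_reg_l with (2 * PI); [lra|]. eapply Rle_trans; [exact B|].
  right. unfold Rdiv. ring.
Qed.

(** * Schwarz-Pick and Julia *)

Lemma disc_inball (z : C) : disc z <-> inball (RtoC 0) 1 z.
Proof. unfold disc, inball. now replace (z - RtoC 0)%C with z by ring. Qed.

Definition self_map (f : C -> C) : Prop :=
  hol_ball f (RtoC 0) 1 /\ forall z, disc z -> disc (f z).

(** The quotient [f z / z] extends holomorphically over [0] and is at most [1 / p]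
    on the circle of radius [p < 1]. *)
Theorem schwarz (f : C -> C) (z : C) :
  self_map f -> f (RtoC 0) = RtoC 0 -> disc z -> Cmod (f z) <= Cmod z.
Proof.
  intros [Hf Hm] H0 Hz.
  destruct (slope_exists f (RtoC 0) (RtoC 0) 1 Hf) as [g [gm [gc gd]]].
  { apply inball_center. lra. }
  assert (Hg : hol_ball g (RtoC 0) 1).
  { apply (painleve g (RtoC 0) 1 0 gc). intros w Hw Hre. apply gd; [exact Hw|].
    intros ->. now apply Hre. }
  assert (gE : forall w, (g w * w)%C = f w).
  { intros w. assert (K := gm w). rewrite H0 in K.
    replace (f w) with (f w - 0)%C by ring. rewrite <- K. ring. }
  replace (Cmod z) with (Cmod z / 1) by field.
  apply Rle_div_limit; [lra| |apply Cmod_ge_0].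
  intros p Hp. destruct (Rlt_le_dec (Cmod z) p) as [L|L].
  - assert (B : Cmod (g z) <= / p).
    { apply (maximum_principle g (RtoC 0) z p 1); try assumption.
      - intros t. assert (I := circle_inball (RtoC 0) p 1 t ltac:(lra)).
        apply (proj2 (disc_inball _)), Hm in I. rewrite <- gE in I. unfold disc in I.
        rewrite Cmod_mult in I.
        replace (Cmod (circle (RtoC 0) p t)) with p in I.
        + apply Rmult_le_reg_r with p; [lra|]. rewrite Rinv_l by lra. lra.
        + unfold circle. replace (RtoC 0 + RtoC p * circ t)%C with (RtoC p * circ t)%C by ring.
          rewrite Cmod_mult, Cmod_circ, Cmod_R, Rabs_pos_eq by lra. ring.
      - unfold inball. now replace (z - RtoC 0)%C with z by ring. }
    rewrite <- gE, Cmod_mult. unfold Rdiv. rewrite Rmult_comm.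
    apply Rmult_le_compat_l; [apply Cmod_ge_0|exact B].
  - apply Rle_trans with 1; [left; now apply Hm|].
    apply Rmult_le_reg_r with p; [lra|]. unfold Rdiv. rewrite Rmult_assoc, Rinv_l by lra. lra.
Qed.

Lemma blaschke_identity (z w : C) :
  Cmod (1 - Cconj w * z) ^ 2 - Cmod (z - w) ^ 2 = (1 - Cmod z ^ 2) * (1 - Cmod w ^ 2).
Proof.
  rewrite !Cmod_sqr. destruct z as [a b], w as [c d]. unfold Re, Im; simpl. ring.
Qed.

Lemma disc_sqr (z : C) : disc z -> 0 < 1 - Cmod z ^ 2.
Proof. unfold disc. intros H. assert (P := Cmod_ge_0 z). nra. Qed.

Lemma blaschke_neq_0 (z w : C) : Cmod w <= 1 -> disc z -> (1 - Cconj w * z)%C <> RtoC 0.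
Proof.
  intros Hw Hz. apply Cmod_gt_0. unfold disc in Hz.
  assert (K := Cmod_sub_ge 1 (Cconj w * z)%C).
  rewrite Cmod_mult, Cmod_conj, Cmod_1 in K.
  assert (P := Cmod_ge_0 z). assert (Q := Cmod_ge_0 w). nra.
Qed.

(** The Möbius automorphism of the disc sending [w] to [0]. *)
Definition blaschke (w z : C) : C := ((z - w) / (1 - Cconj w * z))%C.

Lemma blaschke_self_map (w : C) : disc w -> self_map (blaschke w).
Proof.
  intros Hw. split.
  - intros z Hz. apply (proj2 (disc_inball _)) in Hz. eexists.
    apply (cdiff_div (fun z => z - w)%C (fun z => 1 - Cconj w * z)%C).
    + apply blaschke_neq_0; [left; exact Hw|exact Hz].
    + apply (cdiff_minus (fun w => w) (fun _ => w)); [apply cdiff_id|apply cdiff_const].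
    + apply (cdiff_minus (fun _ => RtoC 1) (fun z => Cconj w * z)%C); [apply cdiff_const|].
      apply (cdiff_scal (Cconj w) (fun z => z)), cdiff_id.
  - intros z Hz. assert (N := blaschke_neq_0 z w (Rlt_le _ _ Hw) Hz).
    unfold disc, blaschke. rewrite Cmod_div by exact N.
    assert (P : 0 < Cmod (1 - Cconj w * z)) by now apply Cmod_gt_0.
    apply Rmult_lt_reg_r with (Cmod (1 - Cconj w * z)); [exact P|].
    unfold Rdiv. rewrite Rmult_assoc, Rinv_l, Rmult_1_l, Rmult_1_r by lra.
    assert (E := blaschke_identity z w). assert (A := disc_sqr z Hz). assert (B := disc_sqr w Hw).
    assert (0 < (1 - Cmod z ^ 2) * (1 - Cmod w ^ 2)) by now apply Rmult_lt_0_compat.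
    assert (Q := Cmod_ge_0 (z - w)). nra.
Qed.

Lemma self_map_comp (f g : C -> C) : self_map f -> self_map g -> self_map (fun z => f (g z)).
Proof.
  intros [Hf Mf] [Hg Mg]. split; [|auto].
  intros z Hz. destruct (Hg z Hz) as [l Hl].
  destruct (Hf (g z)) as [m Hm]; [apply (proj1 (disc_inball _)), Mg; now apply (proj2 (disc_inball z))|].
  exists (m * l)%C. now apply cdiff_comp.
Qed.

Lemma blaschke_inv (w z : C) : disc w -> disc z -> blaschke (- w) (blaschke w z) = z.
Proof.
  intros Hw Hz. unfold blaschke.
  assert (N := blaschke_neq_0 z w (Rlt_le _ _ Hw) Hz).
  assert (N1 := blaschke_neq_0 w w (Rlt_le _ _ Hw) Hw).
  rewrite Copp_conj. field. split; [exact N|].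
  replace (1 - Cconj w * z - - Cconj w * (z - w))%C with (1 - Cconj w * w)%C by ring.
  exact N1.
Qed.

(** Conjugating by automorphisms reduces this to [schwarz].  The form without
    quotients, where [1 - |z|^2] enters on both sides, survives the passage of
    [w] to the boundary. *)
Theorem schwarz_pick (f : C -> C) (z w : C) :
  self_map f -> disc z -> disc w ->
  Cmod (1 - Cconj (f w) * f z) ^ 2 * ((1 - Cmod z ^ 2) * (1 - Cmod w ^ 2)) <=
  Cmod (1 - Cconj w * z) ^ 2 * ((1 - Cmod (f z) ^ 2) * (1 - Cmod (f w) ^ 2)).
Proof.
  intros Hf Hz Hw.
  assert (Hfz : disc (f z)) by now apply Hf. assert (Hfw : disc (f w)) by now apply Hf.
  assert (Hw' : disc (- w)) by (unfold disc; now rewrite Cmod_opp).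
  assert (S : self_map (fun u => blaschke (f w) (f (blaschke (- w) u)))).
  { apply (self_map_comp (blaschke (f w)) (fun u => f (blaschke (- w) u))).
    - now apply blaschke_self_map.
    - apply self_map_comp; [exact Hf|now apply blaschke_self_map]. }
  assert (Hu : disc (blaschke w z)) by now apply (blaschke_self_map w Hw).
  assert (K := schwarz _ (blaschke w z) S). cbv beta in K.
  rewrite blaschke_inv in K by assumption.
  assert (K0 : blaschke (f w) (f (blaschke (- w) (RtoC 0))) = RtoC 0).
  { replace (blaschke (- w) (RtoC 0)) with w.
    - unfold blaschke. replace (f w - f w)%C with (RtoC 0) by ring. unfold Cdiv. ring.
    - unfold blaschke. field. }
  specialize (K K0 Hu). unfold blaschke in K.
  assert (N1 := blaschke_neq_0 z w (Rlt_le _ _ Hw) Hz).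
  assert (N2 := blaschke_neq_0 (f z) (f w) (Rlt_le _ _ Hfw) Hfz).
  rewrite !Cmod_div in K by assumption.
  assert (E1 := blaschke_identity z w). assert (E2 := blaschke_identity (f z) (f w)).
  assert (D1 : 0 < Cmod (1 - Cconj w * z)) by now apply Cmod_gt_0.
  assert (D2 : 0 < Cmod (1 - Cconj (f w) * f z)) by now apply Cmod_gt_0.
  assert (P1 := Cmod_ge_0 (f z - f w)). assert (P2 := Cmod_ge_0 (z - w)).
  rewrite <- E1, <- E2.
  set (a := Cmod (f z - f w)) in *. set (b := Cmod (z - w)) in *.
  set (d1 := Cmod (1 - Cconj w * z)) in *. set (d2 := Cmod (1 - Cconj (f w) * f z)) in *.
  assert (K2 : a * d1 <= b * d2).
  { apply Rmult_le_compat_r with (r := d1 * d2) in K; [|apply Rmult_le_pos; lra].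
    replace (a / d2 * (d1 * d2)) with (a * d1) in K by (field; lra).
    replace (b / d1 * (d1 * d2)) with (b * d2) in K by (field; lra). exact K. }
  assert (K3 : (a * d1) ^ 2 <= (b * d2) ^ 2).
  { apply pow_incr. split; [apply Rmult_le_pos; lra|exact K2]. }
  nra.
Qed.

(** The data of Julia's lemma: the pair [(w, f w)] comes close to [(a, b)] while the
    boundary dilation of [f] at [w] stays close to, or below, [al]. *)
Definition approach (f : C -> C) (a b : C) (al : R) : Prop :=
  forall eta, 0 < eta -> exists w, disc w /\ Cmod (w - a) < eta /\ Cmod (f w - b) < eta /\
    (1 - Cmod (f w)) / (1 - Cmod w) < al + eta.

Lemma Cmod_unit_sub (b z : C) : Cmod b = 1 -> Cmod (1 - Cconj b * z) = Cmod (b - z).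
Proof.
  intros Hb. assert (E := Cmod2_conj b). rewrite Hb in E.
  replace (1 - Cconj b * z)%C with (Cconj b * (b - z))%C.
  - rewrite Cmod_mult, Cmod_conj, Hb. ring.
  - replace (Cconj b * (b - z))%C with (b * Cconj b - Cconj b * z)%C by ring.
    rewrite <- E. f_equal. rewrite pow1. reflexivity.
Qed.

Lemma Rle_limit_linear (x y K : R) :
  (forall eta, 0 < eta <= 1 -> x <= y + K * eta) -> x <= y.
Proof.
  intros H. apply Rnot_lt_le. intros L.
  set (K' := Rmax K 1). assert (K1 : 1 <= K') by apply Rmax_r.
  assert (K2 : K <= K') by apply Rmax_l.
  set (eta := Rmin 1 ((x - y) / (2 * K'))).
  assert (E : 0 < eta) by (apply Rmin_pos; [lra|apply Rdiv_lt_0_compat; lra]).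
  assert (E1 : eta <= 1) by apply Rmin_l.
  assert (E2 : eta <= (x - y) / (2 * K')) by apply Rmin_r.
  specialize (H eta (conj E E1)).
  assert (K * eta <= K' * eta) by (apply Rmult_le_compat_r; lra).
  assert (K' * eta <= K' * ((x - y) / (2 * K'))) by (apply Rmult_le_compat_l; lra).
  replace (K' * ((x - y) / (2 * K'))) with ((x - y) / 2) in * by (field; lra). lra.
Qed.

(** Limit form of Schwarz-Pick as one of the two points tends to the boundary. *)
Theorem julia (f : C -> C) (a b : C) (al : R) (z : C) :
  self_map f -> Cmod a = 1 -> Cmod b = 1 -> 0 <= al -> approach f a b al -> disc z ->
  Cmod (b - f z) ^ 2 * (1 - Cmod z ^ 2) <= al * Cmod (a - z) ^ 2 * (1 - Cmod (f z) ^ 2).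
Proof.
  intros Hf Ha Hb Hal Hap Hz. assert (Hfz : disc (f z)) by now apply Hf.
  assert (c1 := disc_sqr z Hz). assert (c2 := disc_sqr _ Hfz).
  assert (c1' : 1 - Cmod z ^ 2 <= 1) by (assert (H := pow2_ge_0 (Cmod z)); lra).
  assert (c2' : 1 - Cmod (f z) ^ 2 <= 1) by (assert (H := pow2_ge_0 (Cmod (f z))); lra).
  set (q := Cmod (a - z) ^ 2). assert (Hq0 : 0 <= q) by apply pow2_ge_0.
  apply Rle_limit_linear with (5 + 5 * al + (al + 2) * (q + 5)). intros eta Heta.
  destruct (Hap eta (proj1 Heta)) as [w [Hw [W1 [W2 W3]]]].
  assert (Hfw : disc (f w)) by now apply Hf.
  assert (SP := schwarz_pick f z w Hf Hz Hw).
  set (c1w := 1 - Cmod w ^ 2) in *. set (c2w := 1 - Cmod (f w) ^ 2) in *.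
  assert (Hc1w : 0 < c1w) by now apply disc_sqr.
  assert (Hc2w : 0 < c2w) by now apply disc_sqr.
  unfold disc in Hz, Hfz, Hw, Hfw.
  assert (Y : Cmod (b - f z) <= Cmod (1 - Cconj (f w) * f z) + eta).
  { rewrite <- Cmod_unit_sub by exact Hb.
    replace (1 - Cconj b * f z)%C with
      ((1 - Cconj (f w) * f z) + Cconj (f w - b) * f z)%C by (rewrite Cminus_conj; ring).
    eapply Rle_trans; [apply Cmod_triangle|]. apply Rplus_le_compat_l.
    rewrite Cmod_mult, Cmod_conj. assert (P := Cmod_ge_0 (f z)).
    assert (Q := Cmod_ge_0 (f w - b)). nra. }
  assert (X : Cmod (1 - Cconj w * z) <= Cmod (a - z) + eta).
  { rewrite <- (Cmod_unit_sub a) by exact Ha.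
    replace (1 - Cconj w * z)%C with
      ((1 - Cconj a * z) - Cconj (w - a) * z)%C by (rewrite Cminus_conj; ring).
    eapply Rle_trans; [apply Cmod_sub_le|]. apply Rplus_le_compat_l.
    rewrite Cmod_mult, Cmod_conj. assert (P := Cmod_ge_0 z).
    assert (Q := Cmod_ge_0 (w - a)). nra. }
  assert (Y2 : Cmod (1 - Cconj (f w) * f z) <= 2).
  { eapply Rle_trans; [apply Cmod_sub_le|]. rewrite Cmod_mult, Cmod_conj, Cmod_1.
    assert (P := Cmod_ge_0 (f z)). assert (Q := Cmod_ge_0 (f w)). nra. }
  assert (X2 : Cmod (a - z) <= 2).
  { eapply Rle_trans; [apply Cmod_sub_le|]. lra. }
  assert (Rt : c2w <= (al + eta) * (1 + eta) * c1w).
  { unfold c1w, c2w. assert (Pw := Cmod_ge_0 w). assert (Pfw := Cmod_ge_0 (f w)).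
    assert (D : 1 - Cmod (f w) <= (al + eta) * (1 - Cmod w)).
    { left. apply Rmult_lt_compat_r with (r := 1 - Cmod w) in W3; [|lra].
      unfold Rdiv in W3. rewrite Rmult_assoc, Rinv_l, Rmult_1_r in W3 by lra. exact W3. }
    assert (Lw : 1 - eta <= Cmod w).
    { assert (K := Cmod_sub_ge a w). rewrite Cmod_sub_sym, Ha in K. lra. }
    apply Rle_trans with (2 * ((al + eta) * (1 - Cmod w))).
    - replace (1 - Cmod (f w) ^ 2) with ((1 - Cmod (f w)) * (1 + Cmod (f w))) by ring. nra.
    - replace ((al + eta) * (1 + eta) * (1 - Cmod w ^ 2)) with
        (((al + eta) * (1 - Cmod w)) * ((1 + eta) * (1 + Cmod w))) by ring.
      rewrite Rmult_comm. apply Rmult_le_compat_l; [apply Rmult_le_pos; lra|]. nra. }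
  set (x := Cmod (b - f z)) in *. set (y := Cmod (1 - Cconj (f w) * f z)) in *.
  set (v := Cmod (1 - Cconj w * z)) in *. set (s := Cmod (a - z)) in *.
  assert (px : 0 <= x) by apply Cmod_ge_0. assert (py : 0 <= y) by apply Cmod_ge_0.
  assert (pv : 0 <= v) by apply Cmod_ge_0. assert (ps : 0 <= s) by apply Cmod_ge_0.
  assert (SP2 : y ^ 2 * (1 - Cmod z ^ 2) <=
    v ^ 2 * (1 - Cmod (f z) ^ 2) * ((al + eta) * (1 + eta))).
  { apply Rmult_le_reg_r with c1w; [exact Hc1w|].
    apply Rle_trans with (v ^ 2 * (1 - Cmod (f z) ^ 2) * c2w); [lra|].
    rewrite (Rmult_assoc (v ^ 2 * _)). apply Rmult_le_compat_l; [|exact Rt].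
    apply Rmult_le_pos; [apply pow2_ge_0|lra]. }
  assert (x2 : x ^ 2 <= y ^ 2 + 5 * eta) by nra.
  assert (v2 : v ^ 2 <= q + 5 * eta) by (unfold q; nra).
  set (k1 := 1 - Cmod z ^ 2) in *. set (k2 := 1 - Cmod (f z) ^ 2) in *.
  assert (T1 : x ^ 2 * k1 <= y ^ 2 * k1 + 5 * eta) by nra.
  assert (T2 : v ^ 2 * k2 * ((al + eta) * (1 + eta)) <=
    (q + 5 * eta) * k2 * ((al + eta) * (1 + eta))).
  { apply Rmult_le_compat_r; [apply Rmult_le_pos; lra|]. apply Rmult_le_compat_r; lra. }
  assert (T3 : (q + 5 * eta) * k2 * ((al + eta) * (1 + eta)) <=
    al * q * k2 + (5 * al + (al + 2) * (q + 5)) * eta).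
  { assert (A1 : (al + eta) * (1 + eta) <= al + eta * (al + 2)) by nra.
    apply Rle_trans with ((q + 5 * eta) * k2 * (al + eta * (al + 2))).
    - apply Rmult_le_compat_l; [|exact A1]. apply Rmult_le_pos; lra.
    - assert (A2 : (q + 5 * eta) * k2 * (al + eta * (al + 2)) =
        al * q * k2 + k2 * (5 * al * eta + (q + 5 * eta) * (eta * (al + 2)))) by ring.
      rewrite A2. apply Rplus_le_compat_l.
      assert (A3 : 0 <= 5 * al * eta + (q + 5 * eta) * (eta * (al + 2))).
      { apply Rplus_le_le_0_compat.
        - apply Rmult_le_pos; [|lra]. lra.
        - apply Rmult_le_pos; [lra|]. apply Rmult_le_pos; lra. }
      assert (A4 : (q + 5 * eta) * (eta * (al + 2)) <= (q + 5) * (eta * (al + 2))).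
      { apply Rmult_le_compat_r; [apply Rmult_le_pos; lra|lra]. }
      nra. }
  lra.
Qed.

Lemma inv_INR_small (e : R) :
  0 < e -> exists N, forall n, (N <= n)%nat -> / (INR n + 1) < e.
Proof.
  intros He. destruct (archimed_cor1 e He) as [N [HN1 HN2]]. exists N. intros n Hn.
  eapply Rlt_trans; [|exact HN1]. apply Rinv_lt_contravar.
  - apply Rmult_lt_0_compat; [apply lt_0_INR; lia|]. assert (P := pos_INR n). lra.
  - apply le_INR in Hn. lra.
Qed.

Lemma Cauchy_C (u : nat -> C) (K : R) : 0 <= K ->
  (forall n m, Cmod (u n - u m) <= K * (/ (INR n + 1) + / (INR m + 1))) ->
  exists b, forall n, Cmod (u n - b) <= 2 * K * / (INR n + 1).
Proof.
  intros HK H.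
  assert (Cy : forall g : nat -> R, (forall n m, Rabs (g n - g m) <= Cmod (u n - u m)) ->
    Cauchy_crit g).
  { intros g Hg e He.
    assert (He' : 0 < e / (2 * (K + 1))) by (apply Rdiv_lt_0_compat; lra).
    destruct (inv_INR_small _ He') as [N HN]. exists N. intros n m Hn Hm.
    unfold Rdist. eapply Rle_lt_trans; [apply Hg|]. eapply Rle_lt_trans; [apply H|].
    assert (A := HN n Hn). assert (B := HN m Hm).
    assert (Pn : 0 < / (INR n + 1)) by (apply Rinv_0_lt_compat; assert (P := pos_INR n); lra).
    assert (Pm : 0 < / (INR m + 1)) by (apply Rinv_0_lt_compat; assert (P := pos_INR m); lra).
    apply Rle_lt_trans with ((K + 1) * (/ (INR n + 1) + / (INR m + 1))).
    - apply Rmult_le_compat_r; lra.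
    - replace e with ((K + 1) * (e / (2 * (K + 1)) + e / (2 * (K + 1)))) by (field; lra).
      apply Rmult_lt_compat_l; lra. }
  destruct (Rcomplete.R_complete (fun n => Re (u n))) as [x Hx].
  { apply Cy. intros n m. apply (Re_le_Cmod (u n - u m)). }
  destruct (Rcomplete.R_complete (fun n => Im (u n))) as [y Hy].
  { apply Cy. intros n m. apply (Im_le_Cmod (u n - u m)). }
  exists (x, y). intros n.
  assert (Pn : 0 < / (INR n + 1)) by (apply Rinv_0_lt_compat; assert (P := pos_INR n); lra).
  apply Rnot_lt_le. intros L.
  set (gap := Cmod (u n - (x, y)) - 2 * K * / (INR n + 1)).
  assert (Hg : 0 < gap / 4) by (unfold gap; lra).
  destruct (Hx _ Hg) as [N1 HN1]. destruct (Hy _ Hg) as [N2 HN2].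
  set (m := (n + N1 + N2)%nat).
  specialize (HN1 m ltac:(unfold m; lia)). specialize (HN2 m ltac:(unfold m; lia)).
  unfold Rdist in HN1, HN2. specialize (H n m).
  assert (D : Cmod (u m - (x, y)) < gap / 2).
  { eapply Rle_lt_trans; [apply Cmod_le_Re_Im|].
    change (Rabs (Re (u m) - x) + Rabs (Im (u m) - y) < gap / 2). lra. }
  assert (T := Cmod_sub_triangle (u n) (u m) (x, y)).
  assert (Hm : / (INR m + 1) <= / (INR n + 1)).
  { apply Rinv_le_contravar; [assert (P := pos_INR n); lra|].
    assert (INR n <= INR m) by (apply le_INR; unfold m; lia). lra. }
  assert (K * (/ (INR n + 1) + / (INR m + 1)) <= K * (2 * / (INR n + 1))).
  { apply Rmult_le_compat_l; lra. }
  unfold gap in D. lra.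
Qed.

(** Along points of bounded dilation quotient tending to [a], Schwarz-Pick makes
    the values of [f] a Cauchy sequence. *)
Theorem boundary_value_exists (f : C -> C) (a : C) (al : R) :
  self_map f -> Cmod a = 1 -> 0 <= al ->
  (forall eta, 0 < eta -> exists w, disc w /\ Cmod (w - a) < eta /\
    (1 - Cmod (f w)) / (1 - Cmod w) < al + eta) ->
  exists b, Cmod b = 1 /\ approach f a b al.
Proof.
  intros Hf Ha Hal H.
  assert (Hpos : forall n : nat, 0 < / (INR n + 1))
    by (intros n; apply Rinv_0_lt_compat; assert (P := pos_INR n); lra).
  assert (Hle1 : forall n : nat, / (INR n + 1) <= 1).
  { intros n. rewrite <- Rinv_1. apply Rinv_le_contravar; [lra|].
    assert (P := pos_INR n). lra. }
  destruct (choice _ (fun n : nat => H _ (Hpos n))) as [w Hw].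
  assert (Hr : forall n, 1 - Cmod (f (w n)) <= (al + 1) * (1 - Cmod (w n))).
  { intros n. destruct (Hw n) as [W1 [W2 W3]]. unfold disc in W1. left.
    apply Rmult_lt_compat_r with (r := 1 - Cmod (w n)) in W3; [|lra].
    unfold Rdiv in W3. rewrite Rmult_assoc, Rinv_l, Rmult_1_r in W3 by lra.
    eapply Rlt_le_trans; [exact W3|]. apply Rmult_le_compat_r; [lra|].
    specialize (Hle1 n). lra. }
  assert (Hr2 : forall n, 1 - Cmod (f (w n)) ^ 2 <= 2 * (al + 1) * (1 - Cmod (w n) ^ 2)).
  { intros n. specialize (Hr n). destruct (Hw n) as [W1 _].
    assert (F1 : disc (f (w n))) by now apply Hf. unfold disc in W1, F1.
    assert (P := Cmod_ge_0 (w n)). assert (Q := Cmod_ge_0 (f (w n))).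
    apply Rle_trans with (2 * ((al + 1) * (1 - Cmod (w n)))); [nra|].
    assert (0 <= (al + 1) * (1 - Cmod (w n)) * Cmod (w n)).
    { apply Rmult_le_pos; [|exact P]. apply Rmult_le_pos; lra. }
    replace (2 * (al + 1) * (1 - Cmod (w n) ^ 2)) with
      (2 * ((al + 1) * (1 - Cmod (w n)) + (al + 1) * (1 - Cmod (w n)) * Cmod (w n))) by ring.
    lra. }
  destruct (Cauchy_C (fun n => f (w n)) (2 * (al + 1))) as [b Hb]; [lra| |].
  { intros n m. destruct (Hw n) as [N1 [N2 _]]. destruct (Hw m) as [M1 [M2 _]].
    assert (Fn : disc (f (w n))) by now apply Hf. assert (Fm : disc (f (w m))) by now apply Hf.
    assert (SP := schwarz_pick f (w n) (w m) Hf N1 M1).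
    assert (BI := blaschke_identity (f (w n)) (f (w m))).
    assert (An := disc_sqr _ N1). assert (Am := disc_sqr _ M1).
    assert (Bn := disc_sqr _ Fn). assert (Bm := disc_sqr _ Fm).
    assert (Rn := Hr2 n). assert (Rm := Hr2 m).
    set (an := 1 - Cmod (w n) ^ 2) in *. set (am := 1 - Cmod (w m) ^ 2) in *.
    set (bn := 1 - Cmod (f (w n)) ^ 2) in *. set (bm := 1 - Cmod (f (w m)) ^ 2) in *.
    set (x := Cmod (f (w n) - f (w m))) in *.
    set (y := Cmod (1 - Cconj (f (w m)) * f (w n))) in *.
    set (v := Cmod (1 - Cconj (w m) * w n)) in *.
    assert (px : 0 <= x) by apply Cmod_ge_0. assert (py : 0 <= y) by apply Cmod_ge_0.
    assert (pv : 0 <= v) by apply Cmod_ge_0.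
    set (k := 2 * (al + 1)) in *.
    assert (hk : 2 <= k) by (unfold k; lra).
    assert (E1 : y ^ 2 <= (k * v) ^ 2).
    { apply Rmult_le_reg_r with (an * am); [now apply Rmult_lt_0_compat|].
      eapply Rle_trans; [exact SP|].
      replace ((k * v) ^ 2 * (an * am)) with (v ^ 2 * ((k * an) * (k * am))) by ring.
      apply Rmult_le_compat_l; [apply pow2_ge_0|]. apply Rmult_le_compat; lra. }
    assert (E2 : x <= k * v).
    { assert (0 <= k * v) by (apply Rmult_le_pos; lra).
      assert (0 < bn * bm) by now apply Rmult_lt_0_compat. nra. }
    assert (V : v <= / (INR n + 1) + / (INR m + 1)).
    { unfold v. replace (1 - Cconj (w m) * w n)%C with
        ((1 - Cconj a * w n) - Cconj (w m - a) * w n)%C by (rewrite Cminus_conj; ring).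
      eapply Rle_trans; [apply Cmod_sub_le|].
      rewrite (Cmod_unit_sub a) by exact Ha. rewrite Cmod_sub_sym.
      rewrite Cmod_mult, Cmod_conj. unfold disc in N1.
      assert (P := Cmod_ge_0 (w n)). assert (Q := Cmod_ge_0 (w m - a)). nra. }
    eapply Rle_trans; [exact E2|]. apply Rmult_le_compat_l; lra. }
  exists b. split.
  - assert (G : forall n : nat, Rabs (Cmod b - 1) <= (5 * (al + 1)) * / (INR n + 1)).
    { intros n. specialize (Hb n). destruct (Hw n) as [W1 [W2 _]]. specialize (Hr n).
      assert (F1 : disc (f (w n))) by now apply Hf. unfold disc in F1, W1.
      assert (A1 := Cmod_sub_ge (f (w n)) b). assert (A2 := Cmod_sub_ge b (f (w n))).
      rewrite (Cmod_sub_sym b) in A2.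
      assert (A3 := Cmod_sub_ge a (w n)). rewrite Ha, (Cmod_sub_sym a) in A3.
      assert (A4 : (al + 1) * (1 - Cmod (w n)) <= (al + 1) * / (INR n + 1))
        by (apply Rmult_le_compat_l; lra).
      assert (A5 : 0 <= (al + 1) * / (INR n + 1)) by
        (apply Rmult_le_pos; [lra|left; apply Hpos]).
      apply Rabs_le. lra. }
    assert (D : Rabs (Cmod b - 1) <= 0).
    { apply (Rle_0_small _ (5 * (al + 1)) 1); [lra|]. intros e He.
      destruct (inv_INR_small e (proj1 He)) as [n Hn].
      specialize (Hn n (Nat.le_refl n)). exists (/ (INR n + 1)).
      split; [split; [left; apply Hpos|exact Hn]|]. rewrite Rmult_comm. apply G. }
    assert (P := Rabs_pos (Cmod b - 1)).
    assert (Rabs (Cmod b - 1) = 0) as E by lra.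
    apply Rabs_eq_0 in E. lra.
  - intros eta Heta.
    assert (He : 0 < eta / (4 * (al + 1) + 1)) by (apply Rdiv_lt_0_compat; lra).
    destruct (inv_INR_small _ He) as [n Hn]. specialize (Hn n (Nat.le_refl n)).
    destruct (Hw n) as [W1 [W2 W3]].
    assert (Hn1 : / (INR n + 1) * (4 * (al + 1) + 1) < eta).
    { apply Rmult_lt_compat_r with (r := 4 * (al + 1) + 1) in Hn; [|lra].
      unfold Rdiv in Hn. rewrite (Rmult_assoc eta), Rinv_l, Rmult_1_r in Hn by lra. exact Hn. }
    specialize (Hpos n). specialize (Hb n).
    assert (0 <= / (INR n + 1) * (4 * (al + 1))) by (apply Rmult_le_pos; lra).
    exists (w n). repeat split; try assumption; lra.
Qed.

(** Julia's inequality bounds [f] from above near [a]; a lower bound for the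
    dilation quotient leaves no room and forces a radial derivative. *)
Theorem julia_caratheodory (f : C -> C) (a b : C) (al : R) :
  self_map f -> Cmod a = 1 -> Cmod b = 1 -> 0 <= al ->
  (forall z, disc z -> Cmod (b - f z) ^ 2 * (1 - Cmod z ^ 2) <=
     al * Cmod (a - z) ^ 2 * (1 - Cmod (f z) ^ 2)) ->
  (forall e, 0 < e -> exists d, 0 < d /\ forall z, disc z -> Cmod (z - a) < d ->
     al - e <= (1 - Cmod (f z)) / (1 - Cmod z)) ->
  forall e, 0 < e -> exists d, 0 < d < 1 /\ forall x, 0 < x < d ->
    Cmod (f (RtoC (1 - x) * a)%C - b * RtoC (1 - al * x)) <= e * x.
Proof.
  intros Hf Ha Hb Hal HJ HL e He.
  set (k := e * e / (4 * (al + 1))).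
  assert (Hk : 0 < k) by (apply Rdiv_lt_0_compat; [now apply Rmult_lt_0_compat|lra]).
  destruct (HL k Hk) as [d1 [Hd1 K1]].
  set (d2 := e * e / (6 * (al * al + 1))).
  assert (Haa : 0 <= al * al) by now apply Rmult_le_pos.
  assert (Hd2 : 0 < d2) by (apply Rdiv_lt_0_compat; [now apply Rmult_lt_0_compat|lra]).
  set (d := Rmin (1 / 2) (Rmin d1 d2)).
  exists d. split.
  { split; [apply Rmin_pos; [lra|now apply Rmin_pos]|].
    apply Rle_lt_trans with (1 / 2); [apply Rmin_l|lra]. }
  intros x Hx.
  assert (X1 : x < 1 / 2) by (eapply Rlt_le_trans; [apply Hx|apply Rmin_l]).
  assert (X2 : x < d1).
  { eapply Rlt_le_trans; [apply Hx|]. eapply Rle_trans; [apply Rmin_r|apply Rmin_l]. }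
  assert (X3 : x < d2).
  { eapply Rlt_le_trans; [apply Hx|]. eapply Rle_trans; [apply Rmin_r|apply Rmin_r]. }
  set (z := (RtoC (1 - x) * a)%C).
  assert (Mz : Cmod z = 1 - x).
  { unfold z. rewrite Cmod_mult, Ha, Cmod_R, Rabs_pos_eq; lra. }
  assert (Dz : Cmod (a - z) = x).
  { unfold z. replace (a - RtoC (1 - x) * a)%C with (RtoC x * a)%C
      by (rewrite RtoC_minus; ring). rewrite Cmod_mult, Ha, Cmod_R, Rabs_pos_eq; lra. }
  assert (Hz : disc z) by (unfold disc; lra).
  assert (J := HJ z Hz). rewrite Mz, Dz in J.
  assert (L := K1 z Hz). rewrite (Cmod_sub_sym z), Dz, Mz in L. specialize (L X2).
  replace (1 - (1 - x)) with x in L by ring.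
  assert (Hfz : disc (f z)) by now apply Hf. unfold disc in Hfz.
  (* [v] is the defect of [f z] from [b] in the direction of [b].  Julia's inequality
     gives [|v| <= al x (1 + x)], the lower dilation bound gives
     [Re v >= (al - k) x]; together they confine [v] to a small neighbourhood of
     [al x]. *)
  set (v := (1 - Cconj b * f z)%C).
  assert (Ev : Cmod v = Cmod (b - f z)) by now apply Cmod_unit_sub.
  assert (Ef : (f z - b * RtoC (1 - al * x))%C = (b * (RtoC (al * x) - v))%C).
  { unfold v. assert (E := Cmod2_conj b). rewrite Hb, pow1 in E.
    replace (b * (RtoC (al * x) - (1 - Cconj b * f z)))%C with
      (b * RtoC (al * x) - b + b * Cconj b * f z)%C by ring.
    rewrite <- E, RtoC_minus. ring. }
  rewrite Ef, Cmod_mult, Hb, Rmult_1_l.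
  set (y := 1 - Cmod (f z)) in *.
  assert (Ly : (al - k) * x <= y).
  { apply Rmult_le_compat_r with (r := x) in L; [|lra].
    unfold Rdiv in L. rewrite Rmult_assoc, Rinv_l, Rmult_1_r in L by lra. exact L. }
  assert (Rv : y <= Re v).
  { unfold v. assert (R1 := Re_le_Cmod (Cconj b * f z)%C).
    rewrite Cmod_mult, Cmod_conj, Hb, Rmult_1_l in R1.
    assert (R2 := Rle_abs (Re (Cconj b * f z)%C)).
    replace (Re (1 - Cconj b * f z)%C) with (1 - Re (Cconj b * f z)%C)
      by (unfold Re; simpl; ring). unfold y. lra. }
  assert (yv : y <= Cmod v).
  { eapply Rle_trans; [exact Rv|]. eapply Rle_trans; [apply Rle_abs|apply Re_le_Cmod]. }
  rewrite <- Ev in J.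
  assert (py : 0 <= y) by (unfold y; lra). assert (pv : 0 <= Cmod v) by apply Cmod_ge_0.
  assert (J2 : Cmod v ^ 2 * (2 - x) <= 2 * al * x * y).
  { apply Rmult_le_reg_r with x; [lra|].
    replace (Cmod v ^ 2 * (2 - x) * x) with (Cmod v ^ 2 * (1 - (1 - x) ^ 2)) by ring.
    eapply Rle_trans; [exact J|].
    assert (1 - Cmod (f z) ^ 2 <= 2 * y).
    { unfold y. assert (P := Cmod_ge_0 (f z)). nra. }
    replace (2 * al * x * y * x) with (al * x ^ 2 * (2 * y)) by ring.
    apply Rmult_le_compat_l; [|assumption]. apply Rmult_le_pos; [exact Hal|apply pow2_ge_0]. }
  assert (J3 : Cmod v <= al * x * (1 + x)).
  { destruct (Req_dec (Cmod v) 0) as [E0|E0].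
    { rewrite E0. apply Rmult_le_pos; [apply Rmult_le_pos|]; lra. }
    assert (J4 : Cmod v * (2 - x) <= 2 * al * x).
    { apply Rmult_le_reg_l with (Cmod v); [lra|].
      replace (Cmod v * (Cmod v * (2 - x))) with (Cmod v ^ 2 * (2 - x)) by ring.
      eapply Rle_trans; [exact J2|]. rewrite (Rmult_comm (Cmod v)).
      apply Rmult_le_compat_l; [|exact yv]. apply Rmult_le_pos; lra. }
    apply Rmult_le_reg_r with (2 - x); [lra|]. eapply Rle_trans; [exact J4|].
    assert (0 <= al * x * (x * (1 - x))) by
      (repeat apply Rmult_le_pos; lra). lra. }
  assert (S : Cmod (RtoC (al * x) - v) ^ 2 <= (e * x) ^ 2).
  { assert (ES : Cmod (RtoC (al * x) - v) ^ 2 = Cmod v ^ 2 - 2 * (al * x) * Re v + (al * x) ^ 2).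
    { rewrite !Cmod_sqr. unfold Re, Im; simpl. ring. }
    rewrite ES.
    assert (V2 : Cmod v ^ 2 <= (al * x * (1 + x)) ^ 2) by (apply pow_incr; lra).
    assert (pax : 0 <= al * x) by (apply Rmult_le_pos; lra).
    assert (R3 : (al * x) * ((al - k) * x) <= (al * x) * Re v) by
      (apply Rmult_le_compat_l; lra).
    assert (F1 : Cmod v ^ 2 - 2 * (al * x) * Re v + (al * x) ^ 2 <=
      x ^ 2 * (al * al * (2 * x + x ^ 2) + 2 * (al * k))) by nra.
    eapply Rle_trans; [exact F1|].
    replace ((e * x) ^ 2) with (x ^ 2 * (e * e)) by ring.
    apply Rmult_le_compat_l; [apply pow2_ge_0|].
    assert (G1 : al * al * (2 * x + x ^ 2) <= e * e / 2).
    { apply Rle_trans with (al * al * (3 * d2)).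
      - apply Rmult_le_compat_l; [exact Haa|]. nra.
      - unfold d2. apply Rle_trans with ((al * al + 1) * (3 * (e * e / (6 * (al * al + 1))))).
        + apply Rmult_le_compat_r; [unfold d2 in Hd2; lra|lra].
        + right. field. lra. }
    assert (G2 : 2 * (al * k) <= e * e / 2).
    { apply Rle_trans with (2 * ((al + 1) * k)).
      - apply Rmult_le_compat_l; [lra|]. apply Rmult_le_compat_r; lra.
      - right. unfold k. field. lra. }
    lra. }
  apply Rsqr_incr_0_var; [|apply Rmult_le_pos; lra].
  rewrite !Rsqr_pow2. exact S.
Qed.

(** * The infinitesimal generator *)

(** The continuity of a semigroup is given over compact sets in the sense of open
    covers; this makes it usable near every point. *)
Lemma compact_rect (x1 x2 y1 y2 : R) :
  compact_set (T := C_UniformSpace) (fun z : C => x1 <= Re z <= x2 /\ y1 <= Im z <= y2).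
Proof.
  intros I O Ho Hc.
  set (pt := fun t : Compactness.Tn 2 R => ((fst t, fst (snd t)) : C)).
  set (a := (x1, (y1, tt)) : Compactness.Tn 2 R).
  set (b := (x2, (y2, tt)) : Compactness.Tn 2 R).
  assert (H : forall t : Compactness.Tn 2 R, exists d : posreal, bounded_n 2 a b t ->
    exists i, forall w : C, Rabs (Re w - fst t) < d -> Rabs (Im w - fst (snd t)) < d -> O i w).
  { intros t. destruct (classic (bounded_n 2 a b t)) as [B|B].
    - destruct (Hc (pt t)) as [i Hi].
      { destruct t as [u [v []]]. simpl in B. unfold pt, Re, Im; simpl. tauto. }
      destruct (Ho i _ Hi) as [d Hd]. exists d. intros _. exists i.
      intros w H1 H2. apply Hd. split; assumption.
    - exists (mkposreal 1 Rlt_0_1). intros B'. contradiction. }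
  set (delta t := proj1_sig (constructive_indefinite_description _ (H t))).
  assert (Hdelta : forall t, bounded_n 2 a b t ->
    exists i, forall w : C, Rabs (Re w - fst t) < delta t ->
      Rabs (Im w - fst (snd t)) < delta t -> O i w).
  { intros t. exact (proj2_sig (constructive_indefinite_description _ (H t))). }
  apply NNPP. intros N. apply (compactness_list 2 a b delta). intros [l Hl]. apply N.
  assert (L : exists l', forall t, In t l -> bounded_n 2 a b t ->
    exists i, In i l' /\ forall w : C, Rabs (Re w - fst t) < delta t ->
      Rabs (Im w - fst (snd t)) < delta t -> O i w).
  { clear Hl N. induction l as [|t l [l' IH]].
    - exists nil. intros t [].
    - destruct (classic (bounded_n 2 a b t)) as [B|B].
      + destruct (Hdelta t B) as [i Hi]. exists (i :: l'). intros s [<-|Hs] Bs.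
        * exists i. split; [now left|exact Hi].
        * destruct (IH s Hs Bs) as [j [J1 J2]]. exists j. split; [now right|exact J2].
      + exists l'. intros s [<-|Hs] Bs; [contradiction|auto]. }
  destruct L as [l' Hl']. exists l'. intros z [Z1 Z2].
  destruct (Hl (Re z, (Im z, tt))) as [t [T1 [T2 T3]]]; [simpl; tauto|].
  destruct (Hl' t T1 T2) as [i [I1 I2]]. exists i. split; [exact I1|].
  destruct t as [u [v []]]. simpl in T3. apply I2; simpl; tauto.
Qed.

Definition time_filter (t : R) : (R -> Prop) -> Prop := within (Rle 0) (locally t).

Global Instance time_filter_filter (t : R) : Filter (time_filter t).
Proof. apply within_filter. apply _. Qed.

Lemma time_filter_spec (t : R) (P : R -> Prop) :
  time_filter t P <-> exists d, 0 < d /\ forall s, 0 <= s -> Rabs (s - t) < d -> P s.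
Proof.
  split.
  - intros [d H]. exists d. split; [apply cond_pos|]. intros s Hs Hd. now apply H.
  - intros [d [Hd H]]. exists (mkposreal d Hd). intros s Hs H0. now apply H.
Qed.

Lemma clim_time_displacement (t : R) :
  clim (time_filter t) (fun s => RtoC (s - t)) (RtoC 0).
Proof.
  apply clim_filter_le with (locally t); [apply filter_le_within|]. apply clim_displacement.
Qed.

Definition tdiff (g : R -> C) (t : R) (l : C) : Prop :=
  cdev (time_filter t) g (fun s => RtoC (s - t)) (g t) l.

Lemma within_locally'_le (t : R) : filter_le (within (Rle 0) (locally' t)) (time_filter t).
Proof.
  intros P HP. apply time_filter_spec in HP. destruct HP as [d [Hd HP]].
  exists (mkposreal d Hd). intros s Hs _ Hs0. now apply HP.
Qed.

Global Instance within_locally'_proper (t : R) : 0 <= t ->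
  ProperFilter (within (Rle 0) (locally' t)).
Proof.
  intros Ht. constructor.
  - intros P [d HP]. exists (t + d / 2). assert (D := cond_pos d). apply HP; try lra.
    change (Rabs (t + d / 2 - t) < d). replace (t + d / 2 - t) with (d / 2) by ring.
    rewrite Rabs_pos_eq; lra.
  - apply within_filter. apply _.
Qed.

Lemma tdiff_time_derivative (g : R -> C) (t : R) (l : C) :
  0 <= t -> tdiff g t l -> is_time_derivative g t l.
Proof.
  intros Ht H. assert (PF := within_locally'_proper t Ht).
  unfold is_time_derivative. apply (proj1 (clim_locally _ _ _)).
  apply (cdev_quot (within (Rle 0) (locally' t)) g (fun s => RtoC (s - t)) (g t) l).
  - exists (mkposreal 1 Rlt_0_1). intros s _ Hs _. apply RtoC_neq_0.
    intros E. apply Hs. lra.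
  - intros e He. apply within_locally'_le. now apply H.
Qed.

Lemma time_derivative_unique (g : R -> C) (t : R) (l m : C) :
  0 <= t -> is_time_derivative g t l -> is_time_derivative g t m -> l = m.
Proof.
  intros Ht Hl Hm. assert (PF := within_locally'_proper t Ht).
  unfold is_time_derivative in *.
  apply (proj2 (clim_locally _ _ _)) in Hl. apply (proj2 (clim_locally _ _ _)) in Hm.
  exact (clim_unique _ _ _ _ Hl Hm).
Qed.

Lemma tdiff_unique (g : R -> C) (t : R) (l m : C) :
  0 <= t -> tdiff g t l -> tdiff g t m -> l = m.
Proof.
  intros Ht Hl Hm. apply (time_derivative_unique g t); auto; now apply tdiff_time_derivative.
Qed.

(** Since [F' <> 0], the increment of [g] is dominated by that of [F o g], hence is
    [O(u)]; only then can the expansion of [F] be inverted.  This recovers the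
    derivative of an orbit from that of its averages. *)
Lemma cdev_cancel {T : Type} (Fil : (T -> Prop) -> Prop) {FF : Filter Fil}
  (F : C -> C) (g u : T -> C) (w l L : C) :
  cdiff F w L -> L <> RtoC 0 -> clim Fil g w ->
  cdev Fil (fun x => F (g x)) u (F w) l -> cdev Fil g u w (l / L)%C.
Proof.
  intros HF HL Hg H e He.
  assert (PL : 0 < Cmod L) by now apply Cmod_gt_0.
  set (A := 2 / Cmod L * (Cmod l + 1)).
  assert (Pl := Cmod_ge_0 l).
  assert (HA : 0 < A).
  { unfold A. apply Rmult_lt_0_compat; [apply Rdiv_lt_0_compat; lra|lra]. }
  set (e1 := Rmin (Cmod L / 2) (e * Cmod L / (2 * A))).
  assert (He1 : 0 < e1).
  { apply Rmin_pos; [lra|]. apply Rdiv_lt_0_compat; [|lra]. now apply Rmult_lt_0_compat. }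
  assert (E1 : e1 <= Cmod L / 2) by apply Rmin_l.
  assert (E2 : e1 <= e * Cmod L / (2 * A)) by apply Rmin_r.
  destruct (HF e1 He1) as [d [Hd K]].
  assert (He2 : 0 < e * Cmod L / 2) by (assert (0 < e * Cmod L) by (now apply Rmult_lt_0_compat); lra).
  generalize (filter_and _ _ (Hg d Hd) (filter_and _ _ (cdev_bound _ _ _ _ _ H) (H _ He2))).
  apply filter_imp. intros x [H1 [H2 H3]]. specialize (K _ H1).
  set (q := (g x - w)%C) in *. set (D := (F (g x) - F w)%C) in *.
  assert (Q1 : Cmod q <= A * Cmod (u x)).
  { assert (T1 : Cmod L * Cmod q <= Cmod D + e1 * Cmod q).
    { rewrite <- Cmod_mult. replace (L * q)%C with (D - (D - L * q))%C by ring.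
      eapply Rle_trans; [apply Cmod_sub_le|]. lra. }
    assert (P := Cmod_ge_0 q).
    assert (T2 : Cmod L / 2 * Cmod q <= Cmod D).
    { assert (e1 * Cmod q <= Cmod L / 2 * Cmod q) by (apply Rmult_le_compat_r; lra). lra. }
    apply Rmult_le_reg_l with (Cmod L / 2); [lra|]. eapply Rle_trans; [exact T2|].
    eapply Rle_trans; [exact H2|]. right. unfold A. field. lra. }
  replace (q - l / L * u x)%C with (((D - l * u x) - (D - L * q)) / L)%C by (field; exact HL).
  rewrite Cmod_div by exact HL.
  apply Rmult_le_reg_r with (Cmod L); [exact PL|].
  unfold Rdiv at 1. rewrite Rmult_assoc, Rinv_l, Rmult_1_r by lra.
  eapply Rle_trans; [apply Cmod_sub_le|].
  assert (T3 : e1 * Cmod q <= e * Cmod L / (2 * A) * (A * Cmod (u x))).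
  { apply Rmult_le_compat; try lra. apply Cmod_ge_0. }
  replace (e * Cmod L / (2 * A) * (A * Cmod (u x))) with (e * Cmod L / 2 * Cmod (u x)) in T3
    by (field; lra).
  lra.
Qed.

Section Semigroup.
Variable phi : R -> C -> C.
Hypothesis sg : semigroup phi.

Lemma sg_self_map (t : R) : 0 <= t -> self_map (phi t).
Proof.
  intros Ht. split.
  - intros z Hz. apply (proj2 (disc_inball _)) in Hz.
    exists (C_derive (phi t) z).
    exact (proj1 (holomorphic_cdiff disc _) (hom_holomorphic _ _ _ sg t Ht) z Hz).
  - intros z Hz. exact (hom_maps _ _ _ sg t z Ht Hz).
Qed.

Lemma sg_ball (t : R) (z : C) (r : R) : 0 <= t -> r <= 1 - Cmod z ->
  hol_ball (phi t) z r.
Proof.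
  intros Ht Hr w Hw. apply (proj1 (sg_self_map t Ht)). apply (proj1 (disc_inball _)).
  unfold disc. unfold inball in Hw. assert (K := Cmod_sub_ge w z). lra.
Qed.

Lemma disc_ball (z w : C) (r : R) : r <= 1 - Cmod z -> inball z r w -> disc w.
Proof.
  intros Hr Hw. unfold disc. unfold inball in Hw. assert (K := Cmod_sub_ge w z). lra.
Qed.

Lemma sg_cont_unif (t0 : R) (z0 : C) (e : R) : 0 <= t0 -> disc z0 -> 0 < e ->
  exists d, 0 < d /\ forall t z, 0 <= t -> Rabs (t - t0) < d ->
    Cmod (z - z0) <= (1 - Cmod z0) / 4 -> Cmod (phi t z - phi t0 z) < e.
Proof.
  intros Ht0 Hz0 He. unfold disc in Hz0. set (h := (1 - Cmod z0) / 4).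
  set (K := fun z : C => Re z0 - h <= Re z <= Re z0 + h /\ Im z0 - h <= Im z <= Im z0 + h).
  assert (HK : forall z, K z -> disc z).
  { intros z [K1 K2]. apply (disc_ball z0 z (1 - Cmod z0)); [lra|]. unfold inball.
    eapply Rle_lt_trans; [apply Cmod_le_Re_Im|].
    change (Rabs (Re z - Re z0) + Rabs (Im z - Im z0) < 1 - Cmod z0).
    assert (Rabs (Re z - Re z0) <= h) by (apply Rabs_le; lra).
    assert (Rabs (Im z - Im z0) <= h) by (apply Rabs_le; lra). unfold h in *. lra. }
  assert (H := hom_continuous _ _ _ sg t0 K Ht0 (compact_rect _ _ _ _) HK (mkposreal e He)).
  apply (time_filter_spec t0) in H. destruct H as [d [Hd H]]. exists d. split; [exact Hd|].
  intros t z Ht Htd Hz. apply H; auto.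
  assert (A := Re_le_Cmod (z - z0)). assert (B := Im_le_Cmod (z - z0)).
  change (Re (z - z0)%C) with (Re z - Re z0) in A. change (Im (z - z0)%C) with (Im z - Im z0) in B.
  apply Rabs_le_between in A. apply Rabs_le_between in B. fold h in Hz. split; lra.
Qed.

(** Extending the orbits by their starting points to negative times makes them
    continuous on the whole line. *)
Definition orbit (z : C) (s : R) : C := phi (Rmax 0 s) z.

Lemma Rmax_0_dist (s t : R) : Rabs (Rmax 0 s - Rmax 0 t) <= Rabs (s - t).
Proof.
  unfold Rmax. destruct (Rle_dec 0 s), (Rle_dec 0 t); apply Rabs_le;
  split; unfold Rabs; destruct Rcase_abs; lra.
Qed.

Lemma rcont_orbit (z : C) (s : R) : disc z -> rcont (orbit z) s.
Proof.
  intros Hz e He.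
  destruct (sg_cont_unif (Rmax 0 s) z e (Rmax_l _ _) Hz He) as [d [Hd H]].
  exists (mkposreal d Hd). intros t Ht. change (Rabs (t - s) < d) in Ht.
  unfold orbit. apply H.
  - apply Rmax_l.
  - eapply Rle_lt_trans; [apply Rmax_0_dist|exact Ht].
  - rewrite Cmod_sub_self. unfold disc in Hz. lra.
Qed.

Lemma cdiff_phi (t : R) (z : C) : 0 <= t -> disc z -> cdiff (phi t) z (C_derive (phi t) z).
Proof.
  intros Ht Hz. apply (hol_ball_C_derive _ (RtoC 0) 1); [now apply sg_self_map|].
  now apply (proj1 (disc_inball _)).
Qed.

Lemma hol_ball_sub (f g : C -> C) (z : C) (r : R) :
  hol_ball f z r -> hol_ball g z r -> hol_ball (fun w => f w - g w)%C z r.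
Proof.
  intros Hf Hg w Hw. destruct (Hf w Hw) as [l Hl]. destruct (Hg w Hw) as [m Hm].
  exists (l - m)%C. now apply cdiff_minus.
Qed.

(** By Cauchy's estimate, continuity of [phi] in time passes to its space
    derivative. *)
Lemma rcont_derive_orbit (z : C) (s : R) : disc z ->
  rcont (fun s => C_derive (phi (Rmax 0 s)) z) s.
Proof.
  intros Hz e He. unfold disc in Hz. set (r := (1 - Cmod z) / 4).
  assert (Hr : 0 < r) by (unfold r; lra).
  assert (Her : 0 < e / 2 * r) by (apply Rmult_lt_0_compat; lra).
  destruct (sg_cont_unif (Rmax 0 s) z _ (Rmax_l _ _) Hz Her) as [d [Hd H]].
  exists (mkposreal d Hd). intros t Ht. change (Rabs (t - s) < d) in Ht.
  assert (P1 := Rmax_l 0 t). assert (P2 := Rmax_l 0 s).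
  set (g := fun w => (phi (Rmax 0 t) w - phi (Rmax 0 s) w)%C).
  assert (Hg : hol_ball g z r).
  { apply hol_ball_sub; apply sg_ball; auto; unfold r; lra. }
  assert (D : C_derive g z = (C_derive (phi (Rmax 0 t)) z - C_derive (phi (Rmax 0 s)) z)%C).
  { apply cdiff_C_derive. apply (cdiff_minus (phi (Rmax 0 t)) (phi (Rmax 0 s)));
    now apply cdiff_phi. }
  rewrite <- D. apply Rle_lt_trans with (e / 2 * r / r).
  - apply (cauchy_estimate g z r); auto. intros w Hw. left. apply H.
    + exact P1.
    + eapply Rle_lt_trans; [apply Rmax_0_dist|exact Ht].
    + left. exact Hw.
  - replace (e / 2 * r / r) with (e / 2) by (field; lra). lra.
Qed.

Definition avg (d : R) (z : C) : C := CInt (orbit z) 0 d.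

Lemma avg_diff (d : R) (z : C) : 0 <= d -> disc z ->
  cdiff (avg d) z (CInt (fun s => C_derive (phi (Rmax 0 s)) z) 0 d).
Proof.
  intros Hd Hz. assert (Hz' := Hz). unfold disc in Hz'.
  set (r := 1 - Cmod z). assert (Hr : 0 < r) by (unfold r; lra).
  assert (Hb : forall v, Cmod (v - z) < r / 4 -> disc v).
  { intros v Hv. apply (disc_ball z v r); [unfold r; lra|]. unfold inball. lra. }
  apply (CInt_param_diff orbit (fun s => C_derive (phi (Rmax 0 s)) z) 0 d z
    (8 * 1 / r ^ 2) (r / 4)); try lra.
  - intros v Hv t _. apply rcont_orbit. now apply Hb.
  - intros t _. now apply rcont_derive_orbit.
  - intros v t Hv Ht. unfold orbit. apply taylor2_estimate; try lra.
    + apply sg_ball; [apply Rmax_l|unfold r; lra].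
    + intros w Hw. left. apply (proj2 (sg_self_map _ (Rmax_l 0 t))).
      apply (disc_ball z w r); [unfold r; lra|exact Hw].
Qed.

Lemma avg_hol (d : R) : 0 <= d -> hol_ball (avg d) (RtoC 0) 1.
Proof.
  intros Hd z Hz. eexists. apply avg_diff; [exact Hd|]. now apply (proj2 (disc_inball _)).
Qed.

(** For small [s] the derivative of [phi s] is close to that of the identity, so the
    derivative of the average is close to [d]. *)
Lemma avg_derive_neq_0 (z : C) : disc z -> exists d, 0 < d /\ C_derive (avg d) z <> RtoC 0.
Proof.
  intros Hz.
  destruct (rcont_derive_orbit z 0 Hz (1 / 2) ltac:(lra)) as [d K].
  assert (Pd := cond_pos d).
  exists (d / 2). split; [lra|].
  rewrite (cdiff_C_derive _ _ _ (avg_diff (d / 2) z ltac:(lra) Hz)).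
  assert (E0 : C_derive (phi (Rmax 0 0)) z = RtoC 1).
  { rewrite Rmax_left by lra. apply cdiff_C_derive.
    apply cdiff_ext with (fun w => w); [|apply cdiff_id].
    assert (Hzb := proj1 (disc_inball z) Hz).
    generalize (inball_open _ _ _ Hzb). apply filter_imp. intros w Hw. symmetry.
    apply (hom_zero _ _ _ sg). now apply (proj2 (disc_inball w)). }
  assert (B : Cmod (CInt (fun s => C_derive (phi (Rmax 0 s)) z - RtoC 1)%C 0 (d / 2)) <=
    1 / 2 * (d / 2 - 0)).
  { apply CInt_bound_le; [lra| |].
    - apply contI_minus; intros t _; [now apply rcont_derive_orbit|apply rcont_const].
    - intros t Ht. rewrite <- E0. left. apply K. change (Rabs (t - 0) < d).
      rewrite Rminus_0_r, Rabs_pos_eq; lra. }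
  rewrite CInt_minus in B by (intros t _; first [apply rcont_const|now apply rcont_derive_orbit]).
  rewrite CInt_const in B. intros E. rewrite E in B.
  replace (0 - RtoC (d / 2 - 0) * 1)%C with (- RtoC (d / 2 - 0))%C in B by ring.
  rewrite Cmod_opp, Cmod_R, Rabs_pos_eq in B by lra. lra.
Qed.

Lemma avg_orbit (d t : R) (z : C) : 0 <= d -> 0 <= t -> disc z ->
  avg d (phi t z) = (CInt (orbit z) 0 (t + d) - CInt (orbit z) 0 t)%C.
Proof.
  intros Hd Ht Hz.
  assert (Hc : forall s, rcont (orbit z) s) by (intros s; now apply rcont_orbit).
  unfold avg. rewrite (CInt_ext _ (fun s => orbit z (s + t))).
  - rewrite (CInt_shift (orbit z)) by exact Hc. rewrite Rplus_0_l, (Rplus_comm d).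
    rewrite <- (CInt_Chasles (orbit z) 0 t (t + d)) by (intros s _; apply Hc). ring.
  - intros s Hs. rewrite Rmin_left, Rmax_right in Hs by lra.
    unfold orbit. rewrite !Rmax_right by lra.
    symmetry. now apply (hom_add _ _ _ sg); try lra.
Qed.

(** By the semigroup law [avg d] along an orbit is the integral of that orbit over
    [t, t + d], which is differentiable in [t] by the fundamental theorem; where
    [avg d] is locally invertible the orbit itself is differentiable. *)
Lemma tdiff_phi_formula (d t : R) (z : C) : 0 <= d -> 0 <= t -> disc z ->
  C_derive (avg d) (phi t z) <> RtoC 0 ->
  tdiff (fun s => phi s z) t
    ((phi d (phi t z) - phi t z) / C_derive (avg d) (phi t z))%C.
Proof.
  intros Hd Ht Hz HN. assert (Hw : disc (phi t z)) by now apply sg_self_map.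
  assert (Hc : forall s, rcont (orbit z) s) by (intros s; now apply rcont_orbit).
  unfold tdiff. apply (cdev_cancel (time_filter t) (avg d)); auto.
  - apply (hol_ball_C_derive _ (RtoC 0) 1); [now apply avg_hol|].
    now apply (proj1 (disc_inball _)).
  - apply clim_ext with (orbit z); [apply _| |].
    + apply time_filter_spec. exists 1. split; [lra|]. intros s Hs _.
      unfold orbit. now rewrite Rmax_right.
    + apply clim_filter_le with (locally t); [apply filter_le_within|].
      assert (H := Hc t). unfold rcont in H. unfold orbit at 2 in H.
      now rewrite Rmax_right in H by lra.
  - apply cdev_ext with (fun s => CInt (orbit z) 0 (s + d) - CInt (orbit z) 0 s)%C; [apply _| |].
    + apply time_filter_spec. exists 1. split; [lra|]. intros s Hs _.
      symmetry. now apply avg_orbit.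
    + rewrite (avg_orbit d t z) by assumption.
      assert (E : phi d (phi t z) = orbit z (t + d)).
      { unfold orbit. rewrite Rmax_right by lra. rewrite Rplus_comm.
        symmetry. now apply (hom_add _ _ _ sg). }
      assert (E' : phi t z = orbit z t) by (unfold orbit; now rewrite Rmax_right by lra).
      apply cdev_eq with (CInt (orbit z) 0 (t + d) - CInt (orbit z) 0 t)%C
        (orbit z (t + d) - orbit z t)%C; [reflexivity|now rewrite E, <- E'|].
      apply cdev_minus; [apply _| |].
      * intros e He. assert (H := CInt_derive (orbit z) 0 (t + d) Hc e He).
        destruct H as [h Hh]. exists h. intros s Hs _.
        replace (s - t) with ((s + d) - (t + d)) by ring. apply Hh.
        change (Rabs (s + d - (t + d)) < h). replace (s + d - (t + d)) with (s - t) by ring.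
        exact Hs.
      * intros e He. apply filter_le_within. exact (CInt_derive (orbit z) 0 t Hc e He).
Qed.

(** The formula [(phi d z - z) / (avg d)' z], valid for any [d] where the
    denominator does not vanish, is at once a derivative in time and a
    holomorphic function of [z]. *)
Theorem generator_exists : exists G : C -> C,
  hol_ball G (RtoC 0) 1 /\
  forall t z, 0 <= t -> disc z -> tdiff (fun s => phi s z) t (G (phi t z)).
Proof.
  assert (P0 : forall z, disc z -> phi 0 z = z) by (intros z Hz; now apply (hom_zero _ _ _ sg)).
  assert (Ex : forall z, exists l, disc z -> tdiff (fun s => phi s z) 0 l).
  { intros z. destruct (classic (disc z)) as [Hz|Hz].
    - destruct (avg_derive_neq_0 z Hz) as [d [Hd HN]].
      eexists. intros _. apply (tdiff_phi_formula d 0 z); try lra; auto. now rewrite P0.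
    - exists (RtoC 0). contradiction. }
  destruct (choice _ Ex) as [G HG].
  assert (GE : forall d z, 0 <= d -> disc z -> C_derive (avg d) z <> RtoC 0 ->
    G z = ((phi d z - z) / C_derive (avg d) z)%C).
  { intros d z Hd Hz HN. apply (tdiff_unique (fun s => phi s z) 0); [lra|now apply HG|].
    assert (H := tdiff_phi_formula d 0 z Hd (Rle_refl 0) Hz). rewrite P0 in H by exact Hz.
    now apply H. }
  exists G. split.
  - intros z Hz. assert (Hzd := proj2 (disc_inball z) Hz).
    destruct (avg_derive_neq_0 z Hzd) as [d [Hd HN]].
    assert (HA := hol_ball_derive _ _ _ (avg_hol d (Rlt_le _ _ Hd))).
    destruct (HA z Hz) as [l Hl].
    eexists. apply cdiff_ext with (fun w => (phi d w - w) / C_derive (avg d) w)%C.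
    + assert (Hnear : Cnear z (fun w => C_derive (avg d) w <> RtoC 0)).
      { assert (PN : 0 < Cmod (C_derive (avg d) z)) by now apply Cmod_gt_0.
        generalize (cdiff_cont _ _ _ Hl _ PN). apply filter_imp. intros w Hw E.
        rewrite E, Cmod_sub_sym in Hw. replace (C_derive (avg d) z - 0)%C with
          (C_derive (avg d) z) in Hw by ring. lra. }
      generalize (filter_and _ _ Hnear (inball_open _ _ _ Hz)). apply filter_imp.
      intros w [W1 W2]. symmetry. apply GE; [lra| |exact W1]. now apply (proj2 (disc_inball w)).
    + apply (cdiff_div (fun w => phi d w - w)%C (C_derive (avg d))); [exact HN| |exact Hl].
      apply (cdiff_minus (phi d) (fun w => w)); [apply cdiff_phi; [lra|exact Hzd]|apply cdiff_id].
  - intros t z Ht Hz. assert (Hw : disc (phi t z)) by now apply sg_self_map.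
    destruct (avg_derive_neq_0 _ Hw) as [d [Hd HN]].
    rewrite (GE d) by (auto; lra). apply tdiff_phi_formula; auto; lra.
Qed.

End Semigroup.

(** * Taylor expansion along flows *)

Notation Csum := (sum_n (G := C_AbelianMonoid)).

(* [ring] needs the equality to be typed in [C] syntactically *)
Ltac cring := match goal with |- @eq _ ?a ?b => change (@eq C a b); ring end.

Lemma Csum_0 (u : nat -> C) : Csum u 0 = u O.
Proof. apply sum_O. Qed.

Lemma Csum_S (u : nat -> C) (n : nat) : Csum u (S n) = (Csum u n + u (S n))%C.
Proof. exact (sum_Sn u n). Qed.

Lemma Csum_ext (u v : nat -> C) (n : nat) : (forall k, u k = v k) -> Csum u n = Csum v n.
Proof. intros H. apply sum_n_ext. exact H. Qed.

Lemma Csum_minus (u v : nat -> C) (n : nat) :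
  Csum (fun k => u k - v k)%C n = (Csum u n - Csum v n)%C.
Proof.
  induction n.
  - now rewrite !Csum_0.
  - rewrite !Csum_S, IHn. cring.
Qed.

Lemma Csum_scal (c : C) (u : nat -> C) (n : nat) :
  Csum (fun k => c * u k)%C n = (c * Csum u n)%C.
Proof.
  induction n.
  - now rewrite !Csum_0.
  - rewrite !Csum_S, IHn. cring.
Qed.

Lemma geometric_sum_le (u : nat -> R) (K : R) (n : nat) :
  0 <= K -> (forall k, u k <= K * (1 / 2) ^ k) -> sum_n u n <= 2 * K.
Proof.
  intros HK H.
  assert (E : sum_n u n <= 2 * K - K * (1 / 2) ^ n).
  { induction n.
    - rewrite sum_O. specialize (H O). simpl in *. lra.
    - rewrite sum_Sn. change (sum_n u n + u (S n) <= 2 * K - K * (1 / 2) ^ S n).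
      specialize (H (S n)). simpl in *. lra. }
  assert (0 <= K * (1 / 2) ^ n) by (apply Rmult_le_pos; [exact HK|apply pow_le; lra]). lra.
Qed.

Lemma Cmod_Csum (u : nat -> C) (n : nat) : Cmod (Csum u n) <= sum_n (fun k => Cmod (u k)) n.
Proof.
  induction n.
  - rewrite Csum_0, sum_O. lra.
  - rewrite Csum_S, sum_Sn. eapply Rle_trans; [apply Cmod_triangle|].
    apply Rplus_le_compat_r. exact IHn.
Qed.

Lemma geometric_Csum_le (u : nat -> C) (K : R) (n : nat) :
  0 <= K -> (forall k, Cmod (u k) <= K * (1 / 2) ^ k) -> Cmod (Csum u n) <= 2 * K.
Proof.
  intros HK H. eapply Rle_trans; [apply Cmod_Csum|]. now apply geometric_sum_le.
Qed.

(** Projecting on the direction of [w b - w 0] reduces the curve to a real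
    function, to which the mean value theorem applies. *)
Lemma mean_value_pow (w w' : R -> C) (b K : R) (m : nat) :
  0 <= b -> (forall s, 0 <= s <= b -> rcont w s) ->
  (forall s, 0 < s < b -> rdiff w s (w' s)) ->
  (forall s, 0 < s < b -> Cmod (w' s) <= K * s ^ m) ->
  Cmod (w b - w 0) <= K * b ^ S m / INR (S m).
Proof.
  intros Hb Hc Hd HK.
  assert (Hm : 0 < INR (S m)) by (apply lt_0_INR; lia).
  destruct Hb as [Hb|<-].
  2:{ rewrite Cmod_sub_self. simpl. right. field. exact (Rgt_not_eq _ _ Hm). }
  set (v := (w b - w 0)%C).
  destruct (Req_dec (Cmod v) 0) as [E0|E0].
  { rewrite E0. assert (0 <= K).
    { assert (P := HK (b / 2) ltac:(lra)). assert (Q := Cmod_ge_0 (w' (b / 2))).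
      assert (0 < (b / 2) ^ m) by (apply pow_lt; lra). nra. }
    apply Rmult_le_pos; [apply Rmult_le_pos; [assumption|apply pow_le; lra]|].
    left. now apply Rinv_0_lt_compat. }
  assert (Pv : 0 < Cmod v) by (assert (H := Cmod_ge_0 v); lra).
  set (f := fun s => Re (Cconj v * w s)%C - Cmod v * (K * s ^ S m / INR (S m))).
  set (df := fun s => Re (Cconj v * w' s)%C - Cmod v * (K * s ^ m)).
  assert (Df : forall s, 0 < s < b -> is_derive f s (df s)).
  { intros s Hs. unfold f, df.
    apply (is_derive_minus (fun s => Re (Cconj v * w s)%C)
      (fun s => Cmod v * (K * s ^ S m / INR (S m)))).
    - apply (rdiff_Re (fun s => (Cconj v * w s)%C)).
      apply (cdev_scal (locally s)). now apply Hd.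
    - auto_derive; [auto|]. simpl pred. field. exact (Rgt_not_eq _ _ Hm). }
  assert (Ef : f b - f 0 = Cmod v * Cmod v - Cmod v * (K * b ^ S m / INR (S m))).
  { unfold f. replace (Cmod v * Cmod v) with (Cmod v ^ 2) by ring. rewrite Cmod_sqr.
    replace (0 ^ S m) with 0 by (simpl; ring).
    replace (Re (Cconj v * w b)%C - Cmod v * (K * b ^ S m / INR (S m)) -
      (Re (Cconj v * w 0)%C - Cmod v * (K * 0 / INR (S m)))) with
      (Re (Cconj v * v)%C - Cmod v * (K * b ^ S m / INR (S m)))
      by (unfold v at 2 4; unfold Re; simpl; field; exact (Rgt_not_eq _ _ Hm)).
    unfold Re, Im. simpl. ring. }
  assert (Dc : forall c, 0 < c < b -> df c <= 0).
  { intros s Hs. unfold df. specialize (HK s Hs).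
    assert (R1 := Re_le_Cmod (Cconj v * w' s)%C). rewrite Cmod_mult, Cmod_conj in R1.
    assert (R2 := Rle_abs (Re (Cconj v * w' s)%C)).
    assert (Cmod v * Cmod (w' s) <= Cmod v * (K * s ^ m)) by (apply Rmult_le_compat_l; lra).
    lra. }
  assert (Cf : forall s, 0 <= s <= b -> continuity_pt f s).
  { intros s Hs. apply continuity_pt_filterlim.
    apply (continuous_minus (fun s => Re (Cconj v * w s)%C)
      (fun s => Cmod v * (K * s ^ S m / INR (S m)))).
    - apply (rcont_Re (fun s => (Cconj v * w s)%C)).
      apply rcont_mult; [apply rcont_const|now apply Hc].
    - apply (ex_derive_continuous (K := R_AbsRing) (V := R_NormedModule)).
      auto_derive. auto. }
  assert (pr : forall c, 0 < c < b -> derivable_pt f c).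
  { intros c Hc'. exists (df c). apply is_derive_Reals. now apply Df. }
  destruct (MVT f id 0 b pr (fun c _ => derivable_pt_id c) Hb Cf) as [c [Hc' E]].
  { intros c _. apply derivable_continuous_pt, derivable_pt_id. }
  assert (Dd : derive_pt f c (pr c Hc') = df c).
  { apply derive_pt_eq_0, is_derive_Reals. now apply Df. }
  rewrite Dd, derive_pt_id in E. unfold id in E.
  assert (L : f b - f 0 <= 0).
  { specialize (Dc c Hc'). nra. }
  rewrite Ef in L. apply Rmult_le_reg_l with (Cmod v); [exact Pv|]. lra.
Qed.

Definition taylor_poly (c : nat -> C) (N : nat) (x : R) : C :=
  Csum (fun n => RtoC (x ^ n / INR (fact n)) * c n)%C N.

Lemma taylor_poly_0 (c : nat -> C) (N : nat) : taylor_poly c N 0 = c O.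
Proof.
  unfold taylor_poly. induction N.
  - rewrite Csum_0. simpl. replace (1 / 1) with 1 by field. ring.
  - rewrite Csum_S, IHN. simpl pow. replace (0 * 0 ^ N / INR (fact (S N))) with 0.
    + ring.
    + unfold Rdiv. ring.
Qed.

Lemma rdiff_taylor_poly (c : nat -> C) (N : nat) (x : R) :
  rdiff (taylor_poly c (S N)) x (taylor_poly (fun n => c (S n)) N x).
Proof.
  assert (Mono : forall n y, rdiff (fun x => RtoC (x ^ S n / INR (fact (S n))) * c (S n))%C y
    (RtoC (y ^ n / INR (fact n)) * c (S n))%C).
  { intros n y.
    assert (Hn : INR (fact n) <> 0) by apply INR_fact_neq_0.
    assert (HS : INR (S n) <> 0) by (apply not_0_INR; lia).
    assert (D : rdiff (fun x => RtoC (x ^ S n / INR (fact (S n)))) y (RtoC (y ^ n / INR (fact n)))).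
    { apply (rdiff_pair (fun x => x ^ S n / INR (fact (S n))) (fun _ => 0)).
      - assert (A : forall k, k <> 0 -> is_derive (fun x => x ^ S n / k) y (INR (S n) * y ^ n / k)).
        { intros k Hk. auto_derive; [auto|]. simpl pred. change (match n with O => 1 | S _ => INR n + 1 end) with (INR (S n)). field. exact Hk. }
        replace (y ^ n / INR (fact n)) with (INR (S n) * y ^ n / INR (fact (S n))).
        + apply A, INR_fact_neq_0.
        + rewrite fact_simpl, mult_INR. field. split; assumption.
      - auto_derive; auto. }
    assert (E := cdev_scal (locally y) (c (S n)) _ _ _ _ D).
    apply (cdev_ext (locally y) (fun x => c (S n) * RtoC (x ^ S n / INR (fact (S n))))%C).
    - apply filter_forall. intros z. ring.
    - apply (cdev_eq _ _ _ _ _ _ _ (Cmult_comm _ _) (Cmult_comm _ _) E). }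
  induction N.
  - unfold taylor_poly.
    apply (cdev_ext (locally x) (fun x => RtoC (x ^ 0 / INR (fact 0)) * c O +
      RtoC (x ^ 1 / INR (fact 1)) * c 1%nat)%C).
    { apply filter_forall. intros y. now rewrite Csum_S, Csum_0. }
    rewrite Csum_S, !Csum_0.
    apply (cdev_eq (locally x) _ _ _ _ (RtoC 0 + RtoC (x ^ 0 / INR (fact 0)) * c 1%nat)%C _ eq_refl);
      [ring|].
    apply cdev_plus; [apply _| |apply Mono].
    exact (cdev_const (locally x) _ (RtoC (1 / INR (fact 0)) * c O)%C).
  - unfold taylor_poly in *.
    apply (cdev_ext (locally x) (fun x =>
      Csum (fun n => RtoC (x ^ n / INR (fact n)) * c n)%C (S N) +
      RtoC (x ^ S (S N) / INR (fact (S (S N)))) * c (S (S N)))%C).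
    { apply filter_forall. intros y. now rewrite (Csum_S _ (S N)). }
    apply (cdev_eq (locally x) _ _ _ _ _ _ (eq_sym (Csum_S _ (S N))) (eq_sym (Csum_S _ N))).
    apply cdev_plus; [apply _|exact IHN|apply Mono].
Qed.

(** The derivative of [u O] minus its Taylor polynomial is the same difference one
    order lower for the shifted sequence of derivatives. *)
Lemma taylor_forward (N : nat) : forall (u : nat -> R -> C) (b B : R),
  0 <= b -> (forall n s, 0 <= s <= b -> rcont (u n) s) ->
  (forall n s, 0 < s < b -> rdiff (u n) s (u (S n) s)) ->
  (forall s, 0 <= s <= b -> Cmod (u (S N) s) <= B) ->
  Cmod (u O b - taylor_poly (fun n => u n 0) N b) <= B * b ^ S N / INR (fact (S N)).
Proof.
  induction N; intros u b B Hb Hc Hd HB.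
  - unfold taylor_poly. rewrite Csum_0.
    replace (RtoC (b ^ 0 / INR (fact 0)) * u O 0)%C with (u O 0)
      by (simpl; replace (1 / 1) with 1 by field; ring).
    replace (INR (fact 1)) with (INR 1) by reflexivity.
    apply (mean_value_pow (u O) (u 1%nat)); auto.
    intros s Hs. rewrite pow_O, Rmult_1_r. apply HB. lra.
  - set (w := fun x => (u O x - taylor_poly (fun n => u n 0) (S N) x)%C).
    set (w' := fun x => (u 1%nat x - taylor_poly (fun n => u (S n) 0) N x)%C).
    assert (Dw : forall s, 0 < s < b -> rdiff w s (w' s)).
    { intros s Hs. apply (cdev_minus (locally s)); [now apply Hd|].
      apply (rdiff_taylor_poly (fun n => u n 0)). }
    assert (K := mean_value_pow w w' b (B / INR (fact (S N))) (S N) Hb).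
    assert (W0 : w 0 = RtoC 0) by (unfold w; rewrite taylor_poly_0; ring).
    rewrite W0 in K. replace (w b - 0)%C with (w b) in K by ring.
    replace (B * b ^ S (S N) / INR (fact (S (S N)))) with
      (B / INR (fact (S N)) * b ^ S (S N) / INR (S (S N))).
    2:{ rewrite (fact_simpl (S N)), mult_INR. field.
        split; [apply INR_fact_neq_0|apply not_0_INR; lia]. }
    apply K; [|exact Dw|].
    + intros s Hs. apply rcont_minus; [now apply Hc|].
      exact (rdiff_rcont _ _ _ (rdiff_taylor_poly _ N s)).
    + intros s Hs. unfold w'.
      replace (B / INR (fact (S N)) * s ^ S N) with (B * s ^ S N / INR (fact (S N)))
        by (field; apply INR_fact_neq_0).
      apply (IHN (fun n => u (S n))); try lra.
      * intros n x Hx. apply Hc. lra.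
      * intros n x Hx. apply Hd. lra.
      * intros x Hx. apply HB. lra.
Qed.

Lemma rdiff_affine (g : R -> C) (t0 sg s : R) (l : C) :
  sg = 1 \/ sg = -1 -> rdiff g (t0 + sg * s) l ->
  rdiff (fun x => g (t0 + sg * x)) s (RtoC sg * l)%C.
Proof.
  intros Hsg H e He. destruct (H e He) as [d Hd]. exists d. intros x Hx.
  change (Rabs (x - s) < d) in Hx.
  assert (E : Rabs (t0 + sg * x - (t0 + sg * s)) = Rabs (x - s)).
  { replace (t0 + sg * x - (t0 + sg * s)) with (sg * (x - s)) by ring.
    rewrite Rabs_mult. destruct Hsg as [-> | ->].
    - rewrite Rabs_R1. ring.
    - rewrite Rabs_left by lra. ring. }
  assert (K := Hd (t0 + sg * x)).
  assert (B : ball (t0 + sg * s) d (t0 + sg * x))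
    by (change (Rabs (t0 + sg * x - (t0 + sg * s)) < d); now rewrite E).
  specialize (K B). rewrite (Cmod_R (t0 + sg * x - (t0 + sg * s))), E in K.
  rewrite (Cmod_R (x - s)).
  replace (RtoC sg * l * RtoC (x - s))%C with (l * RtoC (t0 + sg * x - (t0 + sg * s)))%C.
  - exact K.
  - replace (t0 + sg * x - (t0 + sg * s)) with (sg * (x - s)) by ring. rewrite RtoC_mult. ring.
Qed.

Lemma rcont_affine (g : R -> C) (t0 sg s : R) :
  sg = 1 \/ sg = -1 -> rcont g (t0 + sg * s) -> rcont (fun x => g (t0 + sg * x)) s.
Proof.
  intros Hsg H e He. destruct (H e He) as [d Hd]. exists d. intros x Hx. apply Hd.
  change (Rabs (x - s) < d) in Hx. change (Rabs (t0 + sg * x - (t0 + sg * s)) < d).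
  replace (t0 + sg * x - (t0 + sg * s)) with (sg * (x - s)) by ring.
  rewrite Rabs_mult. destruct Hsg as [-> | ->].
  - rewrite Rabs_R1. lra.
  - rewrite (Rabs_left (-1)) by lra. lra.
Qed.

Lemma taylor_two_sided (N : nat) (u : nat -> R -> C) (t0 t B : R) :
  (forall n s, Rmin t0 t <= s <= Rmax t0 t -> rcont (u n) s) ->
  (forall n s, Rmin t0 t < s < Rmax t0 t -> rdiff (u n) s (u (S n) s)) ->
  (forall s, Rmin t0 t <= s <= Rmax t0 t -> Cmod (u (S N) s) <= B) ->
  Cmod (u O t - taylor_poly (fun n => u n t0) N (t - t0)) <=
    B * Rabs (t - t0) ^ S N / INR (fact (S N)).
Proof.
  intros Hc Hd HB.
  assert (G : forall sg b, sg = 1 \/ sg = -1 -> 0 <= b -> t = t0 + sg * b ->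
    Cmod (u O t - taylor_poly (fun n => u n t0) N (t - t0)) <=
    B * b ^ S N / INR (fact (S N))).
  { intros sg b Hsg Hb Et.
    assert (Rg : forall s, 0 <= s <= b -> Rmin t0 t <= t0 + sg * s <= Rmax t0 t).
    { intros s Hs. subst t. destruct Hsg as [-> | ->].
      - rewrite Rmin_left, Rmax_right by lra. lra.
      - rewrite Rmin_right, Rmax_left by lra. lra. }
    assert (Ri : forall s, 0 < s < b -> Rmin t0 t < t0 + sg * s < Rmax t0 t).
    { intros s Hs. subst t. destruct Hsg as [-> | ->].
      - rewrite Rmin_left, Rmax_right by lra. lra.
      - rewrite Rmin_right, Rmax_left by lra. lra. }
    assert (S2 : forall n, Cmod (RtoC sg ^ n) = 1).
    { intros n. rewrite Cmod_pow, Cmod_R. destruct Hsg as [-> | ->].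
      - rewrite Rabs_R1. apply pow1.
      - rewrite Rabs_left by lra. replace (- -1) with 1 by ring. apply pow1. }
    set (v := fun n x => (RtoC sg ^ n * u n (t0 + sg * x)%R)%C).
    assert (K := taylor_forward N v b B Hb).
    assert (E : taylor_poly (fun n => v n 0) N b = taylor_poly (fun n => u n t0) N (t - t0)).
    { unfold taylor_poly. apply Csum_ext. intros n. unfold v.
      replace (t0 + sg * 0) with t0 by ring. replace (t - t0) with (sg * b) by (subst t; ring).
      rewrite Rpow_mult_distr. unfold Rdiv. rewrite !RtoC_mult, (RtoC_pow sg). cring. }
    rewrite E in K. unfold v in K. rewrite <- Et in K.
    replace (RtoC sg ^ 0 * u O t)%C with (u O t) in K by (simpl; ring).
    apply K.
    - intros n s Hs. apply rcont_mult; [apply rcont_const|].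
      apply rcont_affine; [exact Hsg|]. apply Hc. now apply Rg.
    - intros n s Hs. fold v.
      assert (D := cdev_scal (locally s) (RtoC sg ^ n)%C _ _ _ _
        (rdiff_affine (u n) t0 sg s _ Hsg (Hd n _ (Ri s Hs)))).
      apply (cdev_eq _ _ _ _ _ _ _ eq_refl) with (2 := D). rewrite Cpow_S. ring.
    - intros s Hs. rewrite Cmod_mult, S2, Rmult_1_l. apply HB. now apply Rg. }
  destruct (Rle_dec t0 t) as [L|L].
  - rewrite Rabs_pos_eq by lra. apply (G 1); [now left|lra|ring].
  - rewrite Rabs_left by lra. apply (G (-1)); [now right|lra|ring].
Qed.

(** The Lie derivative along the field [G], iterated; [lie G f n] evaluated along
    an integral curve of [G] is the [n]-th derivative of [f] along it. *)
Fixpoint lie (G f : C -> C) (n : nat) : C -> C :=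
  match n with
  | O => f
  | S n => fun z => (G z * C_derive (lie G f n) z)%C
  end.

Lemma lie_hol (G f : C -> C) (z0 : C) (r : R) (n : nat) :
  hol_ball G z0 r -> hol_ball f z0 r -> hol_ball (lie G f n) z0 r.
Proof.
  intros HG Hf. induction n; [exact Hf|].
  intros z Hz. destruct (HG z Hz) as [l Hl].
  destruct (hol_ball_derive _ _ _ IHn z Hz) as [m Hm].
  eexists. apply (cdiff_mult G (C_derive (lie G f n))); eassumption.
Qed.

Lemma one_plus_inv_pow_le (n : nat) : (1 + / INR (S n)) ^ S n <= exp 1.
Proof.
  assert (Hn : 0 < INR (S n)) by (apply lt_0_INR; lia).
  assert (P := Rinv_0_lt_compat _ Hn).
  apply Rle_trans with (exp (/ INR (S n)) ^ S n).
  - apply pow_incr. split; [lra|]. left. apply exp_ineq1. lra.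
  - right. rewrite <- Rpower_pow by apply exp_pos. unfold Rpower. rewrite ln_exp.
    f_equal. field. lra.
Qed.

(** Nested Cauchy estimates: passing from the distance [d] to the boundary to
    [d * (n / (n + 1))] costs a factor at most [e] at each step. *)
Lemma lie_bound (G f : C -> C) (z0 : C) (r M B : R) :
  0 <= M -> 0 <= B -> hol_ball G z0 r -> hol_ball f z0 r ->
  (forall z, inball z0 r z -> Cmod (G z) <= M) ->
  (forall z, inball z0 r z -> Cmod (f z) <= B) ->
  forall n z, inball z0 r z ->
    Cmod (lie G f n z) <= B * INR (fact n) * (exp 1 * M / (r - Cmod (z - z0))) ^ n.
Proof.
  intros HM HB HG Hf BG Bf. assert (Pe := exp_pos 1).
  induction n; intros z Hz.
  { simpl. rewrite !Rmult_1_r. now apply Bf. }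
  unfold inball in Hz. set (d := r - Cmod (z - z0)). assert (Hd : 0 < d) by (unfold d; lra).
  assert (Hn1 : 0 < INR (S n)) by (apply lt_0_INR; lia).
  assert (Hn0 : 0 <= INR n) by apply pos_INR.
  assert (HS : INR (S n) = INR n + 1) by apply S_INR.
  (* The ball of radius [d / (n + 1)] about [z] stays at distance [d * n / (n + 1)]
     from the boundary, where [K] is the bound of the induction hypothesis.  For
     [n = 0] the division by [INR 0] is harmless, its exponent being [0]. *)
  set (K := B * INR (fact n) * (exp 1 * M / d * (INR (S n) / INR n)) ^ n).
  assert (HK : K <= B * INR (fact n) * (exp 1 * M / d) ^ n * exp 1).
  { unfold K. rewrite Rpow_mult_distr, <- Rmult_assoc. apply Rmult_le_compat_l.
    - apply Rmult_le_pos; [apply Rmult_le_pos; [exact HB|apply pos_INR]|].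
      apply pow_le. apply Rmult_le_pos; [apply Rmult_le_pos; lra|].
      left. now apply Rinv_0_lt_compat.
    - destruct n.
      + simpl. left. assert (H := exp_ineq1 1 ltac:(lra)). lra.
      + eapply Rle_trans; [|apply (one_plus_inv_pow_le n)]. right. f_equal.
        rewrite (S_INR (S n)). field. apply not_0_INR. lia. }
  assert (Hder : Cmod (C_derive (lie G f n) z) <= K / (d / INR (S n))).
  { apply cauchy_estimate.
    - now apply Rdiv_lt_0_compat.
    - intros w Hw. apply (lie_hol G f z0 r n HG Hf). unfold inball in *.
      eapply Rle_lt_trans; [apply (Cmod_sub_triangle w z z0)|].
      assert (d / INR (S n) <= d).
      { unfold Rdiv. rewrite <- (Rmult_1_r d) at 2. apply Rmult_le_compat_l; [lra|].
        rewrite <- Rinv_1. apply Rinv_le_contravar; lra. }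
      unfold d in *. lra.
    - intros w Hw. unfold inball in Hw.
      assert (T := Cmod_sub_triangle w z z0).
      destruct n as [|n].
      { unfold K. simpl. rewrite !Rmult_1_r. apply Bf. unfold inball. unfold d in *.
        simpl in Hw. lra. }
      assert (Hn2 : 0 < INR (S n)) by (apply lt_0_INR; lia).
      assert (Hlow : d * (INR (S n) / INR (S (S n))) <= r - Cmod (w - z0)).
      { replace (d * (INR (S n) / INR (S (S n)))) with (d - d / INR (S (S n))).
        - unfold d in *. lra.
        - rewrite HS. field. lra. }
      assert (Hpos : 0 < d * (INR (S n) / INR (S (S n)))).
      { apply Rmult_lt_0_compat; [lra|]. now apply Rdiv_lt_0_compat. }
      eapply Rle_trans; [apply IHn; unfold inball; lra|]. unfold K.
      apply Rmult_le_compat_l; [apply Rmult_le_pos; [exact HB|apply pos_INR]|].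
      apply pow_incr. split.
      + apply Rmult_le_pos; [apply Rmult_le_pos; lra|]. left. apply Rinv_0_lt_compat. lra.
      + replace (exp 1 * M / d * (INR (S (S n)) / INR (S n))) with
          (exp 1 * M * / (d * (INR (S n) / INR (S (S n))))) by (field; lra).
        apply Rmult_le_compat_l; [apply Rmult_le_pos; lra|].
        now apply Rinv_le_contravar. }
  simpl lie. rewrite Cmod_mult.
  apply Rle_trans with (M * (B * INR (fact n) * (exp 1 * M / d) ^ n * exp 1 / (d / INR (S n)))).
  - apply Rmult_le_compat; try apply Cmod_ge_0; [now apply BG|].
    eapply Rle_trans; [exact Hder|]. apply Rmult_le_compat_r; [|exact HK].
    left. apply Rinv_0_lt_compat. now apply Rdiv_lt_0_compat.
  - right. rewrite fact_simpl, mult_INR. simpl pow. field. lra.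
Qed.

Definition taylor_coef (G f : C -> C) (n : nat) (z : C) : C :=
  (RtoC (/ INR (fact n)) * lie G f n z)%C.

Definition taylor_rate (M r : R) : R := 2 * exp 1 * M / r.

Lemma taylor_coef_hol (G f : C -> C) (z0 : C) (r : R) (n : nat) :
  hol_ball G z0 r -> hol_ball f z0 r -> hol_ball (taylor_coef G f n) z0 r.
Proof.
  intros HG Hf z Hz. destruct (lie_hol G f z0 r n HG Hf z Hz) as [l Hl].
  eexists. apply cdiff_scal. exact Hl.
Qed.

Lemma inv_fact_pos (n : nat) : 0 < / INR (fact n).
Proof. apply Rinv_0_lt_compat, INR_fact_lt_0. Qed.

Section FlowTaylor.
Variables (G f : C -> C) (z0 : C) (r M B : R).
Hypotheses (HM : 0 <= M) (HB : 0 <= B) (Hr : 0 < r).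
Hypotheses (HG : hol_ball G z0 r) (Hf : hol_ball f z0 r).
Hypothesis BG : forall z, inball z0 r z -> Cmod (G z) <= M.
Hypothesis Bf : forall z, inball z0 r z -> Cmod (f z) <= B.

Lemma lie_bound_half (n : nat) (z : C) : inball z0 (r / 2) z ->
  Cmod (lie G f n z) <= B * INR (fact n) * taylor_rate M r ^ n.
Proof.
  intros Hz. unfold inball in Hz. assert (Pe := exp_pos 1).
  eapply Rle_trans; [apply (lie_bound G f z0 r M B); auto; unfold inball; lra|].
  apply Rmult_le_compat_l; [apply Rmult_le_pos; [exact HB|apply pos_INR]|].
  apply pow_incr. split.
  - apply Rmult_le_pos; [apply Rmult_le_pos; lra|]. left. apply Rinv_0_lt_compat. lra.
  - unfold taylor_rate. replace (2 * exp 1 * M / r) with (exp 1 * M * / (r / 2)) by (field; lra).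
    apply Rmult_le_compat_l; [apply Rmult_le_pos; lra|]. apply Rinv_le_contravar; lra.
Qed.

Lemma taylor_coef_bound (n : nat) (z : C) : inball z0 (r / 2) z ->
  Cmod (taylor_coef G f n z) <= B * taylor_rate M r ^ n.
Proof.
  intros Hz. unfold taylor_coef. assert (P := inv_fact_pos n).
  rewrite Cmod_mult, Cmod_R, Rabs_pos_eq by lra.
  apply Rle_trans with (/ INR (fact n) * (B * INR (fact n) * taylor_rate M r ^ n)).
  - apply Rmult_le_compat_l; [lra|]. now apply lie_bound_half.
  - right. field. apply INR_fact_neq_0.
Qed.

(** Along an integral curve the iterated Lie derivatives of [f] are the successive
    derivatives in time, so that Taylor's formula with the bounds of [lie_bound]
    gives a geometrically small remainder. *)
Theorem flow_taylor (g : R -> C) (t0 t : R) (N : nat) :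
  (forall s, Rmin t0 t <= s <= Rmax t0 t -> rcont g s /\ inball z0 (r / 2) (g s)) ->
  (forall s, Rmin t0 t < s < Rmax t0 t -> rdiff g s (G (g s))) ->
  Cmod (f (g t) - Csum (fun n => RtoC ((t - t0) ^ n) * taylor_coef G f n (g t0))%C N) <=
    B * (taylor_rate M r * Rabs (t - t0)) ^ S N.
Proof.
  intros Hc Hd.
  assert (sub : forall z, inball z0 (r / 2) z -> inball z0 r z)
    by (intros z Hz; unfold inball in *; lra).
  set (u := fun n s => lie G f n (g s)).
  assert (K := taylor_two_sided N u t0 t (B * INR (fact (S N)) * taylor_rate M r ^ S N)).
  replace (Csum (fun n => RtoC ((t - t0) ^ n) * taylor_coef G f n (g t0))%C N) with
    (taylor_poly (fun n => u n t0) N (t - t0)).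
  2:{ apply Csum_ext. intros n. unfold u, taylor_coef, Rdiv. rewrite RtoC_mult. ring. }
  replace (B * (taylor_rate M r * Rabs (t - t0)) ^ S N) with
    (B * INR (fact (S N)) * taylor_rate M r ^ S N * Rabs (t - t0) ^ S N / INR (fact (S N))).
  2:{ rewrite Rpow_mult_distr. field. apply INR_fact_neq_0. }
  apply K.
  - intros n s Hs. destruct (Hc s Hs) as [C1 C2]. apply rcont_comp; [|exact C1].
    apply (hol_ball_cont _ z0 r); [now apply lie_hol|auto].
  - intros n s Hs. assert (C2 := proj2 (Hc s ltac:(lra))).
    assert (E : u (S n) s = (C_derive (lie G f n) (g s) * G (g s))%C)
      by (unfold u; simpl; ring).
    rewrite E. apply rdiff_comp; [|now apply Hd].
    apply (hol_ball_C_derive _ z0 r); [now apply lie_hol|auto].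
  - intros s Hs. apply lie_bound_half. now apply Hc.
Qed.

End FlowTaylor.

(** * Real analyticity of the flow *)

Lemma pow_half_le (A s : R) (n : nat) : 0 <= A -> A * Rabs s <= 1 / 2 ->
  A ^ n * Rabs s ^ n <= (1 / 2) ^ n.
Proof.
  intros HA H. rewrite <- Rpow_mult_distr. apply pow_incr. split; [|exact H].
  apply Rmult_le_pos; [exact HA|apply Rabs_pos].
Qed.

Lemma Cmod_RtoC_pow (s : R) (n : nat) : Cmod (RtoC (s ^ n)) = Rabs s ^ n.
Proof. rewrite Cmod_R. symmetry. apply RPow_abs. Qed.

(** Replacing coefficients by approximations of weight [A ^ j]: as [A |s| <= 1/2],
    the total error is that of a geometric series of sum [2]. *)
Lemma expand_step (v : C) (s A K K' e : R) (b X : nat -> C) (N : nat) :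
  0 <= A -> 0 <= K' -> 0 <= e -> A * Rabs s <= 1 / 2 ->
  Cmod (v - Csum (fun j => RtoC (s ^ j) * b j)%C N) <= K * e ->
  (forall j, Cmod (b j - X j) <= A ^ j * (K' * e)) ->
  Cmod (v - Csum (fun j => RtoC (s ^ j) * X j)%C N) <= (K + 2 * K') * e.
Proof.
  intros HA HK' He Hs Hv HX.
  replace (v - Csum (fun j => RtoC (s ^ j) * X j)%C N)%C with
    ((v - Csum (fun j => RtoC (s ^ j) * b j)%C N) +
     Csum (fun j => RtoC (s ^ j) * b j - RtoC (s ^ j) * X j)%C N)%C
    by (rewrite Csum_minus; cring).
  eapply Rle_trans; [apply Cmod_triangle|].
  assert (P : 0 <= K' * e) by now apply Rmult_le_pos.
  assert (Cmod (Csum (fun j => RtoC (s ^ j) * b j - RtoC (s ^ j) * X j)%C N) <= 2 * (K' * e)).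
  { apply geometric_Csum_le; [exact P|]. intros j.
    replace (RtoC (s ^ j) * b j - RtoC (s ^ j) * X j)%C with (RtoC (s ^ j) * (b j - X j))%C by ring.
    rewrite Cmod_mult, Cmod_RtoC_pow.
    apply Rle_trans with (Rabs s ^ j * (A ^ j * (K' * e))).
    - apply Rmult_le_compat_l; [apply pow_le, Rabs_pos|apply HX].
    - replace (Rabs s ^ j * (A ^ j * (K' * e))) with (A ^ j * Rabs s ^ j * (K' * e)) by ring.
      rewrite (Rmult_comm (K' * e)). apply Rmult_le_compat_r; [exact P|].
      now apply pow_half_le. }
  lra.
Qed.

Lemma taylor_rate_ge_0 (M r : R) : 0 <= M -> 0 < r -> 0 <= taylor_rate M r.
Proof.
  intros HM Hr. unfold taylor_rate. assert (P := exp_pos 1).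
  apply Rmult_le_pos; [apply Rmult_le_pos; lra|]. left. now apply Rinv_0_lt_compat.
Qed.

Lemma rate_radius (A s : R) : 0 <= A -> Rabs s < / (2 * (A + 1)) -> A * Rabs s <= 1 / 2.
Proof.
  intros HA Hs. apply Rle_trans with ((A + 1) * / (2 * (A + 1))).
  - apply Rmult_le_compat; try lra. apply Rabs_pos.
  - right. field. lra.
Qed.

Lemma hol_ball_const (c z0 : C) (r : R) : hol_ball (fun _ => c) z0 r.
Proof. intros z _. exists (RtoC 0). apply cdiff_const. Qed.

Lemma hol_ball_shrink (f : C -> C) (z0 : C) (r r' : R) : r' <= r ->
  hol_ball f z0 r -> hol_ball f z0 r'.
Proof. intros Hr Hf z Hz. apply Hf. unfold inball in *. lra. Qed.

Lemma cube_sum_factor (a : nat -> nat -> nat -> C) (s x y : R) (N : nat) :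
  cube_sum (G := C_AbelianMonoid) (monomial a s x y) N =
  Csum (fun j => RtoC (s ^ j) * Csum (fun k => RtoC (x ^ k) *
    Csum (fun l => RtoC (y ^ l) * a j k l) N) N)%C N.
Proof.
  unfold cube_sum. apply Csum_ext. intros j. rewrite <- Csum_scal.
  apply Csum_ext. intros k. rewrite <- !Csum_scal. apply Csum_ext. intros l.
  unfold monomial. rewrite !RtoC_mult. cring.
Qed.

Lemma cube_sum_bound (a : nat -> nat -> nat -> C) (A E H s x y : R) (N : nat) :
  0 <= A -> 0 <= E -> 0 <= H ->
  (forall j k l, Cmod (a j k l) <= A ^ j * E ^ k * H ^ l) ->
  A * Rabs s <= 1 / 2 -> E * Rabs x <= 1 / 2 -> H * Rabs y <= 1 / 2 ->
  cube_sum (fun j k l => Cmod (monomial a s x y j k l)) N <= 8.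
Proof.
  intros HA HE HH Ha Hs Hx Hy. unfold cube_sum.
  assert (Ph : forall n, 0 <= (1 / 2) ^ n) by (intros n; apply pow_le; lra).
  assert (Pm : forall j k l, Cmod (monomial a s x y j k l) <=
    (1 / 2) ^ j * (1 / 2) ^ k * (1 / 2) ^ l).
  { intros j k l. unfold monomial. rewrite Cmod_mult, Cmod_R, !Rabs_mult, <- !RPow_abs.
    apply Rle_trans with ((A ^ j * E ^ k * H ^ l) * (Rabs s ^ j * Rabs x ^ k * Rabs y ^ l)).
    - apply Rmult_le_compat_r; [|apply Ha].
      repeat apply Rmult_le_pos; apply pow_le, Rabs_pos.
    - replace ((A ^ j * E ^ k * H ^ l) * (Rabs s ^ j * Rabs x ^ k * Rabs y ^ l)) with
        ((A ^ j * Rabs s ^ j) * (E ^ k * Rabs x ^ k) * (H ^ l * Rabs y ^ l)) by ring.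
      assert (Q : forall B u n, 0 <= B -> 0 <= B ^ n * Rabs u ^ n)
        by (intros B u n HB; apply Rmult_le_pos; apply pow_le; [exact HB|apply Rabs_pos]).
      apply Rmult_le_compat; auto.
      + apply Rmult_le_pos; auto.
      + apply Rmult_le_compat; auto; now apply pow_half_le.
      + now apply pow_half_le. }
  replace 8 with (2 * 4) by ring. apply geometric_sum_le; [lra|]. intros j.
  replace (4 * (1 / 2) ^ j) with (2 * (2 * (1 / 2) ^ j)) by ring.
  apply geometric_sum_le; [specialize (Ph j); lra|]. intros k.
  replace (2 * (1 / 2) ^ j * (1 / 2) ^ k) with (2 * ((1 / 2) ^ j * (1 / 2) ^ k)) by ring.
  apply geometric_sum_le; [now apply Rmult_le_pos|]. intros l. apply Pm.
Qed.

Lemma rdiff_shift_h (a b s : R) : rdiff (fun s => (a + s, b)) s (RtoC 1).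
Proof. apply (rdiff_pair (fun s => a + s) (fun _ => b)); auto_derive; auto; ring. Qed.

Lemma rdiff_shift_v (a b s : R) : rdiff (fun s => (a, b + s)) s Ci.
Proof. apply (rdiff_pair (fun _ => a) (fun s => b + s)); auto_derive; auto; ring. Qed.

Lemma between_0_abs (x s : R) : Rmin 0 x <= s <= Rmax 0 x -> Rabs s <= Rabs x.
Proof.
  intros H. destruct (Rminmax_between 0 x) as [[E1 [E2 L]]|[E1 [E2 L]]]; rewrite E1, E2 in H.
  - rewrite !Rabs_pos_eq; lra.
  - rewrite !Rabs_left1; lra.
Qed.

(** The flow expands in [t] along the orbits with coefficients holomorphic in [z];
    these expand in [x], and their coefficients in [y], by the same theorem
    applied to the flows of the constant fields [1] and [Ci]. *)
Theorem flow_real_analytic (phi : R -> C -> C) :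
  semigroup phi -> real_analytic_on (fun t z => 0 <= t /\ disc z) phi.
Proof.
  intros sg. destruct (generator_exists phi sg) as [G [HG HD]].
  intros t0 z0 [Ht0 Hz0].
  set (w0 := phi t0 z0).
  assert (Hw0 : disc w0) by now apply (sg_self_map phi sg).
  assert (Hw0' := Hw0). assert (Hz0' := Hz0). unfold disc in Hw0', Hz0'.
  destruct (HG w0 (proj1 (disc_inball w0) Hw0)) as [lG HlG].
  destruct (cdiff_cont _ _ _ HlG 1 Rlt_0_1) as [d1 [Hd1 B1]].
  set (R0 := Rmin d1 (1 - Cmod w0)).
  assert (HR0 : 0 < R0) by (apply Rmin_pos; lra).
  assert (R01 : R0 <= d1) by apply Rmin_l. assert (R02 : R0 <= 1 - Cmod w0) by apply Rmin_r.
  set (M := Cmod (G w0) + 1).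
  assert (HM : 0 <= M) by (unfold M; assert (H := Cmod_ge_0 (G w0)); lra).
  assert (GM : forall w, inball w0 R0 w -> Cmod (G w) <= M).
  { intros w Hw. unfold inball in Hw. assert (H := B1 w ltac:(lra)).
    assert (K := Cmod_sub_ge (G w) (G w0)). unfold M. lra. }
  assert (hG : hol_ball G w0 R0).
  { intros w Hw. apply HG, (proj1 (disc_inball w)). now apply (disc_ball w0 w R0). }
  assert (hid : hol_ball (fun w => w) w0 R0) by (intros w _; exists (RtoC 1); apply cdiff_id).
  assert (bid : forall w, inball w0 R0 w -> Cmod w <= 1).
  { intros w Hw. left. now apply (disc_ball w0 w R0). }
  assert (HR4 : 0 < R0 / 4) by lra.
  destruct (cdiff_cont _ _ _ (cdiff_phi phi sg t0 z0 Ht0 Hz0) _ HR4) as [d2 [Hd2 B2]].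
  destruct (sg_cont_unif phi sg t0 z0 _ Ht0 Hz0 HR4) as [d3 [Hd3 B3]].
  set (p := Rmin d2 ((1 - Cmod z0) / 4)).
  assert (Hp : 0 < p) by (apply Rmin_pos; lra).
  assert (p1 : p <= d2) by apply Rmin_l. assert (p2 : p <= (1 - Cmod z0) / 4) by apply Rmin_r.
  assert (in0 : forall z, inball z0 p z -> inball w0 (R0 / 2) (phi t0 z)).
  { intros z Hz. unfold inball in *. assert (H := B2 z ltac:(lra)). fold w0 in H. lra. }
  assert (inT : forall t z, 0 <= t -> Rabs (t - t0) < d3 -> inball z0 p z ->
    inball w0 (R0 / 2) (phi t z)).
  { intros t z Ht Htd Hz. assert (Hz' := Hz). unfold inball in *.
    assert (H1 := B3 t z Ht Htd ltac:(lra)). assert (H2 := B2 z ltac:(lra)). fold w0 in H2.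
    assert (T := Cmod_sub_triangle (phi t z) (phi t0 z) w0). lra. }
  set (A := taylor_rate M R0). assert (HA : 0 <= A) by now apply taylor_rate_ge_0.
  set (E := taylor_rate 1 p). assert (HE : 0 <= E) by (apply taylor_rate_ge_0; lra).
  set (H := taylor_rate 1 (p / 2)). assert (HH : 0 <= H) by (apply taylor_rate_ge_0; lra).
  set (b1 := fun j z => taylor_coef G (fun w => w) j (phi t0 z)).
  set (b2 := fun j k => taylor_coef (fun _ => RtoC 1) (b1 j) k).
  set (b3 := fun j k l => taylor_coef (fun _ => Ci) (b2 j k) l).
  assert (PA : forall j, 0 <= A ^ j) by (intros j; now apply pow_le).
  assert (PE : forall j, 0 <= E ^ j) by (intros j; now apply pow_le).
  assert (h1 : forall j, hol_ball (b1 j) z0 p).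
  { intros j z Hz. assert (Hzd : disc z).
    { apply (disc_ball z0 z p); [lra|exact Hz]. }
    destruct (taylor_coef_hol G (fun w => w) w0 R0 j hG hid (phi t0 z)) as [l Hl].
    { assert (K := in0 z Hz). unfold inball in *. lra. }
    eexists. apply (cdiff_comp (taylor_coef G (fun w => w) j) (phi t0)); [exact Hl|].
    now apply (cdiff_phi phi sg). }
  assert (c1 : forall j z, inball z0 p z -> Cmod (b1 j z) <= A ^ j).
  { intros j z Hz. rewrite <- (Rmult_1_l (A ^ j)).
    apply (taylor_coef_bound G (fun w => w) w0 R0 M 1); auto; lra. }
  assert (one : forall z : C, inball z0 p z -> Cmod (RtoC 1) <= 1)
    by (intros z _; rewrite Cmod_1; lra).
  assert (oneI : forall z : C, inball z0 (p / 2) z -> Cmod Ci <= 1)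
    by (intros z _; rewrite Cmod_Ci; lra).
  assert (h2 : forall j k, hol_ball (b2 j k) z0 (p / 2)).
  { intros j k. apply hol_ball_shrink with p; [lra|].
    apply taylor_coef_hol; [apply hol_ball_const|apply h1]. }
  assert (c2 : forall j k z, inball z0 (p / 2) z -> Cmod (b2 j k z) <= A ^ j * E ^ k).
  { intros j k z Hz. apply (taylor_coef_bound (fun _ => RtoC 1) (b1 j) z0 p 1 (A ^ j)); auto; try lra.
    apply hol_ball_const. }
  assert (c3 : forall j k l, Cmod (b3 j k l z0) <= A ^ j * E ^ k * H ^ l).
  { intros j k l. apply (taylor_coef_bound (fun _ => Ci) (b2 j k) z0 (p / 2) 1 (A ^ j * E ^ k));
    auto; try lra.
    - now apply Rmult_le_pos.
    - apply hol_ball_const.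
    - apply inball_center. lra. }
  set (r := Rmin (Rmin d3 (p / 8)) (Rmin (/ (2 * (A + 1))) (Rmin (/ (2 * (E + 1))) (/ (2 * (H + 1)))))).
  assert (Hr : 0 < r).
  { assert (I : forall B, 0 <= B -> 0 < / (2 * (B + 1)))
      by (intros B HB; apply Rinv_0_lt_compat; lra).
    repeat apply Rmin_pos; auto; lra. }
  assert (r1 : r <= d3) by (eapply Rle_trans; [apply Rmin_l|apply Rmin_l]).
  assert (r2 : r <= p / 8) by (eapply Rle_trans; [apply Rmin_l|apply Rmin_r]).
  assert (r3 : r <= / (2 * (A + 1))) by (eapply Rle_trans; [apply Rmin_r|apply Rmin_l]).
  assert (r4 : r <= / (2 * (E + 1))).
  { eapply Rle_trans; [apply Rmin_r|]. eapply Rle_trans; [apply Rmin_r|apply Rmin_l]. }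
  assert (r5 : r <= / (2 * (H + 1))).
  { eapply Rle_trans; [apply Rmin_r|]. eapply Rle_trans; [apply Rmin_r|apply Rmin_r]. }
  exists (fun j k l => b3 j k l z0), (mkposreal r Hr). simpl pos. split.
  (* Three geometric series of ratio at most [1/2], each of sum at most [2]. *)
  { intros s x y Hs Hx Hy. exists 8. intros N.
    apply (cube_sum_bound _ A E H); auto; apply rate_radius; auto; lra. }
  intros t z [Ht Hz] Hts Hx Hy.
  set (s := t - t0) in *. set (x := Re z - Re z0) in *. set (y := Im z - Im z0) in *.
  assert (As : A * Rabs s <= 1 / 2) by (apply rate_radius; auto; lra).
  assert (Ex : E * Rabs x <= 1 / 2) by (apply rate_radius; auto; lra).
  assert (Hyy : H * Rabs y <= 1 / 2) by (apply rate_radius; auto; lra).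
  assert (near : forall u v r, Rabs u + Rabs v < r -> inball z0 r ((Re z0 + u)%R, (Im z0 + v)%R)).
  { intros u v q Huv. unfold inball. eapply Rle_lt_trans; [apply Cmod_le_Re_Im|].
    replace (Re (((Re z0 + u)%R, (Im z0 + v)%R) - z0)%C) with u by (unfold Re; simpl; ring).
    replace (Im (((Re z0 + u)%R, (Im z0 + v)%R) - z0)%C) with v by (unfold Im; simpl; ring). exact Huv. }
  assert (Ez : z = ((Re z0 + x)%R, (Im z0 + y)%R)).
  { apply Ceq; unfold x, y, Re, Im; simpl; ring. }
  assert (Hzp : inball z0 p z) by (rewrite Ez; apply near; lra).
  assert (S1 : forall N, Cmod (phi t z - Csum (fun j => RtoC (s ^ j) * b1 j z)%C N) <=
    1 * (1 / 2) ^ S N).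
  { intros N.
    assert (Dz : disc z) by (apply (disc_ball z0 z p); [lra|exact Hzp]).
    assert (K := flow_taylor G (fun w => w) w0 R0 M 1 HM ltac:(lra) HR0 hG hid GM bid
      (orbit phi z) t0 t N).
    assert (Eo : forall q, 0 <= q -> orbit phi z q = phi q z)
      by (intros q Hq; unfold orbit; now rewrite Rmax_right).
    rewrite !Eo in K by assumption.
    eapply Rle_trans; [apply K|].
    - intros q Hq. split; [now apply rcont_orbit|].
      assert (Hq0 : 0 <= q).
      { destruct (Rminmax_between t0 t) as [[E1 [E2 L]]|[E1 [E2 L]]]; rewrite E1, E2 in Hq; lra. }
      rewrite Eo by exact Hq0. apply inT; auto.
      apply Rle_lt_trans with (Rabs s); [|lra]. unfold s.
      destruct (Rminmax_between t0 t) as [[E1 [E2 L]]|[E1 [E2 L]]]; rewrite E1, E2 in Hq.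
      + rewrite !Rabs_pos_eq; lra.
      + rewrite !Rabs_left1; lra.
    - intros q Hq. assert (Hq0 : 0 < q).
      { destruct (Rminmax_between t0 t) as [[E1 [E2 L]]|[E1 [E2 L]]]; rewrite E1, E2 in Hq; lra. }
      rewrite Eo by lra. intros e He.
      destruct (proj1 (time_filter_spec _ _) (HD q z ltac:(lra) Dz e He)) as [d [Hd Kd]].
      assert (Hm : 0 < Rmin d q) by now apply Rmin_pos.
      exists (mkposreal _ Hm). intros q' Hq'. change (Rabs (q' - q) < Rmin d q) in Hq'.
      assert (M1 := Rmin_l d q). assert (M2 := Rmin_r d q).
      assert (Hq1 : 0 <= q') by (apply Rabs_lt_between in Hq'; lra).
      rewrite !Eo by lra. apply Kd; lra.
    - rewrite !Rmult_1_l. apply pow_incr. split; [|exact As].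
      apply Rmult_le_pos; [exact HA|apply Rabs_pos]. }
  assert (S2 : forall N j, Cmod (b1 j z - Csum (fun k => RtoC (x ^ k) *
    b2 j k (Re z0, (Im z0 + y)%R))%C N) <= A ^ j * (1 * (1 / 2) ^ S N)).
  { intros N j.
    assert (K := flow_taylor (fun _ => RtoC 1) (b1 j) z0 p 1 (A ^ j) ltac:(lra) (PA j) Hp
      (hol_ball_const _ _ _) (h1 j) one (c1 j) (fun q => (Re z0 + q, Im z0 + y)) 0 x N).
    cbv beta in K. rewrite <- Ez, Rplus_0_r, Rminus_0_r in K.
    eapply Rle_trans; [apply K|].
    - intros q Hq. apply between_0_abs in Hq. split.
      + exact (rdiff_rcont _ _ _ (rdiff_shift_h _ _ q)).
      + apply near. lra.
    - intros q Hq. apply rdiff_shift_h.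
    - rewrite Rmult_1_l. apply Rmult_le_compat_l; [apply PA|].
      apply pow_incr. split; [|exact Ex]. apply Rmult_le_pos; [exact HE|apply Rabs_pos]. }
  assert (S3 : forall N j k, Cmod (b2 j k (Re z0, (Im z0 + y)%R) - Csum (fun l => RtoC (y ^ l) *
    b3 j k l z0)%C N) <= E ^ k * (A ^ j * (1 / 2) ^ S N)).
  { intros N j k.
    assert (K := flow_taylor (fun _ => Ci) (b2 j k) z0 (p / 2) 1 (A ^ j * E ^ k) ltac:(lra)
      (Rmult_le_pos _ _ (PA j) (PE k)) ltac:(lra)
      (hol_ball_const _ _ _) (h2 j k) oneI (c2 j k) (fun q => (Re z0, Im z0 + q)) 0 y N).
    cbv beta in K. rewrite Rplus_0_r, Rminus_0_r in K.
    replace ((Re z0, Im z0) : C) with z0 in K by (destruct z0; reflexivity).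
    eapply Rle_trans; [apply K|].
    - intros q Hq. apply between_0_abs in Hq. split.
      + exact (rdiff_rcont _ _ _ (rdiff_shift_v _ _ q)).
      + assert (N0 := near 0 q (p / 2 / 2)). rewrite Rplus_0_r, Rabs_R0 in N0. apply N0. lra.
    - intros q Hq. apply rdiff_shift_v.
    - rewrite <- Rmult_assoc, (Rmult_comm (E ^ k)). apply Rmult_le_compat_l.
      + now apply Rmult_le_pos.
      + apply pow_incr. split; [|exact Hyy]. apply Rmult_le_pos; [exact HH|apply Rabs_pos]. }
  assert (Tot : forall N, Cmod (phi t z - cube_sum (G := C_AbelianMonoid)
    (monomial (fun j k l => b3 j k l z0) s x y) N) <= 7 * (1 / 2) ^ S N).
  { intros N. rewrite cube_sum_factor.
    assert (Pe : 0 <= (1 / 2) ^ S N) by (apply pow_le; lra).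
    replace 7 with (1 + 2 * 3) by ring.
    apply (expand_step _ s A 1 3 _ (fun j => b1 j z)); auto; try lra.
    intros j. replace (A ^ j * (3 * (1 / 2) ^ S N)) with ((1 + 2 * 1) * (A ^ j * (1 / 2) ^ S N)) by ring.
    apply (expand_step _ x E 1 1 _ (fun k => b2 j k (Re z0, (Im z0 + y)%R))); auto; try lra.
    - apply Rmult_le_pos; auto.
    - eapply Rle_trans; [apply S2|]. right. ring.
    - intros k. rewrite Rmult_1_l. apply S3. }
  apply (proj1 (clim_locally Hierarchy.eventually _ _)). intros e He.
  destruct (pow_lt_1_zero (1 / 2)) with (y := e / 7) as [N HN].
  { rewrite Rabs_pos_eq; lra. }
  { lra. }
  exists N. intros n Hn. rewrite Cmod_sub_sym.
  eapply Rle_lt_trans; [apply Tot|]. specialize (HN (S n) ltac:(lia)).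
  rewrite Rabs_pos_eq in HN by (apply pow_le; lra). lra.
Qed.

(** * The complex exponential *)

Definition cexp (w : C) : C := (RtoC (exp (Re w)) * circ (Im w))%C.

(** The principal logarithm on the right half-plane, the only place where it is
    used. *)
Definition clog (q : C) : C := (ln (Cmod q), atan (Im q / Re q)).

Lemma Cmod_cexp (w : C) : Cmod (cexp w) = exp (Re w).
Proof.
  unfold cexp. rewrite Cmod_mult, Cmod_circ, Cmod_R, Rabs_pos_eq; [ring|].
  left. apply exp_pos.
Qed.

Lemma circ_plus (a b : R) : circ (a + b) = (circ a * circ b)%C.
Proof. unfold circ. rewrite cos_plus, sin_plus. apply Ceq; unfold Re, Im; simpl; ring. Qed.

Lemma cexp_plus (z w : C) : cexp (z + w) = (cexp z * cexp w)%C.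
Proof.
  unfold cexp. rewrite re_plus, im_plus, exp_plus, circ_plus, RtoC_mult. ring.
Qed.

Lemma cexp_clog (q : C) : 0 < Re q -> cexp (clog q) = q.
Proof.
  intros Hq. set (t := Im q / Re q).
  assert (Ht : Im q = Re q * t) by (unfold t; field; lra).
  assert (P : 0 < 1 + t²) by (unfold Rsqr; nra).
  assert (Ps : 0 < sqrt (1 + t²)) by now apply sqrt_lt_R0.
  assert (Em : Cmod q = Re q * sqrt (1 + t²)).
  { transitivity (sqrt ((Re q)² * (1 + t²))).
    - unfold Cmod. f_equal. change (fst q) with (Re q). change (snd q) with (Im q).
      rewrite Ht. unfold Rsqr. ring.
    - rewrite sqrt_mult by (try apply Rle_0_sqr; lra). now rewrite sqrt_Rsqr by lra. }
  assert (Pm : 0 < Cmod q) by (rewrite Em; now apply Rmult_lt_0_compat).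
  unfold cexp, clog, circ. change (Re (ln (Cmod q), atan (Im q / Re q))) with (ln (Cmod q)).
  change (Im (ln (Cmod q), atan (Im q / Re q))) with (atan t).
  rewrite exp_ln, cos_atan, sin_atan, Em by exact Pm. apply Ceq.
  - unfold Re at 1; simpl. field. lra.
  - unfold Im at 1; simpl. rewrite Ht. field. lra.
Qed.

Lemma cdiff_cexp (z : C) : cdiff cexp z (cexp z).
Proof.
  assert (D0 : forall e, 0 < e -> exists d, 0 < d /\ forall h, Cmod h < d ->
    Cmod (cexp h - 1 - h) <= e * Cmod h).
  { intros e He.
    assert (He3 : 0 < e / 3) by lra.
    assert (Dx := proj1 (is_derive_eps exp 0 (exp 0)) (is_derive_exp 0) _ He3).
    assert (Dy := rdiff_circ 0 _ He3). assert (Cy := rcont_circ 0 _ He3).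
    destruct Dx as [d1 K1]. destruct Dy as [d2 K2]. destruct Cy as [d3 K3].
    exists (Rmin d1 (Rmin d2 d3)). split; [repeat apply Rmin_pos; apply cond_pos|].
    intros h Hh. set (x := Re h). set (y := Im h).
    assert (Mx : Rabs x <= Cmod h) by apply Re_le_Cmod.
    assert (My : Rabs y <= Cmod h) by apply Im_le_Cmod.
    assert (M1 := Rmin_l d1 (Rmin d2 d3)). assert (M2 := Rmin_r d1 (Rmin d2 d3)).
    assert (M3 := Rmin_l d2 d3). assert (M4 := Rmin_r d2 d3).
    assert (B1 : Rabs (x - 0) < d1) by (rewrite Rminus_0_r; lra).
    assert (B2 : Rabs (y - 0) < d2) by (rewrite Rminus_0_r; lra).
    assert (B3 : Rabs (y - 0) < d3) by (rewrite Rminus_0_r; lra).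
    specialize (K1 x B1). specialize (K2 y B2). specialize (K3 y B3).
    assert (c0 : circ 0 = RtoC 1) by (unfold circ; now rewrite cos_0, sin_0).
    rewrite exp_0, !Rminus_0_r in K1. rewrite c0, Rminus_0_r, Cmod_R in K2. rewrite c0 in K3.
    assert (Eh : h = (RtoC x + Ci * RtoC y)%C)
      by (unfold x, y; apply Ceq; unfold Re, Im; simpl; ring).
    replace (cexp h - 1 - h)%C with
      (RtoC (exp x - 1 - 1 * x) * circ y + RtoC x * (circ y - 1) +
       (circ y - 1 - Ci * 1 * RtoC y))%C.
    2:{ change (cexp h) with (RtoC (exp x) * circ y)%C. rewrite Eh.
        rewrite !RtoC_minus, RtoC_mult. ring. }
    eapply Rle_trans; [apply Cmod_triangle|].
    eapply Rle_trans; [apply Rplus_le_compat_r, Cmod_triangle|].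
    rewrite !Cmod_mult, Cmod_circ, !Cmod_R.
    assert (P := Rabs_pos x).
    assert (Rabs x * Cmod (circ y - 1) <= Rabs x * (e / 3)) by (apply Rmult_le_compat_l; lra).
    assert (e / 3 * Rabs x <= e / 3 * Cmod h) by (apply Rmult_le_compat_l; lra).
    assert (e / 3 * Rabs y <= e / 3 * Cmod h) by (apply Rmult_le_compat_l; lra).
    lra. }
  intros e He.
  assert (Pz : 0 < Cmod (cexp z)) by (rewrite Cmod_cexp; apply exp_pos).
  destruct (D0 (e / Cmod (cexp z))) as [d [Hd K]]; [now apply Rdiv_lt_0_compat|].
  exists d. split; [exact Hd|]. intros w Hw. specialize (K _ Hw).
  replace (cexp w) with (cexp z * cexp (w - z))%C
    by (rewrite <- cexp_plus; f_equal; ring).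
  replace (cexp z * cexp (w - z) - cexp z - cexp z * (w - z))%C with
    (cexp z * (cexp (w - z) - 1 - (w - z)))%C by ring.
  rewrite Cmod_mult. apply Rle_trans with (Cmod (cexp z) * (e / Cmod (cexp z) * Cmod (w - z))).
  - apply Rmult_le_compat_l; lra.
  - right. field. lra.
Qed.

Lemma clim_clog_1 : clim (Cnear (RtoC 1)) clog (RtoC 0).
Proof.
  assert (Hln : continuous ln 1).
  { apply (ex_derive_continuous (K := R_AbsRing) (V := R_NormedModule)).
    exists (/ 1). apply is_derive_ln. lra. }
  assert (Hat : continuous atan 0).
  { apply (ex_derive_continuous (K := R_AbsRing) (V := R_NormedModule)).
    eexists. apply is_derive_atan. }
  intros e He. assert (He2 : 0 < e / 2) by lra.
  destruct (Hln (fun y => Rabs (y - ln 1) < e / 2)) as [d1 K1].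
  { exists (mkposreal _ He2). intros y Hy. exact Hy. }
  destruct (Hat (fun y => Rabs (y - atan 0) < e / 2)) as [d2 K2].
  { exists (mkposreal _ He2). intros y Hy. exact Hy. }
  assert (P1 := cond_pos d1). assert (P2 := cond_pos d2).
  exists (Rmin (1 / 2) (Rmin d1 (d2 / 2))). split; [repeat apply Rmin_pos; lra|].
  intros q Hq.
  assert (M1 := Rmin_l (1 / 2) (Rmin d1 (d2 / 2))).
  assert (M2 := Rmin_r (1 / 2) (Rmin d1 (d2 / 2))).
  assert (M3 := Rmin_l d1 (d2 / 2)). assert (M4 := Rmin_r d1 (d2 / 2)).
  assert (R1 := Re_le_Cmod (q - 1)). assert (I1 := Im_le_Cmod (q - 1)).
  change (Re (q - 1)%C) with (Re q - 1) in R1.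
  replace (Im (q - 1)%C) with (Im q) in I1 by (unfold Im; simpl; ring).
  assert (Rq : 1 / 2 <= Re q) by (apply Rabs_le_between in R1; lra).
  specialize (K1 (Cmod q)). specialize (K2 (Im q / Re q)).
  rewrite ln_1 in K1. rewrite atan_0 in K2.
  assert (A1 : Rabs (ln (Cmod q) - 0) < e / 2).
  { apply K1. change (Rabs (Cmod q - 1) < d1).
    assert (T1 := Cmod_sub_ge q 1). assert (T2 := Cmod_sub_ge 1 q).
    rewrite (Cmod_sub_sym 1 q) in T2. rewrite Cmod_1 in T1, T2.
    apply Rabs_def1; lra. }
  assert (A2 : Rabs (atan (Im q / Re q) - 0) < e / 2).
  { apply K2. change (Rabs (Im q / Re q - 0) < d2). rewrite Rminus_0_r.
    unfold Rdiv. rewrite Rabs_mult, Rabs_inv, (Rabs_pos_eq (Re q)) by lra.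
    apply Rle_lt_trans with (Rabs (Im q) * 2).
    - apply Rmult_le_compat_l; [apply Rabs_pos|].
      replace 2 with (/ (1 / 2)) by field. apply Rinv_le_contravar; lra.
    - lra. }
  eapply Rle_lt_trans; [apply Cmod_le_Re_Im|].
  replace (Re (clog q - 0)%C) with (ln (Cmod q) - 0) by (unfold clog, Re; simpl; ring).
  replace (Im (clog q - 0)%C) with (atan (Im q / Re q) - 0) by (unfold clog, Im; simpl; ring).
  lra.
Qed.

(** * The boundary orbit of the Denjoy-Wolff point *)

Section Boundary.
Variables (phi : R -> C -> C) (tau : C) (lambda : R).
Hypothesis sg : semigroup phi.
Hypothesis dw : denjoy_wolff_spectral phi tau lambda.

Definition dil (t : R) : R := exp (- lambda * t).

Lemma tau_unit : Cmod tau = 1.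
Proof. apply dw. Qed.

Lemma dil_pos (t : R) : 0 < dil t.
Proof. apply exp_pos. Qed.

Lemma dil_le_1 (t : R) : 0 <= t -> dil t <= 1.
Proof.
  intros Ht. unfold dil. rewrite <- exp_0. destruct dw as [_ [Hl _]].
  assert (H : - lambda * t <= 0) by nra. destruct H as [H|H].
  - left. now apply exp_increasing.
  - rewrite H. lra.
Qed.

Lemma dil_plus (s t : R) : dil (t + s) = dil t * dil s.
Proof. unfold dil. rewrite <- exp_plus. f_equal. ring. Qed.

Lemma liminf_upper (t : R) : 0 <= t -> forall eta, 0 < eta -> exists w, disc w /\
  Cmod (w - tau) < eta /\ (1 - Cmod (phi t w)) / (1 - Cmod w) < dil t + eta.
Proof.
  intros Ht eta Heta. destruct dw as [_ [_ H]].
  destruct (H t Ht (mkposreal eta Heta)) as [U _].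
  destruct (U (fun w => disc w /\ Cmod (w - tau) < eta)) as [w [[W1 W2] W3]].
  - apply Cnear_locally. exists eta. split; [exact Heta|]. intros w Hw Dw. now split.
  - exists w. repeat split; auto.
Qed.

Lemma liminf_lower (t : R) : 0 <= t -> forall e, 0 < e -> exists d, 0 < d /\
  forall z, disc z -> Cmod (z - tau) < d ->
    dil t - e <= (1 - Cmod (phi t z)) / (1 - Cmod z).
Proof.
  intros Ht e He. destruct dw as [_ [_ H]].
  destruct (H t Ht (mkposreal e He)) as [_ L].
  apply Cnear_locally in L. destruct L as [d [Hd L]]. exists d. split; [exact Hd|].
  intros z Hz Hzd. left. exact (L z Hzd Hz).
Qed.

(** [phi t] sends the boundary point [tau] to [sig t] with angular derivative of
    modulus [dil t]; that [sig] is constant is only known at the end. *)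
Lemma boundary_orbit_exists : exists sig : R -> C,
  (forall t, 0 <= t -> Cmod (sig t) = 1) /\
  (forall t z, 0 <= t -> disc z ->
     Cmod (sig t - phi t z) ^ 2 * (1 - Cmod z ^ 2) <=
     dil t * Cmod (tau - z) ^ 2 * (1 - Cmod (phi t z) ^ 2)) /\
  (forall t, 0 <= t -> forall e, 0 < e -> exists d, 0 < d < 1 /\ forall x, 0 < x < d ->
     Cmod (phi t (RtoC (1 - x) * tau)%C - sig t * RtoC (1 - dil t * x)) <= e * x).
Proof.
  assert (Ex : forall t, exists b, 0 <= t -> Cmod b = 1 /\ approach (phi t) tau b (dil t)).
  { intros t. destruct (Rle_dec 0 t) as [Ht|Ht].
    - destruct (boundary_value_exists (phi t) tau (dil t)) as [b Hb].
      + now apply sg_self_map.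
      + exact tau_unit.
      + left. apply dil_pos.
      + now apply liminf_upper.
      + exists b. intros _. exact Hb.
    - exists (RtoC 0). intros H. contradiction. }
  destruct (choice _ Ex) as [sig Hsig]. exists sig.
  assert (J : forall t z, 0 <= t -> disc z ->
     Cmod (sig t - phi t z) ^ 2 * (1 - Cmod z ^ 2) <=
     dil t * Cmod (tau - z) ^ 2 * (1 - Cmod (phi t z) ^ 2)).
  { intros t z Ht Hz. destruct (Hsig t Ht) as [S1 S2]. apply julia; auto.
    - now apply sg_self_map.
    - exact tau_unit.
    - left. apply dil_pos. }
  split; [|split; [exact J|]].
  - intros t Ht. now apply Hsig.
  - intros t Ht. apply julia_caratheodory.
    + now apply sg_self_map.
    + exact tau_unit.
    + now apply Hsig.
    + left. apply dil_pos.
    + intros z Hz. now apply J.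
    + now apply liminf_lower.
Qed.

Section Orbit.
Variable sig : R -> C.
Hypothesis sig_unit : forall t, 0 <= t -> Cmod (sig t) = 1.
Hypothesis sig_radial : forall t, 0 <= t -> forall e, 0 < e ->
  exists d, 0 < d < 1 /\ forall x, 0 < x < d ->
    Cmod (phi t (RtoC (1 - x) * tau)%C - sig t * RtoC (1 - dil t * x)) <= e * x.

Lemma radial_disc (a : C) (x : R) : Cmod a = 1 -> 0 < x <= 1 -> disc (RtoC (1 - x) * a)%C.
Proof.
  intros Ha Hx. unfold disc. rewrite Cmod_mult, Ha, Cmod_R, Rabs_pos_eq; lra.
Qed.

Lemma radial_value (t x e : R) : 0 <= t -> 0 < x < 1 ->
  Cmod (phi t (RtoC (1 - x) * tau)%C - sig t * RtoC (1 - dil t * x)) <= e * x ->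
  Rabs ((1 - Cmod (phi t (RtoC (1 - x) * tau)%C)) - dil t * x) <= e * x /\
  Cmod (phi t (RtoC (1 - x) * tau)%C - sig t) <= (e + 1) * x.
Proof.
  intros Ht Hx H. set (w := phi t (RtoC (1 - x) * tau)%C) in *.
  assert (D1 := dil_pos t). assert (D2 := dil_le_1 t Ht).
  assert (D3 : dil t * x <= x) by nra. assert (D4 : 0 < dil t * x) by nra.
  assert (M : Cmod (sig t * RtoC (1 - dil t * x)) = 1 - dil t * x).
  { rewrite Cmod_mult, sig_unit, Cmod_R, Rabs_pos_eq by (assumption || lra). ring. }
  split.
  - assert (A := Cmod_sub_ge w (sig t * RtoC (1 - dil t * x))).
    assert (B := Cmod_sub_ge (sig t * RtoC (1 - dil t * x)) w).
    rewrite (Cmod_sub_sym _ w) in B. rewrite M in A, B. apply Rabs_le. lra.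
  - eapply Rle_trans; [apply (Cmod_sub_triangle _ (sig t * RtoC (1 - dil t * x)))|].
    assert (Cmod (sig t * RtoC (1 - dil t * x) - sig t) <= x).
    { replace (sig t * RtoC (1 - dil t * x) - sig t)%C with (- (sig t * RtoC (dil t * x)))%C
        by (rewrite RtoC_minus; ring).
      rewrite Cmod_opp, Cmod_mult, sig_unit, Cmod_R, Rabs_pos_eq by (assumption || lra). lra. }
    lra.
Qed.

(** The chain rule for angular derivatives along the image of the radius:
    [phi t] has dilation [dil (t + s) / dil s = dil t] at [sig s]. *)
Lemma sig_approach (s t : R) : 0 <= s -> 0 <= t ->
  approach (phi t) (sig s) (sig (t + s)) (dil t).
Proof.
  intros Hs Ht eta Heta.
  assert (Hts : 0 <= t + s) by lra.
  assert (D1 := dil_pos s). assert (D2 := dil_le_1 t Ht). assert (D3 := dil_pos t).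
  set (e := Rmin (Rmin 1 (dil s / 2)) (eta * dil s / (2 * (2 + eta)))).
  assert (He : 0 < e).
  { repeat apply Rmin_pos; try lra. apply Rdiv_lt_0_compat; [|lra]. now apply Rmult_lt_0_compat. }
  assert (e1 : e <= 1) by (eapply Rle_trans; [apply Rmin_l|apply Rmin_l]).
  assert (e2 : e <= dil s / 2) by (eapply Rle_trans; [apply Rmin_l|apply Rmin_r]).
  assert (e3 : e <= eta * dil s / (2 * (2 + eta))) by apply Rmin_r.
  destruct (sig_radial s Hs e He) as [d1 [Hd1 K1]].
  destruct (sig_radial (t + s) Hts e He) as [d2 [Hd2 K2]].
  set (x := Rmin (Rmin (d1 / 2) (d2 / 2)) (eta / 4)).
  assert (Hx : 0 < x) by (repeat apply Rmin_pos; lra).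
  assert (x1 : x <= d1 / 2) by (eapply Rle_trans; [apply Rmin_l|apply Rmin_l]).
  assert (x2 : x <= d2 / 2) by (eapply Rle_trans; [apply Rmin_l|apply Rmin_r]).
  assert (x3 : x <= eta / 4) by apply Rmin_r.
  specialize (K1 x ltac:(lra)). specialize (K2 x ltac:(lra)).
  set (z := (RtoC (1 - x) * tau)%C) in *.
  assert (Hz : disc z) by (apply radial_disc; [exact tau_unit|lra]).
  destruct (radial_value s x e Hs ltac:(lra) K1) as [V1 V2].
  destruct (radial_value (t + s) x e Hts ltac:(lra) K2) as [V3 V4].
  fold z in V1, V2, V3, V4.
  assert (Es : phi (t + s) z = phi t (phi s z)) by now apply (hom_add _ _ _ sg).
  rewrite Es in V3, V4.
  assert (Hw : disc (phi s z)) by now apply (sg_self_map phi sg).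
  exists (phi s z). split; [exact Hw|]. split; [|split].
  - eapply Rle_lt_trans; [exact V2|]. nra.
  - eapply Rle_lt_trans; [exact V4|]. nra.
  - apply Rabs_le_between in V1. apply Rabs_le_between in V3. rewrite dil_plus in V3.
    unfold disc in Hw.
    apply Rmult_lt_reg_r with (1 - Cmod (phi s z)); [lra|].
    unfold Rdiv. rewrite Rmult_assoc, Rinv_l, Rmult_1_r by lra.
    apply Rle_lt_trans with ((dil t * dil s + e) * x); [lra|].
    apply Rlt_le_trans with ((dil t + eta) * ((dil s - e) * x)).
    + rewrite <- Rmult_assoc. apply Rmult_lt_compat_r; [exact Hx|].
      assert (E1 : e * (2 + eta) <= eta * dil s / 2).
      { apply Rle_trans with (eta * dil s / (2 * (2 + eta)) * (2 + eta)).
        - apply Rmult_le_compat_r; lra.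
        - right. field. lra. }
      assert (0 < eta * dil s) by now apply Rmult_lt_0_compat.
      assert (e * dil t <= e * 1) by (apply Rmult_le_compat_l; lra). nra.
    + apply Rmult_le_compat_l; lra.
Qed.

Lemma sig_julia (s t : R) (z : C) : 0 <= s -> 0 <= t -> disc z ->
  Cmod (sig (t + s) - phi t z) ^ 2 * (1 - Cmod z ^ 2) <=
  dil t * Cmod (sig s - z) ^ 2 * (1 - Cmod (phi t z) ^ 2).
Proof.
  intros Hs Ht Hz. apply julia; auto.
  - now apply sg_self_map.
  - apply sig_unit. lra.
  - left. apply dil_pos.
  - now apply sig_approach.
Qed.

(** Julia's inequality on the radius ending at [sig s].  The bound depends neither
    on [s] nor on [t], so along an arc filled by [sig] the boundary values of
    [phi t] are attained uniformly, and [sig] inherits the continuity of the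
    orbits in the disc. *)
Lemma sig_radial_unif (s t x : R) : 0 <= s -> 0 <= t -> 0 < x <= 1 ->
  Cmod (sig (t + s) - phi t (RtoC (1 - x) * sig s)%C) ^ 2 <= x.
Proof.
  intros Hs Ht Hx.
  assert (Hz : disc (RtoC (1 - x) * sig s)%C) by (apply radial_disc; auto).
  assert (K := sig_julia s t _ Hs Ht Hz). set (z := (RtoC (1 - x) * sig s)%C) in *.
  assert (Mz : Cmod z = 1 - x).
  { unfold z. rewrite Cmod_mult, sig_unit, Cmod_R, Rabs_pos_eq by (assumption || lra). ring. }
  assert (Dz : Cmod (sig s - z) = x).
  { unfold z. replace (sig s - RtoC (1 - x) * sig s)%C with (RtoC x * sig s)%C
      by (rewrite RtoC_minus; ring).
    rewrite Cmod_mult, sig_unit, Cmod_R, Rabs_pos_eq by (assumption || lra). ring. }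
  rewrite Mz, Dz in K.
  assert (D1 := dil_pos t). assert (D2 := dil_le_1 t Ht).
  set (X := Cmod (sig (t + s) - phi t z) ^ 2) in *.
  assert (HX : 0 <= X) by apply pow2_ge_0.
  assert (F1 : 0 < 1 - Cmod (phi t z) ^ 2) by (apply disc_sqr; now apply (sg_self_map phi sg)).
  assert (F2 : 1 - Cmod (phi t z) ^ 2 <= 1) by (assert (H := pow2_ge_0 (Cmod (phi t z))); lra).
  assert (K2 : dil t * x ^ 2 * (1 - Cmod (phi t z) ^ 2) <= x ^ 2).
  { assert (P : 0 <= x ^ 2) by apply pow2_ge_0.
    apply Rle_trans with (1 * x ^ 2 * 1); [|lra].
    apply Rmult_le_compat; try lra.
    - apply Rmult_le_pos; lra.
    - apply Rmult_le_compat_r; lra. }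
  apply Rmult_le_reg_r with (x * (2 - x)); [apply Rmult_lt_0_compat; lra|].
  replace (X * (x * (2 - x))) with (X * (1 - (1 - x) ^ 2)) by ring. nra.
Qed.

End Orbit.
End Boundary.

(** * Reflection across an arc of contact *)

Lemma cdiff_reflect (f : C -> C) (z l : C) :
  cdiff f (- Cconj z)%C l -> cdiff (fun w => Cconj (f (- Cconj w)))%C z (- Cconj l)%C.
Proof.
  intros H e He. destruct (H e He) as [d [Hd K]]. exists d. split; [exact Hd|].
  intros w Hw.
  assert (E : (- Cconj w - - Cconj z = - Cconj (w - z))%C) by (rewrite Cminus_conj; ring).
  assert (N : Cmod (- Cconj w - - Cconj z) = Cmod (w - z))
    by (now rewrite E, Cmod_opp, Cmod_conj).
  specialize (K (- Cconj w)%C). rewrite N in K. specialize (K Hw). rewrite E in K.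
  replace (Cconj (f (- Cconj w)) - Cconj (f (- Cconj z)) - - Cconj l * (w - z))%C with
    (Cconj (f (- Cconj w) - f (- Cconj z) - l * - Cconj (w - z)))%C.
  - now rewrite Cmod_conj.
  - rewrite !Cminus_conj, Cmult_conj, Copp_conj, Cminus_conj, !Cconj_conj. ring.
Qed.

Lemma cexp_disc (tau w : C) : Cmod tau = 1 -> Re w < 0 -> disc (tau * cexp w)%C.
Proof.
  intros tu Hw. unfold disc. rewrite Cmod_mult, tu, Cmod_cexp, Rmult_1_l, <- exp_0.
  now apply exp_increasing.
Qed.

Lemma clim_at_right_id : clim (at_right 0) (fun x => RtoC x) (RtoC 0).
Proof.
  intros e He. exists (mkposreal e He). intros x Hx _.
  replace (RtoC x - RtoC 0)%C with (RtoC x) by ring. rewrite Cmod_R.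
  change (Rabs (x - 0) < e) in Hx. now rewrite Rminus_0_r in Hx.
Qed.

Lemma at_right_spec (P : R -> Prop) (d : R) :
  0 < d -> (forall x, 0 < x < d -> P x) -> at_right 0 P.
Proof.
  intros Hd H. exists (mkposreal d Hd). intros x Hx Hx0. apply H.
  change (Rabs (x - 0) < d) in Hx. rewrite Rminus_0_r, Rabs_pos_eq in Hx; lra.
Qed.

(** Schwarz reflection across an arc on which the boundary values have modulus 1.
    The reflected function is [1 / conj f (- conj w)]; the two halves match
    continuously along the imaginary axis, a vertical line, which is removable. *)
Theorem schwarz_reflection (f : C -> C) (Sg : R -> C) (th0 eta : R) :
  0 < eta -> (forall w, Re w < 0 -> exists l, cdiff f w l) ->
  (forall th, Rabs (th - th0) < eta -> Cmod (Sg th) = 1) ->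
  (forall x th, x < 0 -> Rabs (th - th0) < eta -> Cmod (Sg th - f (x, th)) ^ 2 <= - x) ->
  exists (F : C -> C) (r : R), 0 < r <= eta /\ hol_ball F (0, th0) r /\
    (forall w, Re w < 0 -> F w = f w) /\ (forall th, F (0, th) = Sg th).
Proof.
  intros Heta fd Sg_unit K1.
  assert (hol_cont : forall w, Re w < 0 -> ccont f w).
  { intros w Hw. destruct (fd w Hw) as [l Hl]. exact (cdiff_cont _ _ _ Hl). }
  set (r := Rmin eta (1 / 16)).
  assert (Hr : 0 < r) by (apply Rmin_pos; lra).
  assert (r1 : r <= eta) by apply Rmin_l. assert (r2 : r <= 1 / 16) by apply Rmin_r.
  set (c0 := (0, th0) : C).
  assert (inb : forall w, inball c0 r w -> Rabs (Re w) < r /\ Rabs (Im w - th0) < r).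
  { intros w Hw. unfold inball in Hw. split.
    - eapply Rle_lt_trans; [|exact Hw]. replace (Re w) with (Re (w - c0)%C)
        by (unfold Re; simpl; ring). apply Re_le_Cmod.
    - eapply Rle_lt_trans; [|exact Hw]. apply (Im_le_Cmod (w - c0)). }
  (* The radius [1 / 16] keeps [f] within [1 / 4] of the unit circle, away from [0]. *)
  assert (flow : forall x th, - r < x < 0 -> Rabs (th - th0) < eta -> 3 / 4 <= Cmod (f (x, th))).
  { intros x th Hx Hth. assert (K := K1 x th ltac:(lra) Hth).
    assert (P := Cmod_ge_0 (Sg th - f (x, th))).
    assert (Cmod (Sg th - f (x, th)) <= 1 / 4) by nra.
    assert (T := Cmod_sub_ge (Sg th) (f (x, th))). rewrite Sg_unit in T by exact Hth. lra. }
  set (F := fun w => if Rlt_dec (Re w) 0 then f w else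
    if Req_EM_T (Re w) 0 then Sg (Im w) else (/ Cconj (f (- Cconj w)))%C).
  assert (Fneg : forall w, Re w < 0 -> F w = f w).
  { intros w Hw. unfold F. destruct Rlt_dec; [reflexivity|lra]. }
  assert (Fzero : forall w, Re w = 0 -> F w = Sg (Im w)).
  { intros w Hw. unfold F. destruct Rlt_dec; [lra|]. destruct Req_EM_T; [reflexivity|lra]. }
  assert (Fpos : forall w, 0 < Re w -> F w = (/ Cconj (f (- Cconj w)))%C).
  { intros w Hw. unfold F. destruct Rlt_dec; [lra|]. destruct Req_EM_T; [lra|reflexivity]. }
  assert (refl : forall w, (- Cconj w)%C = (- Re w, Im w)).
  { intros w. apply Ceq; unfold Re, Im; simpl; ring. }
  assert (pairE : forall w : C, w = (Re w, Im w)) by (intros [a b]; reflexivity).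
  assert (K2 : forall w, inball c0 r w -> Cmod (F w - Sg (Im w)) ^ 2 <= 4 * Rabs (Re w)).
  { intros w Hw. destruct (inb w Hw) as [I1 I2].
    assert (I3 : Rabs (Im w - th0) < eta) by lra.
    destruct (Rtotal_order (Re w) 0) as [L|[L|L]].
    - rewrite Fneg by exact L. rewrite (pairE w) at 1. rewrite Cmod_sub_sym.
      rewrite (Rabs_left (Re w)) by exact L. assert (K := K1 (Re w) (Im w) L I3). lra.
    - rewrite Fzero by exact L. rewrite Cmod_sub_self, L, Rabs_R0. lra.
    - rewrite Fpos by exact L. rewrite refl. rewrite Rabs_pos_eq in I1 |- * by lra.
      assert (K := K1 (- Re w) (Im w) ltac:(lra) I3).
      assert (Lo := flow (- Re w) (Im w) ltac:(lra) I3).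
      set (q := f (- Re w, Im w)) in *. set (S0 := Sg (Im w)) in *.
      assert (Nq : Cconj q <> RtoC 0) by (apply Cmod_gt_0; rewrite Cmod_conj; lra).
      assert (U : (S0 * Cconj S0)%C = RtoC 1).
      { assert (E := Cmod2_conj S0). unfold S0 in *. rewrite Sg_unit, pow1 in E by exact I3.
        now rewrite <- E. }
      assert (Eq : (/ Cconj q - S0 = S0 * Cconj (S0 - q) / Cconj q)%C).
      { rewrite Cminus_conj.
        replace (S0 * (Cconj S0 - Cconj q))%C with (S0 * Cconj S0 - S0 * Cconj q)%C by ring.
        rewrite U. field. exact Nq. }
      rewrite Eq, Cmod_div, Cmod_mult, !Cmod_conj by exact Nq.
      unfold S0 at 1. rewrite Sg_unit by exact I3. rewrite Rmult_1_l.
      set (X := Cmod (S0 - q)) in *. assert (PX : 0 <= X) by apply Cmod_ge_0.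
      assert (HX : X / Cmod q <= 2 * X).
      { apply Rmult_le_reg_r with (Cmod q); [lra|]. unfold Rdiv.
        rewrite Rmult_assoc, Rinv_l, Rmult_1_r by lra. nra. }
      assert (0 <= X / Cmod q) by (apply Rmult_le_pos; [exact PX|left; apply Rinv_0_lt_compat; lra]).
      nra. }
  assert (K3 : forall th, Rabs (th - th0) < eta -> forall e, 0 < e -> exists d, 0 < d /\
    forall th', Rabs (th' - th) < d -> Rabs (th' - th0) < eta -> Cmod (Sg th' - Sg th) < e).
  { intros th Hth e He.
    set (h := Rmin 1 (e * e / 16)).
    assert (Hh : 0 < h) by (apply Rmin_pos; [lra|]; assert (0 < e * e) by (now apply Rmult_lt_0_compat); lra).
    assert (h2 : h <= e * e / 16) by apply Rmin_r.
    assert (Hc := hol_cont (- h, th) ltac:(unfold Re; simpl; lra)).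
    assert (He3 : 0 < e / 3) by lra.
    destruct (Hc _ He3) as [d [Hd K]]. exists d. split; [exact Hd|].
    intros th' Hd' Hth'.
    assert (A : forall u, Rabs (u - th0) < eta -> Cmod (Sg u - f (- h, u)) < e / 3).
    { intros u Hu. assert (B := K1 (- h) u ltac:(lra) Hu).
      assert (P := Cmod_ge_0 (Sg u - f (- h, u))). nra. }
    assert (A1 := A th Hth). assert (A2 := A th' Hth').
    assert (A3 : Cmod (f (- h, th') - f (- h, th)) < e / 3).
    { apply K. eapply Rle_lt_trans; [apply Cmod_pair_sub|].
      rewrite Rminus_eq_0, Rabs_R0, Rplus_0_l. exact Hd'. }
    rewrite Cmod_sub_sym in A1.
    assert (T1 := Cmod_sub_triangle (Sg th') (f (- h, th')) (Sg th)).
    assert (T2 := Cmod_sub_triangle (f (- h, th')) (f (- h, th)) (Sg th)). lra. }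
  assert (Fd : forall w, inball c0 r w -> Re w <> 0 -> exists l, cdiff F w l).
  { intros w Hw Hre. destruct (inb w Hw) as [I1 I2].
    destruct (Rlt_le_dec (Re w) 0) as [L|L].
    - destruct (fd w L) as [l Hl]. exists l. apply (cdiff_ext f); [|exact Hl].
      exists (- Re w). split; [lra|]. intros v Hv. symmetry. apply Fneg.
      assert (Q := Re_close v w). lra.
    - assert (L' : 0 < Re w) by lra. rewrite Rabs_pos_eq in I1 by lra.
      destruct (fd (- Cconj w)%C) as [l Hl]; [rewrite refl; unfold Re at 1; simpl; lra|].
      eexists. apply (cdiff_ext (fun v => / Cconj (f (- Cconj v)))%C).
      + exists (Re w). split; [lra|]. intros v Hv. symmetry. apply Fpos.
        assert (Q := Re_close v w). lra.
      + apply (cdiff_comp Cinv (fun v => Cconj (f (- Cconj v)))%C).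
        * apply cdiff_inv. apply Cmod_gt_0. rewrite Cmod_conj, refl.
          assert (Lo := flow (- Re w) (Im w) ltac:(lra) ltac:(lra)). lra.
        * apply cdiff_reflect. exact Hl. }
  assert (Fc : forall w, inball c0 r w -> ccont F w).
  { intros w Hw. destruct (Req_dec (Re w) 0) as [E|E].
    2:{ destruct (Fd w Hw E) as [l Hl]. exact (cdiff_cont _ _ _ Hl). }
    destruct w as [x th]. assert (E' : x = 0) by exact E. subst x. clear E.
    destruct (inb _ Hw) as [_ I2]. change (Im (0, th)) with th in I2. intros e He.
    destruct (K3 th ltac:(lra) (e / 2) ltac:(lra)) as [d [Hd K]].
    destruct (inball_open _ _ _ Hw) as [d' [Hd' B]].
    assert (Hee : 0 < e * e / 16) by (assert (0 < e * e) by (now apply Rmult_lt_0_compat); lra).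
    exists (Rmin (Rmin d d') (e * e / 16)). split; [repeat apply Rmin_pos; assumption|].
    intros v Hv.
    assert (M1 := Rmin_l (Rmin d d') (e * e / 16)). assert (M2 := Rmin_r (Rmin d d') (e * e / 16)).
    assert (M3 := Rmin_l d d'). assert (M4 := Rmin_r d d').
    assert (Hvb : inball c0 r v) by (apply B; lra).
    destruct (inb v Hvb) as [J1 J2].
    assert (Q1 := Re_le_Cmod (v - (0, th))). assert (Q2 := Im_le_Cmod (v - (0, th))).
    replace (Re (v - (0, th))%C) with (Re v) in Q1 by (unfold Re; simpl; ring).
    change (Im (v - (0, th))%C) with (Im v - th) in Q2.
    assert (A1 := K2 v Hvb).
    assert (A2 : Cmod (Sg (Im v) - Sg th) < e / 2) by (apply K; lra).
    rewrite (Fzero (0, th)) by reflexivity. change (Im (0, th)) with th.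
    assert (P := Cmod_ge_0 (F v - Sg (Im v))).
    assert (A3 : Cmod (F v - Sg (Im v)) < e / 2) by nra.
    assert (T := Cmod_sub_triangle (F v) (Sg (Im v)) (Sg th)). lra. }
  exists F, r. split; [lra|]. split; [exact (painleve F c0 r 0 Fc Fd)|].
  split; [exact Fneg|]. intros th. now rewrite Fzero.
Qed.

(** In the coordinate [z = tau * cexp w] the equation [F' = c F] reads
    [z * f' z = c * f z].  It spreads from the arc to the whole disc by the
    identity theorem, applied on a disc recentred by an automorphism, and at
    [z = 0] it leaves [c * f 0 = 0]. *)
Lemma euler_equation_fixes_zero (f F : C -> C) (tau c : C) (th0 r : R) :
  self_map f -> Cmod tau = 1 -> c <> RtoC 0 -> 0 < r -> hol_ball F (0, th0) r ->
  (forall w, Re w < 0 -> F w = f (tau * cexp w)%C) ->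
  (forall th, Rabs (th - th0) < r -> C_derive F (0, th) = (c * F (0, th))%C) ->
  f (RtoC 0) = RtoC 0.
Proof.
  intros sm tu Nd Hr HF Fneg K4. set (c0 := (0, th0) : C).
  assert (in_disc := fun w => cexp_disc tau w tu).
  assert (K5 : forall w, inball c0 r w -> (C_derive F w - c * F w)%C = RtoC 0).
  { apply (identity_theorem (fun w => C_derive F w - c * F w)%C).
    - apply hol_ball_sub; [now apply hol_ball_derive|].
      intros w Hw. destruct (HF w Hw) as [l Hl]. eexists. apply cdiff_scal. exact Hl.
    - intros d Hd. set (h := Rmin (d / 2) (r / 2)). assert (Hh : 0 < h) by (apply Rmin_pos; lra).
      assert (H1 := Rmin_l (d / 2) (r / 2)). assert (H2 := Rmin_r (d / 2) (r / 2)). fold h in H1, H2.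
      exists (0, th0 + h). split; [|split].
      + intros E. apply (f_equal Im) in E. unfold c0, Im in E. simpl in E. lra.
      + eapply Rle_lt_trans; [apply Cmod_pair_sub|].
        replace (th0 + h - th0) with h by ring.
        rewrite Rminus_eq_0, Rabs_R0, Rabs_pos_eq; lra.
      + rewrite K4; [ring|]. replace (th0 + h - th0) with h by ring. rewrite Rabs_pos_eq; lra. }
  set (K := fun z => (z * C_derive f z - c * f z)%C).
  assert (K6 : forall w, inball c0 r w -> Re w < 0 -> K (tau * cexp w)%C = RtoC 0).
  { intros w Hw L. rewrite <- (K5 w Hw), Fneg by exact L. unfold K.
    rewrite (cdiff_C_derive F w (C_derive f (tau * cexp w) * (tau * cexp w))%C); [ring|].
    apply (cdiff_ext (fun w => f (tau * cexp w)%C)).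
    - exists (- Re w). split; [lra|]. intros v Hv. symmetry. apply Fneg.
      assert (Q := Re_close v w). lra.
    - apply (cdiff_comp f (fun w => tau * cexp w)%C); [|apply cdiff_scal, cdiff_cexp].
      apply (hol_ball_C_derive _ (RtoC 0) 1); [apply sm|]. now apply (proj1 (disc_inball _)), in_disc. }
  assert (HK : hol_ball K (RtoC 0) 1).
  { apply hol_ball_sub.
    - intros z Hz. destruct (hol_ball_derive _ _ _ (proj1 sm) z Hz) as [l Hl]. eexists.
      apply (cdiff_mult (fun z => z) (C_derive f)); [apply cdiff_id|exact Hl].
    - intros z Hz. destruct (proj1 sm z Hz) as [l Hl]. eexists. apply cdiff_scal. exact Hl. }
  set (pt := fun h => (tau * cexp ((- (r / 2) - h)%R, th0))%C).
  assert (pt_disc : forall h, 0 <= h -> disc (pt h)).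
  { intros h Hh. apply in_disc. unfold Re; simpl. lra. }
  assert (pt_mod : forall h, Cmod (pt h) = exp (- (r / 2) - h)).
  { intros h. unfold pt. rewrite Cmod_mult, tu, Cmod_cexp, Rmult_1_l. reflexivity. }
  assert (Kpt : forall h, 0 <= h < r / 4 -> K (pt h) = RtoC 0).
  { intros h Hh. apply K6.
    - unfold inball. eapply Rle_lt_trans; [apply Cmod_pair_sub|].
      rewrite Rminus_eq_0, Rabs_R0, Rabs_left; lra.
    - unfold Re; simpl. lra. }
  set (z1 := pt 0). assert (Hz1 : disc z1) by (apply pt_disc; lra).
  assert (Hz1' : disc (- z1)) by (unfold disc; now rewrite Cmod_opp).
  assert (B0 : blaschke z1 z1 = RtoC 0) by (unfold blaschke, Cdiv; ring).
  assert (Kz : K (blaschke (- z1) (- z1)%C) = RtoC 0).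
  { apply (identity_theorem (fun u => K (blaschke (- z1) u)) (RtoC 0) 1).
    - intros u Hu. assert (Hud := proj2 (disc_inball u) Hu).
      destruct (proj1 (blaschke_self_map _ Hz1') u Hu) as [l Hl].
      destruct (HK (blaschke (- z1) u)) as [m Hm].
      + apply (proj1 (disc_inball _)). now apply (blaschke_self_map _ Hz1').
      + eexists. apply (cdiff_comp K (blaschke (- z1))); eassumption.
    - intros d Hd.
      destruct (proj1 (blaschke_self_map _ Hz1) z1 (proj1 (disc_inball _) Hz1)) as [l Hl].
      destruct (cdiff_cont _ _ _ Hl d Hd) as [d1 [Hd1 C1]]. rewrite B0 in C1.
      assert (Cp : ccont (fun w => tau * cexp w)%C ((- (r / 2) - 0)%R, th0)).
      { refine (cdiff_cont _ _ _ (cdiff_scal _ _ _ _ (cdiff_cexp _))). }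
      destruct (Cp d1 Hd1) as [d2 [Hd2 C2]].
      set (h := Rmin (r / 8) (d2 / 2)). assert (Hh : 0 < h) by (apply Rmin_pos; lra).
      assert (H1 := Rmin_l (r / 8) (d2 / 2)). assert (H2 := Rmin_r (r / 8) (d2 / 2)).
      fold h in H1, H2.
      assert (Inv : blaschke (- z1) (blaschke z1 (pt h)) = pt h)
        by (apply blaschke_inv; [exact Hz1|apply pt_disc; lra]).
      exists (blaschke z1 (pt h)). split; [|split].
      + intros E. rewrite E, <- B0, blaschke_inv in Inv by exact Hz1.
        apply (f_equal Cmod) in Inv. unfold z1 in Inv. rewrite !pt_mod in Inv.
        apply exp_inv in Inv. lra.
      + apply C1. apply C2. eapply Rle_lt_trans; [apply Cmod_pair_sub|].
        rewrite Rminus_eq_0, Rabs_R0, Rabs_left1; lra.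
      + rewrite Inv. apply Kpt. lra.
    - now apply (proj1 (disc_inball _)). }
  replace (blaschke (- z1) (- z1)%C) with (RtoC 0) in Kz by (unfold blaschke, Cdiv; ring).
  unfold K in Kz.
  replace (f (RtoC 0)) with (- / c *
    (0 * C_derive f 0 - c * f (RtoC 0)))%C by (field; exact Nd).
  rewrite Kz. ring.
Qed.

Section Arc.
Variables (phi : R -> C -> C) (tau : C) (lambda : R).
Hypothesis sg : semigroup phi.
Hypothesis dw : denjoy_wolff_spectral phi tau lambda.
Variable sig : R -> C.
Hypothesis sig_unit : forall t, 0 <= t -> Cmod (sig t) = 1.
Hypothesis sig_radial : forall t, 0 <= t -> forall e, 0 < e ->
  exists d, 0 < d < 1 /\ forall x, 0 < x < d ->
    Cmod (phi t (RtoC (1 - x) * tau)%C - sig t * RtoC (1 - dil lambda t * x)) <= e * x.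

Let cdev_radial (t : R) (Ht : 0 <= t) :
  cdev (at_right 0) (fun x => phi t (RtoC (1 - x) * tau)%C) (fun x => RtoC x)
    (sig t) (- (RtoC (dil lambda t) * sig t))%C.
Proof.
  intros e He. destruct (sig_radial t Ht e He) as [d [Hd K]].
  apply at_right_spec with d; [lra|]. intros x Hx. specialize (K x Hx).
  rewrite Cmod_R, Rabs_pos_eq by lra.
  replace (phi t (RtoC (1 - x) * tau)%C - sig t -
    - (RtoC (dil lambda t) * sig t) * RtoC x)%C with
    (phi t (RtoC (1 - x) * tau)%C - sig t * RtoC (1 - dil lambda t * x))%C
    by (rewrite (RtoC_minus 1 (dil lambda t * x)), RtoC_mult; ring).
  exact K.
Qed.

(** The points [phi s (r tau)] tend to [sig s] along a curve whose image under
    [phi t] is known to first order; comparing both expansions gives the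
    derivative of any extension of [phi t] at [sig s]. *)
Lemma extension_derivative (F : C -> C) (s t th : R) (D : C) : 0 <= s -> 0 <= t ->
  sig s = (tau * circ th)%C -> cdiff F (0, th) D -> F (0, th) = sig (t + s) ->
  (forall w, Re w < 0 -> F w = phi t (tau * cexp w)%C) ->
  D = (RtoC (dil lambda t) * F (0, th))%C.
Proof.
  intros S0 Ht SE DF F0 Fneg.
  assert (tu : Cmod tau = 1) by exact (tau_unit phi tau lambda dw).
  assert (Ds := cdev_radial s S0). assert (Hts : 0 <= t + s) by lra.
  assert (Dts := cdev_radial (t + s) Hts).
  set (zt := fun x => phi s (RtoC (1 - x) * tau)%C) in *.
  assert (Ns : sig s <> RtoC 0) by (apply Cmod_gt_0; rewrite sig_unit by exact S0; lra).
  (* [g] is the curve [zt] in the logarithmic coordinate, in which [F] is defined. *)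
  set (g := fun x => ((0, th) + clog (zt x / sig s))%C).
  assert (Lz : clim (at_right 0) zt (sig s)) by exact (cdev_lim _ _ _ _ _ clim_at_right_id Ds).
  assert (Lq : clim (at_right 0) (fun x => zt x / sig s)%C (RtoC 1)).
  { replace (RtoC 1) with (sig s * / sig s)%C by (field; exact Ns).
    apply clim_mult; [apply _|exact Lz|]. apply clim_const. apply _. }
  assert (Lg : clim (at_right 0) g (0, th)).
  { replace ((0, th) : C) with ((0, th) + RtoC 0)%C by ring. unfold g.
    apply clim_plus; [apply _|apply clim_const; apply _|].
    exact (clim_comp _ (fun x => zt x / sig s)%C clog _ _ Lq clim_clog_1). }
  assert (Eg : at_right 0 (fun x => (tau * cexp (g x))%C = zt x)).
  { generalize (Lq _ Rlt_0_1). apply filter_imp. intros x Hx. unfold g.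
    rewrite cexp_plus, cexp_clog.
    - replace (cexp (0, th)) with (circ th).
      + replace (tau * (circ th * (zt x / sig s)))%C with ((tau * circ th) * (zt x / sig s))%C by ring.
        rewrite <- SE. field. exact Ns.
      + unfold cexp, Re, Im; simpl. rewrite exp_0. ring.
    - assert (Q := Re_le_Cmod (zt x / sig s - 1)).
      replace (Re (zt x / sig s - 1)%C) with (Re (zt x / sig s)%C - 1) in Q
        by (unfold Re; simpl; ring).
      apply Rabs_le_between in Q. lra. }
  assert (c1 : (tau * cexp (0, th))%C = sig s).
  { rewrite SE. unfold cexp, Re, Im; simpl. rewrite exp_0. ring. }
  assert (Dg : cdev (at_right 0) g (fun x => RtoC x) (0, th)
    (- (RtoC (dil lambda s) * sig s) / sig s)%C).
  { apply (cdev_cancel (at_right 0) (fun w => tau * cexp w)%C); [|exact Ns|exact Lg|].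
    - rewrite <- c1. apply cdiff_scal, cdiff_cexp.
    - rewrite c1. apply (cdev_ext _ zt); [|exact Ds].
      revert Eg. apply filter_imp. intros x Hx. now rewrite Hx. }
  assert (DFg := cdev_comp _ F g _ _ _ _ clim_at_right_id DF Dg).
  assert (EFg : at_right 0 (fun x => F (g x) = phi (t + s) (RtoC (1 - x) * tau)%C)).
  { assert (Small : at_right 0 (fun x => 0 < x < 1))
      by (apply at_right_spec with 1; [lra|auto]).
    generalize (filter_and _ _ Eg Small). apply filter_imp. intros x [X1 X2].
    assert (Hdx : disc (RtoC (1 - x) * tau)%C) by (apply radial_disc; [exact tu|lra]).
    assert (Hzx : disc (zt x)) by (now apply (sg_self_map phi sg)).
    rewrite Fneg.
    - rewrite X1. unfold zt. symmetry. now apply (hom_add _ _ _ sg).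
    - apply exp_lt_inv. rewrite exp_0.
      replace (exp (Re (g x))) with (Cmod (tau * cexp (g x))).
      + rewrite X1. exact Hzx.
      + rewrite Cmod_mult, tu, Cmod_cexp. ring. }
  apply (cdev_ext _ _ _ _ _ _ EFg) in DFg. rewrite F0 in DFg.
  assert (Nu : at_right 0 (fun x => RtoC x <> RtoC 0)).
  { apply at_right_spec with 1; [lra|]. intros x Hx. apply RtoC_neq_0. lra. }
  assert (E := clim_unique _ _ _ _ (cdev_quot _ _ _ _ _ Nu DFg) (cdev_quot _ _ _ _ _ Nu Dts)).
  rewrite dil_plus, RtoC_mult in E.
  assert (Nd : RtoC (dil lambda s) <> RtoC 0).
  { apply RtoC_neq_0. assert (P := dil_pos lambda s). lra. }
  rewrite F0.
  replace D with (D * (- (RtoC (dil lambda s) * sig s) / sig s) * (- / RtoC (dil lambda s)))%C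
    by (field; split; assumption).
  rewrite E. field. exact Nd.
Qed.

(** Across an arc filled by the boundary orbit [phi t] extends by reflection.  On the
    arc the derivative of the extension is an angular derivative, of the constant
    modulus [dil t], and this is the equation of [euler_equation_fixes_zero]. *)
Theorem arc_fixes_zero (th0 eta t : R) : 0 < eta -> 0 <= t ->
  (forall th, Rabs (th - th0) < eta -> exists s, 0 <= s /\ sig s = (tau * circ th)%C) ->
  phi t (RtoC 0) = RtoC 0.
Proof.
  intros Heta Ht Harc.
  assert (tu : Cmod tau = 1) by exact (tau_unit phi tau lambda dw).
  assert (sm := sg_self_map phi sg t Ht).
  assert (Ex : forall th, exists s, Rabs (th - th0) < eta -> 0 <= s /\ sig s = (tau * circ th)%C).
  { intros th. destruct (Rlt_dec (Rabs (th - th0)) eta) as [L|L].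
    - destruct (Harc th L) as [s Hs]. exists s. auto.
    - exists 0. intros H. contradiction. }
  destruct (choice _ Ex) as [S HS].
  set (Sg := fun th => sig (t + S th)).
  set (f := fun w => phi t (tau * cexp w)%C).
  assert (Sg_unit : forall th, Rabs (th - th0) < eta -> Cmod (Sg th) = 1).
  { intros th Hth. apply sig_unit. destruct (HS th Hth). lra. }
  assert (in_disc := fun w => cexp_disc tau w tu).
  assert (K1 : forall x th, x < 0 -> Rabs (th - th0) < eta ->
    Cmod (Sg th - f (x, th)) ^ 2 <= - x).
  { intros x th Hx Hth. destruct (HS th Hth) as [S0 SE].
    assert (E1 : exp x < 1) by (rewrite <- exp_0; now apply exp_increasing).
    assert (E2 := exp_pos x). assert (E3 := exp_ineq1_le x).
    assert (K := sig_radial_unif phi tau lambda sg dw sig sig_unit sig_radial (S th) t (1 - exp x)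
      S0 Ht ltac:(lra)).
    replace (RtoC (1 - (1 - exp x)) * sig (S th))%C with (tau * cexp (x, th))%C in K.
    - fold (f (x, th)) in K. fold (Sg th) in K. lra.
    - rewrite SE. replace (1 - (1 - exp x)) with (exp x) by ring.
      unfold cexp, Re, Im; simpl. ring. }
  assert (fd : forall w, Re w < 0 -> exists l, cdiff f w l).
  { intros w Hw. eexists. apply (cdiff_comp (phi t) (fun w => tau * cexp w)%C).
    - apply cdiff_phi; auto.
    - apply cdiff_scal, cdiff_cexp. }
  destruct (schwarz_reflection f Sg th0 eta Heta fd Sg_unit K1) as [F [r [Hr [HF [Fneg F0]]]]].
  apply (euler_equation_fixes_zero (phi t) F tau (RtoC (dil lambda t)) th0 r); auto; try lra.
  - apply RtoC_neq_0. assert (P := dil_pos lambda t). lra.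
  - intros th Hth. destruct (HS th ltac:(lra)) as [S0 SE].
    apply (extension_derivative F (S th) t th); auto.
    apply (hol_ball_C_derive F (0, th0) r); [exact HF|].
    eapply Rle_lt_trans; [apply Cmod_pair_sub|].
    rewrite Rminus_eq_0, Rabs_R0, Rplus_0_l. exact Hth.
Qed.

End Arc.

(** * The Denjoy-Wolff point and the Berkson-Porta formula *)

Lemma sqr_le_small (X x e : R) : 0 <= X -> 0 < e -> X ^ 2 <= x -> x <= e * e / 16 -> X <= e / 4.
Proof. intros HX He H1 H2. nra. Qed.

(** For the boundary point [sig t] in place of [tau] on the left this is Julia's
    inequality.  If [sig] left [tau], it would sweep an arc by the intermediate
    value theorem, and by [arc_fixes_zero] all [phi u] would fix [0]. *)
Theorem horodiscs_invariant (phi : R -> C -> C) (tau : C) (lambda : R) :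
  semigroup phi -> ~ elliptic phi -> denjoy_wolff_spectral phi tau lambda ->
  exists d, 0 < d /\ forall t z, 0 <= t <= d -> disc z ->
    Cmod (tau - phi t z) ^ 2 * (1 - Cmod z ^ 2) <= Cmod (tau - z) ^ 2 * (1 - Cmod (phi t z) ^ 2).
Proof.
  intros sg ne dw.
  assert (tu : Cmod tau = 1) by exact (tau_unit phi tau lambda dw).
  destruct (boundary_orbit_exists phi tau lambda sg dw) as [sig [Su [SJ SR]]].
  assert (Z1 : (Cconj tau * tau)%C = RtoC 1).
  { assert (E := Cmod2_conj tau). rewrite tu, pow1 in E. rewrite Cmult_comm. now rewrite <- E. }
  assert (Z1' : (tau * Cconj tau)%C = RtoC 1) by (now rewrite Cmult_comm).
  assert (S0 : sig 0 = tau).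
  { symmetry. apply Cmod_sub_small_eq. intros e He.
    destruct (SR 0 (Rle_refl 0) (e / 2) ltac:(lra)) as [d [Hd K]].
    set (x := Rmin (d / 2) (1 / 2)). assert (Hx : 0 < x) by (apply Rmin_pos; lra).
    assert (x1 : x <= d / 2) by apply Rmin_l. assert (x2 : x <= 1 / 2) by apply Rmin_r.
    specialize (K x ltac:(lra)).
    rewrite (hom_zero _ _ _ sg) in K by (apply radial_disc; [exact tu|lra]).
    replace (dil lambda 0) with 1 in K by (unfold dil; rewrite Rmult_0_r, exp_0; reflexivity).
    rewrite Rmult_1_l in K.
    replace (RtoC (1 - x) * tau - sig 0 * RtoC (1 - x))%C with
      (RtoC (1 - x) * (tau - sig 0))%C in K by ring.
    rewrite Cmod_mult, Cmod_R, Rabs_pos_eq in K by lra.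
    assert (P := Cmod_ge_0 (tau - sig 0)). nra. }
  assert (Sc : forall t, rcont (fun s => sig (Rmax 0 s)) t).
  { intros t e He.
    set (x := Rmin 1 (e * e / 16)).
    assert (Hx : 0 < x) by (apply Rmin_pos; [lra|]; assert (0 < e * e) by (now apply Rmult_lt_0_compat); lra).
    assert (x1 : x <= 1) by apply Rmin_l. assert (x2 : x <= e * e / 16) by apply Rmin_r.
    set (z := (RtoC (1 - x) * tau)%C).
    assert (Hz : disc z) by (apply radial_disc; [exact tu|lra]).
    assert (cl : forall s, Cmod (sig (Rmax 0 s) - orbit phi z s) <= e / 4).
    { intros s. assert (P := Rmax_l 0 s).
      assert (K := sig_radial_unif phi tau lambda sg dw sig Su SR 0 (Rmax 0 s) x
        (Rle_refl 0) P ltac:(lra)).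
      rewrite Rplus_0_r, S0 in K. fold z in K.
      apply (sqr_le_small _ x); auto. apply Cmod_ge_0. }
    generalize (rcont_orbit phi sg z t Hz (e / 4) ltac:(lra)). apply filter_imp. intros s Hs.
    assert (A := cl s). assert (B := cl t). rewrite Cmod_sub_sym in B.
    assert (T1 := Cmod_sub_triangle (sig (Rmax 0 s)) (orbit phi z s) (sig (Rmax 0 t))).
    assert (T2 := Cmod_sub_triangle (orbit phi z s) (orbit phi z t) (sig (Rmax 0 t))). lra. }
  set (q := fun s => (Cconj tau * sig (Rmax 0 s))%C).
  assert (qc : forall t, rcont q t) by (intros t; apply rcont_mult; [apply rcont_const|apply Sc]).
  assert (qu : forall s, Re (q s) ^ 2 + Im (q s) ^ 2 = 1).
  { intros s. rewrite <- Cmod_sqr. unfold q. rewrite Cmod_mult, Cmod_conj, tu, Su by apply Rmax_l. ring. }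
  assert (q0 : q 0 = RtoC 1) by (unfold q; rewrite Rmax_left, S0 by lra; exact Z1).
  assert (qsig : forall s, 0 <= s -> sig s = (tau * q s)%C).
  { intros s Hs. unfold q. rewrite Rmax_right by exact Hs. rewrite Cmult_assoc, Z1'. ring. }
  destruct (qc 0 (1 / 2) ltac:(lra)) as [d0 Kd]. assert (Pd := cond_pos d0).
  assert (qpos : forall s, 0 <= s <= d0 / 2 -> 0 < Re (q s)).
  { intros s Hs. assert (B : Cmod (q s - q 0) < 1 / 2).
    { apply Kd. change (Rabs (s - 0) < d0). rewrite Rminus_0_r, Rabs_pos_eq; lra. }
    rewrite q0 in B. assert (Q := Re_le_Cmod (q s - 1)).
    change (Re (q s - 1)%C) with (Re (q s) - 1) in Q. apply Rabs_le_between in Q. lra. }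
  exists (d0 / 2). split; [lra|]. intros t z Ht Hz.
  destruct (Req_dec (Im (q t)) 0) as [E|E].
  - assert (Et : sig t = tau).
    { rewrite qsig by lra. replace (q t) with (RtoC 1); [ring|].
      assert (P := qpos t Ht). assert (Q := qu t). rewrite E in Q.
      apply Ceq; [|now rewrite E]. change (Re (RtoC 1)) with 1. nra. }
    assert (K := SJ t z (proj1 Ht) Hz). rewrite Et in K. eapply Rle_trans; [exact K|].
    assert (F := disc_sqr (phi t z) (proj2 (sg_self_map phi sg t (proj1 Ht)) z Hz)).
    assert (D1 := dil_pos lambda t). assert (D2 := dil_le_1 phi tau lambda dw t (proj1 Ht)).
    apply Rmult_le_compat_r; [lra|]. rewrite <- (Rmult_1_l (Cmod (tau - z) ^ 2)) at 2.
    apply Rmult_le_compat_r; [apply pow2_ge_0|exact D2].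
  - exfalso. apply ne. exists (RtoC 0). split.
    { unfold disc. rewrite Cmod_0. lra. }
    set (v1 := Im (q t)) in *.
    assert (V1 : -1 <= v1 <= 1).
    { assert (Q := qu t). fold v1 in Q. assert (0 <= Re (q t) ^ 2) by apply pow2_ge_0. nra. }
    (* By connectedness [Im q] takes every value between [0] and [v1].  An angle of
       sine [v1 / 2] therefore has a neighbourhood of angles all reached by [q], which
       stays in the right half-plane where the sine determines the point. *)
    set (th0 := asin (v1 / 2)).
    assert (sin0 : sin th0 = v1 / 2) by (apply sin_asin; lra).
    assert (cos0 : 0 < cos th0).
    { unfold th0. rewrite cos_asin by lra. apply sqrt_lt_R0. unfold Rsqr. nra. }
    assert (Av : 0 < Rabs v1) by now apply Rabs_pos_lt.
    assert (Hv4 : 0 < Rabs v1 / 4) by lra.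
    destruct (rcont_Im _ _ (rcont_circ th0) (fun y => Rabs (y - sin th0) < Rabs v1 / 4)) as [e1 K1].
    { exists (mkposreal _ Hv4). intros y Hy. exact Hy. }
    destruct (rcont_Re _ _ (rcont_circ th0) (fun y => Rabs (y - cos th0) < cos th0)) as [e2 K2].
    { exists (mkposreal _ cos0). intros y Hy. exact Hy. }
    assert (P1 := cond_pos e1). assert (P2 := cond_pos e2).
    assert (Hm : 0 < Rmin e1 e2) by now apply Rmin_pos.
    intros u Hu.
    apply (arc_fixes_zero phi tau lambda sg dw sig Su SR th0 (Rmin e1 e2) u Hm Hu).
    intros th Hth.
    assert (M1 := Rmin_l e1 e2). assert (M2 := Rmin_r e1 e2).
    assert (A1 : Rabs (sin th - v1 / 2) < Rabs v1 / 4).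
    { rewrite <- sin0. apply (K1 th). change (Rabs (th - th0) < e1). lra. }
    assert (A2 : 0 < cos th).
    { assert (H : Rabs (cos th - cos th0) < cos th0)
        by (apply (K2 th); change (Rabs (th - th0) < e2); lra).
      apply Rabs_lt_between in H. lra. }
    assert (Cv : continuity (fun s => Im (q s))).
    { intros s. apply continuity_pt_filterlim. apply rcont_Im, qc. }
    destruct (IVT_gen (fun s => Im (q s)) 0 t (sin th) Cv) as [s [Hs1 Hs2]].
    { rewrite q0. change (Im (RtoC 1)) with 0. fold v1. apply Rabs_lt_between in A1.
      unfold Rabs in A1. destruct (Rcase_abs v1).
      - rewrite Rmin_right, Rmax_left; lra.
      - rewrite Rmin_left, Rmax_right; lra. }
    rewrite Rmin_left, Rmax_right in Hs1 by lra.
    exists s. split; [lra|]. rewrite qsig by lra. f_equal.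
    apply Ceq; [|exact Hs2]. change (Re (circ th)) with (cos th).
    assert (Q := qu s). rewrite Hs2 in Q. assert (Pq := qpos s ltac:(lra)).
    assert (T := sin2_cos2 th). unfold Rsqr in T.
    apply Rsqr_inj; [lra|lra|]. unfold Rsqr. nra.
Qed.

Lemma cdev_conj_real (F : (R -> Prop) -> Prop) {FF : Filter F} (g : R -> C) (u : R -> R) (g0 l : C) :
  cdev F g (fun s => RtoC (u s)) g0 l ->
  cdev F (fun s => Cconj (g s)) (fun s => RtoC (u s)) (Cconj g0) (Cconj l).
Proof.
  intros H e He. generalize (H e He). apply filter_imp. intros s Hs.
  replace (Cconj (g s) - Cconj g0 - Cconj l * RtoC (u s))%C with
    (Cconj (g s - g0 - l * RtoC (u s)))%C.
  - now rewrite Cmod_conj.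
  - rewrite !Cminus_conj, Cmult_conj. f_equal. f_equal.
    apply Ceq; unfold Re, Im; simpl; ring.
Qed.

Lemma Cmod_sqr_C (z : C) : RtoC (Cmod z ^ 2) = (z * Cconj z)%C.
Proof. exact (Cmod2_conj z). Qed.

(** Differentiating the invariance of the horodiscs at [t = 0]: the derivative of
    the difference of both sides is [2 |z - tau|^4 Re p]. *)
Theorem berkson_porta_nonneg (phi : R -> C -> C) (tau z g p : C) (d : R) :
  Cmod tau = 1 -> disc z -> 0 < d -> phi 0 z = z -> tdiff (fun s => phi s z) 0 g ->
  (forall t, 0 <= t <= d ->
    Cmod (tau - phi t z) ^ 2 * (1 - Cmod z ^ 2) <= Cmod (tau - z) ^ 2 * (1 - Cmod (phi t z) ^ 2)) ->
  g = ((z - tau) * (Cconj tau * z - 1) * p)%C -> 0 <= Re p.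
Proof.
  intros tu Hz Hd P0 Hg HJ Ep.
  assert (Z1 : (tau * Cconj tau)%C = RtoC 1).
  { rewrite <- Cmod_sqr_C, tu. f_equal. ring. }
  assert (Nz : 0 < Cmod (tau - z)).
  { apply Cmod_pos_sub. intros E. unfold disc in Hz. rewrite <- E in Hz. lra. }
  set (N := RtoC (Cmod (tau - z) ^ 2)). set (m := RtoC (1 - Cmod z ^ 2)).
  set (Phi := fun s => (N * (1 - phi s z * Cconj (phi s z)) -
    m * ((tau - phi s z) * Cconj (tau - phi s z)))%C).
  assert (PhiR : forall s, Phi s = RtoC (Cmod (tau - z) ^ 2 * (1 - Cmod (phi s z) ^ 2) -
    Cmod (tau - phi s z) ^ 2 * (1 - Cmod z ^ 2))).
  { intros s. unfold Phi, N, m. rewrite <- !Cmod_sqr_C.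
    rewrite (RtoC_minus (_ * _)), !RtoC_mult, !RtoC_minus. ring. }
  set (u := fun s => s - 0).
  assert (cu := clim_time_displacement 0).
  assert (Dc : cdev (time_filter 0) (fun s => Cconj (phi s z)) (fun s => RtoC (u s))
    (Cconj (phi 0 z)) (Cconj g)).
  { apply (cdev_conj_real (time_filter 0) (fun s => phi s z)). exact Hg. }
  assert (Dt : cdev (time_filter 0) (fun s => tau - phi s z)%C (fun s => RtoC (u s))
    (tau - phi 0 z)%C (RtoC 0 - g)%C).
  { apply cdev_minus; [apply _|apply (cdev_const (time_filter 0))|exact Hg]. }
  assert (Dtc := cdev_conj_real (time_filter 0) (fun s => tau - phi s z)%C u _ _ Dt).
  assert (D1 := cdev_mult (time_filter 0) _ _ _ _ _ _ _ cu Hg Dc).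
  assert (D2 := cdev_mult (time_filter 0) _ _ _ _ _ _ _ cu Dt Dtc).
  assert (D3 := cdev_minus (time_filter 0) _ _ _ _ _ _ _
    (cdev_scal (time_filter 0) N _ _ _ _ (cdev_minus (time_filter 0) _ _ _ _ _ _ _
      (cdev_const (time_filter 0) _ (RtoC 1)) D1))
    (cdev_scal (time_filter 0) m _ _ _ _ D2)).
  match type of D3 with cdev _ _ _ ?a ?b => set (L := b) in D3; set (V := a) in D3 end.
  change (cdev (time_filter 0) Phi (fun s => RtoC (u s)) V L) in D3.
  assert (V0 : V = RtoC 0).
  { change V with (Phi 0). rewrite PhiR, P0. f_equal. ring. }
  rewrite V0 in D3.
  assert (PF := within_locally'_proper 0 (Rle_refl 0)).
  assert (Lim : clim (within (Rle 0) (locally' 0)) (fun s => (Phi s - 0) / RtoC (u s))%C L).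
  { apply cdev_quot; [apply _| |].
    - exists (mkposreal 1 Rlt_0_1). intros s _ Hs _. apply RtoC_neq_0. unfold u. lra.
    - intros e He. apply within_locally'_le. now apply D3. }
  assert (RL : 0 <= Re L).
  { apply Rnot_lt_le. intros Lneg. assert (Hp : 0 < - Re L) by lra.
    assert (Sm : within (Rle 0) (locally' 0) (fun s => 0 < s < d)).
    { exists (mkposreal d Hd). intros s Hs Hs1 Hs2. change (Rabs (s - 0) < d) in Hs.
      rewrite Rminus_0_r, Rabs_pos_eq in Hs by exact Hs2. lra. }
    destruct (filter_ex (F := within (Rle 0) (locally' 0)) _ (filter_and _ _ (Lim _ Hp) Sm))
      as [s [S1 S2]].
    rewrite PhiR in S1. unfold u in S1. rewrite Rminus_0_r in S1.
    set (k := Cmod (tau - z) ^ 2 * (1 - Cmod (phi s z) ^ 2) -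
      Cmod (tau - phi s z) ^ 2 * (1 - Cmod z ^ 2)) in *.
    assert (Hk : 0 <= k) by (unfold k; assert (J := HJ s ltac:(lra)); lra).
    replace ((RtoC k - 0) / RtoC s)%C with (RtoC (k / s)) in S1
      by (rewrite RtoC_div by lra; field; apply RtoC_neq_0; lra).
    assert (Q := Re_le_Cmod (RtoC (k / s) - L)).
    change (Re (RtoC (k / s) - L)%C) with (k / s - Re L) in Q.
    assert (0 <= k / s) by (apply Rmult_le_pos; [exact Hk|left; apply Rinv_0_lt_compat; lra]).
    rewrite Rabs_pos_eq in Q by lra. lra. }
  assert (EL : L = (RtoC (Cmod (tau - z) ^ 2 * Cmod (tau - z) ^ 2) * (p + Cconj p))%C).
  { assert (key : ((Cconj tau * z - 1) * (tau * Cconj z - 1) = (tau - z) * (Cconj tau - Cconj z))%C).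
    { transitivity (1 - Cconj tau * z - tau * Cconj z + (tau * Cconj tau) * (z * Cconj z))%C; [ring|].
      transitivity (tau * Cconj tau - Cconj tau * z - tau * Cconj z + z * Cconj z)%C; [|ring].
      rewrite Z1. ring. }
    assert (EN : N = ((tau - z) * (Cconj tau - Cconj z))%C).
    { unfold N. now rewrite Cmod_sqr_C, Cminus_conj. }
    assert (Em : m = (1 - z * Cconj z)%C) by (unfold m; now rewrite RtoC_minus, Cmod_sqr_C).
    assert (E0 : Cconj (RtoC 0 - g) = (- Cconj g)%C) by (rewrite Cminus_conj; apply Ceq; unfold Re, Im; simpl; ring).
    assert (Eg : Cconj g = ((Cconj z - Cconj tau) * (tau * Cconj z - 1) * Cconj p)%C).
    { rewrite Ep, !Cmult_conj, !Cminus_conj, Cmult_conj, Cconj_conj.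
      replace (Cconj (RtoC 1)) with (RtoC 1) by (apply Ceq; unfold Re, Im; simpl; ring). reflexivity. }
    rewrite RtoC_mult. fold N. unfold L. rewrite P0, E0, Cminus_conj.
    transitivity (N * ((Cconj tau * z - 1) * (tau * Cconj z - 1)) * (p + Cconj p))%C.
    - rewrite Em, EN, Eg, Ep. ring.
    - rewrite key, <- EN. reflexivity. }
  assert (ER : Re L = Cmod (tau - z) ^ 2 * Cmod (tau - z) ^ 2 * (2 * Re p)).
  { rewrite EL, re_scal_l, re_plus, re_conj. ring. }
  rewrite ER in RL.
  assert (PN : 0 < Cmod (tau - z) ^ 2 * Cmod (tau - z) ^ 2)
    by (apply Rmult_lt_0_compat; now apply pow_lt).
  apply Rnot_lt_le. intros Lp.
  assert (Cmod (tau - z) ^ 2 * Cmod (tau - z) ^ 2 * (2 * Re p) < 0) by nra. lra.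
Qed.

Theorem theorem4p8 (phi : R -> C -> C) (tau : C)
  (phi_semigroup : semigroup phi)
  (phi_non_elliptic : ~ elliptic phi)
  (tau_dw : denjoy_wolff_point phi tau) :
  real_analytic_on (fun t z => 0 <= t /\ disc z) phi /\
  exists G : C -> C,
    generates G phi /\
    (forall G' : C -> C, generates G' phi -> forall z, disc z -> G' z = G z) /\
    forall h : C -> C, koenigs_function phi h ->
      (forall z, disc z ->
         C_derive h z <> RtoC 0 /\ G z = (Ci / C_derive h z)%C) /\
      let p := fun z : C =>
        (Ci / (C_derive h z * (z - tau) * (Cconj tau * z - 1)))%C in
      forall z, disc z ->
        G z = ((z - tau) * (Cconj tau * z - 1) * p z)%C /\ 0 <= Re (p z).
Proof.
  split; [now apply flow_real_analytic|].
  destruct (generator_exists phi phi_semigroup) as [G [HG HD]].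
  assert (P0 : forall z, disc z -> phi 0 z = z)
    by (intros z Hz; now apply (hom_zero _ _ _ phi_semigroup)).
  assert (HD0 : forall z, disc z -> tdiff (fun s => phi s z) 0 (G z)).
  { intros z Hz. assert (K := HD 0 z (Rle_refl 0) Hz). now rewrite P0 in K. }
  destruct tau_dw as [lambda dw].
  assert (tu : Cmod tau = 1) by exact (tau_unit phi tau lambda dw).
  exists G. split; [|split].
  - split.
    + intros z Hz. destruct (HG z (proj1 (disc_inball z) Hz)) as [l Hl].
      exists l. now apply cdiff_is_derive.
    + intros t z Ht Hz. apply tdiff_time_derivative; auto.
  - intros G' [_ HG'] z Hz.
    apply (time_derivative_unique (fun s => phi s z) 0); [lra| |].
    + assert (K := HG' 0 z (Rle_refl 0) Hz). now rewrite P0 in K.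
    + apply tdiff_time_derivative; [lra|now apply HD0].
  - intros h [lam [Om [_ [_ hm]]]].
    (* The chain rule at time [0] for [h (phi s z) = h z + i s]; it also shows that
       [h'] has no zeros. *)
    assert (Hh : forall z, disc z -> (C_derive h z * G z)%C = Ci).
    { intros z Hz.
      assert (Dh := proj1 (holomorphic_cdiff disc h) (model_holomorphic _ _ _ _ hm) z Hz).
      apply (tdiff_unique (fun s => h (phi s z)) 0); [lra| |].
      - apply (cdev_comp (time_filter 0) h (fun s => phi s z)).
        + apply clim_time_displacement.
        + rewrite P0 by exact Hz. exact Dh.
        + now apply HD0.
      - unfold tdiff.
        apply (cdev_ext (time_filter 0) (fun s => h z + Ci * RtoC (s - 0))%C).
        + apply time_filter_spec. exists 1. split; [lra|]. intros s Hs _.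
          rewrite Rminus_0_r. symmetry. now apply (model_intertwines _ _ _ _ hm).
        + rewrite P0 by exact Hz. apply (cdev_affine (time_filter 0)). }
    assert (Nh : forall z, disc z -> C_derive h z <> RtoC 0).
    { intros z Hz E. specialize (Hh z Hz). rewrite E in Hh. apply Ci_nz. rewrite <- Hh. ring. }
    assert (Gh : forall z, disc z -> G z = (Ci / C_derive h z)%C).
    { intros z Hz. rewrite <- (Hh z Hz). field. now apply Nh. }
    split; [now split; [apply Nh|apply Gh]|].
    intros p z Hz.
    assert (Nz : z <> tau).
    { intros ->. unfold disc in Hz. lra. }
    assert (N1 : (z - tau)%C <> RtoC 0) by now apply Cminus_eq_contra.
    assert (N2 : (Cconj tau * z - 1)%C <> RtoC 0).
    { intros E. apply (blaschke_neq_0 z tau); [lra|exact Hz|].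
      replace (1 - Cconj tau * z)%C with (- (Cconj tau * z - 1))%C by ring. rewrite E. ring. }
    assert (Gp : G z = ((z - tau) * (Cconj tau * z - 1) * p z)%C).
    { rewrite Gh by exact Hz. unfold p. field. repeat split; auto. }
    split; [exact Gp|].
    destruct (horodiscs_invariant phi tau lambda phi_semigroup phi_non_elliptic dw) as [d [Hd J]].
    apply (berkson_porta_nonneg phi tau z (G z) (p z) d); auto.
Qed.
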